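(* Let $n$ be a nonzero integer with $3\mid n$, write $n=3n'$, let $D=-3n^2=-27n'^2$, and let $p_1,\dots,p_s$ be the prime factors of $n'$. Let $r$ be the rank of $E^{-27D}(\mathbb{Q})$, let $P_0=(0,\sqrt{-27D})$ and let $P_1,\dots,P_r$ be generators of the free part of $E^{-27D}(\mathbb{Q})$. Let $\mathcal{M}$ be the $(r+1)\times s$ matrix over $\mathbb{F}_3$ whose rows are the coefficient vectors $(\overline{\lambda}^i_1,\dots,\overline{\lambda}^i_s)$ of $P_i$, $i=0,\dots,r$, and let $V\subseteq\mathbb{F}_3^{s}$ be the vector space generated by the rows of $\mathcal{M}$. Then $E^{-27D}(\mathbb{Q})/\phi_D(E^D(\mathbb{Q}))$ is isomorphic to $V$ as an $\mathbb{F}_3$-vector space. Moreover, the assignment $$\langle(\overline{\lambda}_1,\dots,\overline{\lambda}_s)\rangle\longmapsto\mathbb{Q}\left(\sqrt[3]{p_1^{\lambda_1}\cdots p_s^{\lambda_s}}\right)$$ is a bijection from the set of subspaces $\langle(\overline{\lambda}_1,\dots,\overline{\lambda}_s)\rangle\subseteq V$ (each generated by one vector) such that $\overline{\lambda}_i\neq0$ for $i=1,\dots,s$ and $p_1^{\lambda_1}\cdots p_s^{\lambda_s}\not\equiv\pm1\pmod 9$, to the set of quasi-monogenic cubic number fields of discriminant $D$ (up to isomorphism). Here $\lambda_i\in\{0,1,2\}$ is the lift of $\overline{\lambda}_i$.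
   Context: For $k\in\mathbb{Q}\setminus\{0\}$, $E^k$ denotes the elliptic curve $Y^2=4X^3+k$ over $\mathbb{Q}$. The 3-isogeny $\phi_D:E^D\to E^{-27D}$, $\phi_D(x,y)=\left(\frac{x^3+D}{x^2},\frac{y(x^3-2D)}{x^3}\right)$, has kernel $E^D[\phi_D]=\{\mathcal{O},\pm P_D\}$, $P_D=(0,\sqrt{D})$. Let $\delta:E^{-27D}(\mathbb{Q})\to H^1(\mathbb{Q},E^D[\phi_D])$ be the connecting map $P\mapsto[\sigma\mapsto Q^\sigma-Q]$, where $\phi_D(Q)=P$; its kernel is $\phi_D(E^D(\mathbb{Q}))$. Let $\zeta_3$ be a primitive cube root of unity and, for $1\le i\le s$, let $f_i:\mathrm{Gal}(\overline{\mathbb{Q}}/\mathbb{Q})\to\mathbb{F}_3$ be $f_i(\sigma)=\log_{\zeta_3}\left(\sigma(\sqrt[3]{p_i})/\sqrt[3]{p_i}\right)$. For every $P\in E^{-27D}(\mathbb{Q})$, the class $\delta(P)$ is represented by a cocycle $(\overline{\lambda}_1f_1+\cdots+\overline{\lambda}_sf_s)P_D$ with uniquely determined $\overline{\lambda}_i\in\mathbb{F}_3$; $(\overline{\lambda}_1,\dots,\overline{\lambda}_s)$ is called the coefficient vector of $P$. A cubic number field $L$ is quasi-monogenic if $I(X,Y)=\pm1$ has a solution in $\mathbb{Q}^2$, where $I$ is its index form: for a $\mathbb{Z}$-basis $\{1,\omega_2,\omega_3\}$ of $\mathcal{O}_L$, $1\wedge\gamma\wedge\gamma^2=I(x_2,x_3)\,(1\wedge\omega_2\wedge\omega_3)$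 for $\gamma=x_1+x_2\omega_2+x_3\omega_3$ (this property does not depend on the basis).
   Formalization: The bijection (''Moreover'') is stated only for squarefree n'; as written it fails, e.g. n=12, n'=4, D=-432: V=F_3 and the line sent to Q(cbrt 2) is admissible, but that field has discriminant -108, and no cubic field has discriminant -27n'^2 when n' is not squarefree. *)

(* Defs.v *)
From HB Require Import structures.
From mathcomp Require Import all_boot all_order all_algebra all_field.
From mathcomp Require Import ring.

Set Implicit Arguments.
Unset Strict Implicit.
Unset Printing Implicit Defensive.

Import Order.TTheory GRing.Theory Num.Theory.
Local Open Scope ring_scope.

Section Curve.
Variables (k : rat) (F : numFieldType).
Implicit Types (x y l : F) (u v : option (F * F)).

(* [None] is the point at infinity. *)
Definition on_curve u : bool :=
  if u is Some (x, y) then y ^+ 2 == 4 * x ^+ 3 + ratr k else true.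

Record ell := Ell { coords : option (F * F); coordsP : on_curve coords }.

HB.instance Definition _ := [isSub for coords].
HB.instance Definition _ := [Equality of ell by <:].

Definition opp_raw u := if u is Some (x, y) then Some (x, - y) else None.

(* Only used for two points of the curve that are not opposite: then x1 = x2
   means that they are equal, and the line is the tangent there. *)
Definition slope x1 y1 x2 y2 : F :=
  if x1 == x2 then 6 * x1 ^+ 2 / y1 else (y2 - y1) / (x2 - x1).

(* The roots of 4 X^3 + k - (y1 + l (X - x1))^2 have sum l^2 / 4. *)
Definition add_raw u v :=
  match u, v with
  | None, _ => v
  | _, None => u
  | Some (x1, y1), Some (x2, y2) =>
      if (x1 == x2) && (y1 == - y2) then None
      else let l := slope x1 y1 x2 y2 in
           let x3 := l ^+ 2 / 4 - x1 - x2 in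
           Some (x3, - (y1 + l * (x3 - x1)))
  end.

Lemma opp_rawP u : on_curve u -> on_curve (opp_raw u).
Proof. by case: u => [[x y]|] //=; rewrite sqrrN. Qed.

Lemma slopeP x1 y1 x2 y2 :
    on_curve (Some (x1, y1)) -> on_curve (Some (x2, y2)) ->
    ~~ ((x1 == x2) && (y1 == - y2)) ->
  let l := slope x1 y1 x2 y2 in
  l * (2 * y1 + l * (x2 - x1)) = 4 * (x1 ^+ 2 + x1 * x2 + x2 ^+ 2).
Proof.
move=> /= /eqP e1 /eqP e2; rewrite /slope.
have [eqx /= nopp|neq _] := eqVneq x1 x2; last first.
  have d0 : x2 - x1 != 0 by rewrite subr_eq0 eq_sym.
  rewrite divfK //; apply: (mulIf d0); rewrite mulrAC divfK //.
  transitivity (y2 ^+ 2 - y1 ^+ 2); first by ring.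
  by rewrite e1 e2; ring.
have y10 : y1 != 0.
  apply: contraNneq nopp => y10; move: e1; rewrite y10 expr0n /= eqx -e2.
  by move/esym/eqP; rewrite expf_eq0 /= => /eqP->; rewrite oppr0.
by rewrite -eqx; field.
Qed.

Lemma add_rawP u v : on_curve u -> on_curve v -> on_curve (add_raw u v).
Proof.
case: u v => [[x1 y1]|] // [[x2 y2]|] // h1 h2; rewrite /add_raw.
case: ifPn => // nopp; have := slopeP h1 h2 nopp.
set l := slope _ _ _ _ => /= hl.
pose x3 := l ^+ 2 / 4 - x1 - x2; rewrite -/x3 sqrrN -subr_eq0.
have hx : l ^+ 2 = 4 * (x1 + x2 + x3).
  by rewrite /x3; field.
move: h1 => /= /eqP h1.
have -> : ratr k = y1 ^+ 2 - 4 * x1 ^+ 3 by rewrite h1; ring.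
have -> : (y1 + l * (x3 - x1)) ^+ 2 - (4 * x3 ^+ 3 + (y1 ^+ 2 - 4 * x1 ^+ 3))
  = (x3 - x1) * (l * (2 * y1 + l * (x2 - x1)) + l ^+ 2 * (x3 - x2)
     - 4 * (x3 ^+ 2 + x3 * x1 + x1 ^+ 2)) by ring.
by rewrite hl hx; apply/eqP; ring.
Qed.

Definition ell0 : ell := @Ell None isT.
Definition ell_opp (X : ell) : ell := Ell (opp_rawP (coordsP X)).
Definition ell_add (X Y : ell) : ell := Ell (add_rawP (coordsP X) (coordsP Y)).
Definition ell_sub (X Y : ell) : ell := ell_add X (ell_opp Y).
Definition ell_muln (X : ell) (n : nat) : ell := iter n (ell_add X) ell0.
Definition ell_mulz (X : ell) (c : int) : ell :=
  if c is Negz n then ell_opp (ell_muln X n.+1) else ell_muln X `|c|%N.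

Definition torsion (X : ell) : Prop := exists2 n, (0 < n)%N & ell_muln X n = ell0.

Definition int_comb r (P : 'I_r -> ell) (c : 'I_r -> int) : ell :=
  \big[ell_add/ell0]_(i < r) ell_mulz (P i) (c i).

(* [P] induces a Z-basis of the group of points modulo torsion; in particular
   [r] is the rank. *)
Definition free_part_generators r (P : 'I_r -> ell) : Prop :=
  (forall X, exists T (c : 'I_r -> int), torsion T /\ X = ell_add T (int_comb P c))
  /\ (forall c : 'I_r -> int, torsion (int_comb P c) -> forall i, c i = 0).

Lemma zero_pointP y : y ^+ 2 = ratr k -> on_curve (Some (0, y)).
Proof. by move=> /= ->; rewrite expr0n mulr0 add0r. Qed.

Definition zero_point y (hy : y ^+ 2 = ratr k) : ell := Ell (zero_pointP hy).

End Curve.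

Arguments ell0 {k F}.

(* Functoriality in the field; for an automorphism this is the Galois action. *)
Section BaseChange.
Variables (k : rat) (F F' : numFieldType) (f : {rmorphism F -> F'}).

Definition map_raw (u : option (F * F)) : option (F' * F') :=
  if u is Some (x, y) then Some (f x, f y) else None.

Lemma map_rawP u : on_curve k u -> on_curve k (map_raw u).
Proof.
case: u => [[x y]|] //= /eqP e; apply/eqP.
by rewrite -rmorphXn e rmorphD rmorphM rmorphXn /= rmorph_nat fmorph_rat.
Qed.

Definition ell_map (X : ell k F) : ell k F' := Ell (map_rawP (coordsP X)).

End BaseChange.

Section Isogeny.
Variables (D : rat) (F : numFieldType).

Definition isog_raw (u : option (F * F)) : option (F * F) :=
  if u is Some (x, y) then
    if x == 0 then None
    else Some ((x ^+ 3 + ratr D) / x ^+ 2,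
               y * (x ^+ 3 - 2 * ratr D) / x ^+ 3)
  else None.

Lemma isog_rawP u : on_curve D u -> on_curve (- 27 * D) (isog_raw u).
Proof.
case: u => [[x y]|] //= /eqP e; case: eqVneq => //= x0; apply/eqP.
rewrite rmorphM rmorphN /= ratr_nat !exprMn e.
by field.
Qed.

Definition isog (X : ell D F) : ell (- 27 * D) F := Ell (isog_rawP (coordsP X)).

End Isogeny.

Section Coefficients.

(* [algC] is the algebraic closure of Q.  Being algebraic over Q, its ring
   endomorphisms are automorphisms, so they form Gal(Qbar / Q). *)
Definition galQ := {rmorphism algC -> algC}.

Variable D : rat.

Definition in_kernel (T : ell D algC) : Prop := isog T = ell0.

(* Equality in H^1(Q, E^D[phi_D]). *)
Definition cohomologous (c c' : galQ -> ell D algC) : Prop :=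
  exists2 T, in_kernel T &
    forall g : galQ, ell_sub (c g) (c' g) = ell_sub (ell_map g T) T.

(* The class [delta X] is represented by [c]. *)
Definition delta_represented (X : ell (- 27 * D) rat) (c : galQ -> ell D algC) :
    Prop :=
  exists2 Q : ell D algC, isog Q = ell_map (ratr : {rmorphism rat -> algC}) X
    & cohomologous c (fun g : galQ => ell_sub (ell_map g Q) Q).

Definition P_D : ell D algC := zero_point (sqrtCK (ratr D)).

Definition log3 (zeta u : algC) : 'F_3 :=
  odflt 0 [pick e : 'F_3 | zeta ^+ e == u].

(* [3.-root p%:R] is the positive real cube root of [p]. *)
Definition kummer_char (zeta : algC) (p : nat) (g : galQ) : 'F_3 :=
  log3 zeta (g (3.-root p%:R) / 3.-root p%:R).

Definition is_coef_vector (zeta : algC) s (p : s.-tuple nat)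
    (X : ell (- 27 * D) rat) (lam : 'rV['F_3]_s) : Prop :=
  delta_represented X
    (fun g => ell_muln P_D
       (\sum_(i < s) lam 0 i * kummer_char zeta (tnth p i) g : 'F_3)%R).

(* An isomorphism from E^{-27D}(Q) / phi_D(E^D(Q)) onto [V], as a map on
   representatives that identifies exactly the points of the same coset. *)
Definition cokernel_iso (vT : vectType 'F_3) (V : {vspace vT}) : Prop :=
  exists f : ell (- 27 * D) rat -> vT,
    [/\ forall X Y,
          f X = f Y <-> exists R : ell D rat, ell_sub X Y = isog R,
        forall v, v \in V <-> exists X, f X = v,
        forall X Y, f (ell_add X Y) = f X + f Y
      & forall (a : 'F_3) X, f (ell_muln X a) = a *: f X].

End Coefficients.

Section NumberField.
Variable L : fieldExtType rat.

Definition algebraic_integer (x : L) : Prop := integralOver (intr : int -> L) x.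

Definition integral_basis n (w : n.-tuple L) : Prop :=
  free w /\ forall x : L,
    algebraic_integer x <-> exists c : 'I_n -> int, x = \sum_(i < n) w`_i *~ c i.

Definition field_trace (x : L) : rat :=
  let b := vbasis {:L} in \sum_(i < \dim {:L}) coord b i (x * b`_i).

Definition has_discriminant (d : rat) : Prop :=
  exists n (w : n.-tuple L), integral_basis w /\
    \det (\matrix_(i < n, j < n) field_trace (w`_i * w`_j)) = d.

(* The factor between the wedge of 1, g, g^2 and that of w, where
   g = x2 w_2 + x3 w_3; adding to g a rational constant does not change it. *)
Definition index_form (w : 3.-tuple L) (x2 x3 : rat) : rat :=
  let g := x2 *: w`_1 + x3 *: w`_2 in
  \det (\matrix_(i < 3, j < 3) coord w j (g ^+ i)).

Definition quasi_monogenic : Prop :=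
  exists w : 3.-tuple L, [/\ integral_basis w, w`_0 = 1 &
    exists x2 x3 : rat, index_form w x2 x3 = 1 \/ index_form w x2 x3 = - 1].

End NumberField.

Definition field_iso (L L' : fieldExtType rat) : Prop :=
  exists f : {rmorphism L -> L'}, bijective f.

Definition quasi_monogenic_cubic (D : rat) (L : fieldExtType rat) : Prop :=
  [/\ \dim {:L} = 3%N, quasi_monogenic L & has_discriminant L D].

(* [R U L] says that [L] is in the isomorphism class of fields attached to [U];
   [R] is a bijection from [A] to the isomorphism classes of fields in [B]. *)
Definition bijection_up_to_iso (T : Type) (A : T -> Prop)
    (B : fieldExtType rat -> Prop) (R : T -> fieldExtType rat -> Prop) : Prop :=
  [/\ forall U, A U -> exists L, R U L,
      forall U L L', A U -> R U L -> (R U L' <-> field_iso L L'),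
      forall U L, A U -> R U L -> B L,
      forall U U' L, A U -> A U' -> R U L -> R U' L -> U = U'
    & forall L, B L -> exists2 U, A U & R U L].

(* The field generated over Q by the real cube root of [m], with its embedding
   in [algC] as part of [num_field_exists]. *)
Definition cube_root_field (m : nat) : fieldExtType rat :=
  projT1 (num_field_exists [:: 3.-root (m%:R : algC)]).

Section Subspaces.
Variables (s : nat) (p : s.-tuple nat).

(* The coercion of ['F_3] to [nat] is the lift to {0, 1, 2}. *)
Definition lift_prod (lam : 'rV['F_3]_s) : nat :=
  (\prod_(i < s) tnth p i ^ lam 0%R i)%N.

Definition admissible_vector (lam : 'rV['F_3]_s) : Prop :=
  [/\ forall i, lam 0 i != 0, (lift_prod lam != 1 %[mod 9])%Z
    & (lift_prod lam != -1 %[mod 9])%Z].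

Definition admissible_subspace (V U : {vspace 'rV['F_3]_s}) : Prop :=
  (U <= V)%VS /\ exists2 lam, U = <[lam]>%VS & admissible_vector lam.

(* Any generator of [U] may be used. *)
Definition subspace_field (U : {vspace 'rV['F_3]_s}) (L : fieldExtType rat) :
    Prop :=
  exists2 lam, U = <[lam]>%VS & field_iso (cube_root_field (lift_prod lam)) L.

End Subspaces.

Definition squarefree_int (m : int) : Prop :=
  forall q : nat, prime q -> ~~ (q ^ 2 %| `|m|)%N.

(* Main.v *)
From HB Require Import structures.
Require Import Defs.
From mathcomp Require Import all_boot all_order all_algebra all_field.
From mathcomp Require Import ring lra zify.

(* Put N = |n'|, so that D = -27 N^2, and let kappa send a point (x, y) of
   E^{-27D} : y^2 = 4x^3 + (27N)^2 to the class of 4(y - 27N) modulo cubes.  Its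
   valuations modulo 3 at the primes dividing N are, up to a sign, the coefficient
   vector, because kappa becomes the cube of (y - 9N)/x on the source of the
   isogeny; so kappa embeds the cokernel, and torsion only contributes multiples
   of the image of P_0.  The class of a b^2 with a b = N is in the image iff
   b y^3 - a z^3 = 1 has a rational solution.  On the other hand a cubic field of
   discriminant -27 N^2 is pure by Cardano's formula, and then it is
   Q(cbrt(a b^2)) with a b = N and a b^2 <> 1, -1 modulo 9; its ring of integers
   is spanned by 1, cbrt(a b^2), cbrt(a^2 b), so its index form is
   b y^3 - a z^3. *)

(** The group law is given only by formulas, so associativity has to be proved. It is reached over
    [algC], where enough points exist to avoid every degenerate configuration, and pulled back along
    an embedding. A coefficient vector is matched with the valuations only up to a sign: the cube
    root of unity built from a square root of [-27 D] and from [sqrtC D] may be [zeta] or its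
    inverse. The sign is not tracked, since neither spans nor lines see it. For torsion,
    multiplication by the part of the order prime to 3 is invertible on an [F_3]-space, and the
    3-power torsion is just 0 and the two points of abscissa 0, because these are not divisible by
    3. For squarefree N, a vector without zero entry is the same as a factorization N = a b: an
    entry 1 puts its prime in a, an entry -1, which lifts to 2, puts it in b. Negating the vector
    swaps a and b, hence the two cube roots, so a line determines one field. *)

Set Implicit Arguments.
Unset Strict Implicit.
Unset Printing Implicit Defensive.

Import Order.TTheory GRing.Theory Num.Theory.
Local Open Scope ring_scope.

(** * Valuations and cubes of rational numbers *)

Section Valuation.
Implicit Types (p : nat) (q r : rat).

(** The p-adic valuation, with value 0 at 0; hence the nonvanishing hypotheses in the laws below. *)
Definition vq (p : nat) (q : rat) : int :=
  (logn p `|numq q|)%:Z - (logn p `|denq q|)%:Z.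

Lemma vq_frac p (a b : int) : a != 0 -> b != 0 ->
  vq p (a%:~R / b%:~R) = (logn p `|a|)%:Z - (logn p `|b|)%:Z.
Proof.
move=> a0 b0; set q : rat := _ / _.
have q0 : q != 0 by rewrite mulf_neq0 ?invr_eq0 ?intr_eq0.
have e : a * denq q = numq q * b.
  apply/eqP; rewrite -(eqr_int rat) !intrM numqE.
  by rewrite mulrAC divfK ?intr_eq0.
have n0 : numq q != 0 by rewrite numq_eq0.
have /(congr1 (fun z : int => logn p `|z|)) := e.
rewrite !abszM !lognM ?absz_gt0 ?denq_neq0 // /vq; lia.
Qed.

Lemma vqM p q r : q != 0 -> r != 0 -> vq p (q * r) = vq p q + vq p r.
Proof.
move=> q0 r0.
have -> : q * r = (numq q * numq r)%:~R / (denq q * denq r)%:~R.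
  by rewrite -{1}(divq_num_den q) -{1}(divq_num_den r) mulf_div !intrM.
have dn x : denq x != 0 by apply: denq_neq0.
rewrite vq_frac ?mulf_neq0 ?numq_eq0 ?dn // !abszM !lognM ?absz_gt0 ?numq_eq0 //.
rewrite /vq; lia.
Qed.

Lemma vq1 p : vq p 1 = 0. Proof. by rewrite /vq /= logn1. Qed.

Lemma vqN p q : vq p (- q) = vq p q.
Proof. by rewrite /vq numqN denqN abszN. Qed.

Lemma vqV p q : q != 0 -> vq p q^-1 = - vq p q.
Proof.
move=> q0; have h : q^-1 * q = 1 by rewrite mulVf.
have := vqM p (_ : q^-1 != 0) q0; rewrite h vq1 invr_eq0 => /(_ q0) /esym/eqP.
by rewrite addr_eq0 => /eqP.
Qed.

Lemma vqX p q n : q != 0 -> vq p (q ^+ n) = vq p q *+ n.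
Proof.
move=> q0; elim: n => [|n IHn]; first by rewrite expr0 vq1 mulr0n.
by rewrite exprS mulrS vqM ?expf_neq0 // IHn.
Qed.

Lemma vq_nat p n : vq p n%:R = logn p n.
Proof.
have [->|n0] := posnP n; first by rewrite /vq /= !(logn0,logn1).
have -> : n%:R = (Posz n)%:~R / 1%:~R :> rat by rewrite divr1.
by rewrite vq_frac ?logn1 ?subr0 // -lt0n.
Qed.

Lemma vqD_ge p q r : q + r != 0 -> vq p q <= vq p r -> q != 0 -> r != 0 ->
  vq p q <= vq p (q + r).
Proof.
have [pr|npr] := boolP (prime p); last by rewrite /vq /logn (negPf npr).
move=> s0 le q0 r0.
pose d := denq q * denq r; pose a := numq q * denq r; pose b := numq r * denq q.
have dn x : denq x != 0 by apply: denq_neq0.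
have d0 : d != 0 by rewrite mulf_neq0.
have a0 : a != 0 by rewrite mulf_neq0 ?numq_eq0.
have b0 : b != 0 by rewrite mulf_neq0 ?numq_eq0.
have dr x : (denq x)%:~R != 0 :> rat by rewrite intr_eq0.
have qE : q = a%:~R / d%:~R.
  by rewrite -{1}(divq_num_den q) !intrM -mulf_div divff ?mulr1.
have rE : r = b%:~R / d%:~R.
  rewrite -{1}(divq_num_den r) !intrM [(denq q)%:~R * _]mulrC -mulf_div.
  by rewrite divff ?mulr1.
have sE : q + r = (a + b)%:~R / d%:~R by rewrite intrD mulrDl -qE -rE.
have ab0 : a + b != 0.
  by apply: contraNneq s0 => e; rewrite sE e mul0r.
move: le; rewrite sE {1}qE {1}rE ?[vq p q]qE qE !vq_frac // => le.
suff : (logn p (absz a) <= logn p (absz (a + b)%R))%N by lia.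
have {}le : (logn p (absz a) <= logn p (absz b))%N by lia.
rewrite -pfactor_dvdn ?absz_gt0 //.
have : ((p ^ logn p (absz a))%N%:Z %| a + b)%Z.
  apply: rpredD; rewrite dvdzE /=; first exact: pfactor_dvdnn.
  by rewrite pfactor_dvdn ?absz_gt0.
by rewrite dvdzE.
Qed.

(** If the sum had a larger valuation than [q], then [q = (q + r) - r] would be a sum of two terms
    of larger valuation than its own. *)
Lemma vqD_lt p q r : q != 0 -> r != 0 -> vq p q < vq p r ->
  q + r != 0 /\ vq p (q + r) = vq p q.
Proof.
move=> q0 r0 lt.
have s0 : q + r != 0.
  by apply: contraTneq lt => /eqP; rewrite addr_eq0 => /eqP ->; rewrite vqN ltxx.
split=> //; apply/le_anti/andP; split; last exact: vqD_ge (ltW lt) _ _.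
rewrite leNgt; apply/negP => lt'.
have qE : q = (q + r) + (- r) by rewrite addrK.
have : Num.min (vq p (q + r)) (vq p r) <= vq p q.
  have nr0 : - r != 0 by rewrite oppr_eq0.
  have e2 : - r + (q + r) = q by rewrite addrC addrK.
  have [le|/ltW le] := leP (vq p (q + r)) (vq p r).
    by have := @vqD_ge p (q + r) (- r); rewrite vqN -qE; apply.
  by have := @vqD_ge p (- r) (q + r); rewrite vqN e2; apply.
by rewrite ge_min leNgt lt' /= leNgt lt.
Qed.

Lemma vq_int (q : rat) : (forall p, prime p -> 0 <= vq p q) ->
  q \is a Num.int.
Proof.
move=> h; have [->|q0] := eqVneq q 0; first exact: rpred0.
rewrite Qint_def; apply: contraT => d1.
have dgt : (1 < `|denq q|)%N.
  by have := denq_gt0 q; move: d1; case: (denq q) => [[|[|n]]|n].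
have pr := pdiv_prime dgt; have := h _ pr; rewrite /vq.
have p1 : (0 < logn (pdiv `|denq q|) `|denq q|)%N.
  by rewrite logn_gt0 mem_primes pr pdiv_dvd absz_gt0 denq_neq0.
suff -> : logn (pdiv `|denq q|) `|numq q| = 0%N by move: p1; lia.
apply/eqP; rewrite -leqn0 leqNgt logn_gt0 mem_primes; apply/negP.
case/and3P=> _ _ dv; have := coprime_num_den q; rewrite /coprime => /eqP e.
have := dvdn_gcd (pdiv `|denq q|) `|numq q| `|denq q|.
by rewrite e dv pdiv_dvd dvdn1 => /eqP e1; move: pr; rewrite e1.
Qed.

Lemma cube_logn n : (0 < n)%N -> (forall p, prime p -> 3 %| logn p n)%N ->
  exists k, n = (k ^ 3)%N.
Proof.
move=> n0 h; exists (\prod_(p <- primes n) p ^ (logn p n %/ 3))%N.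
rewrite (big_morph (expn^~ 3) (fun a b => expnMn a b 3) (exp1n 3)).
rewrite {1}(prod_prime_decomp n0) prime_decompE big_map /=.
rewrite big_seq [RHS]big_seq; apply: eq_bigr => p.
by rewrite mem_primes => /and3P[pr _ _]; rewrite -expnM divnK // h.
Qed.

(** In lowest terms a prime divides at most one of numerator and denominator, so both have all
    exponents divisible by 3; the sign is its own cube. *)
Lemma cube_vq (q : rat) : q != 0 ->
  (forall p, prime p -> (3 %| vq p q)%Z) -> exists t, q = t ^+ 3.
Proof.
move=> q0 h.
have key p : prime p -> (3 %| logn p (absz (numq q)))%N /\ (3 %| logn p (absz (denq q)))%N.
  move=> pr; have := h p pr; rewrite /vq.
  have [|n0] := posnP (logn p `|numq q|); first by move=> ->; rewrite sub0r rpredN.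
  suff -> : logn p `|denq q| = 0%N by rewrite subr0.
  apply/eqP; rewrite -leqn0 leqNgt logn_gt0 mem_primes; apply/negP.
  case/and3P=> _ _ dv; move: n0; rewrite logn_gt0 mem_primes => /and3P[_ _ dv'].
  have := coprime_num_den q; rewrite /coprime => /eqP e.
  have := dvdn_gcd p `|numq q| `|denq q|.
  by rewrite e dv dv' dvdn1 => /eqP e1; move: pr; rewrite e1.
have [|k ek] := @cube_logn `|numq q| _ (fun p pr => (key p pr).1).
  by rewrite absz_gt0 numq_eq0.
have [|l el] := @cube_logn `|denq q| _ (fun p pr => (key p pr).2).
  by rewrite absz_gt0 denq_neq0.
exists ((-1) ^+ (numq q < 0)%R * k%:R / l%:R).
rewrite !exprMn exprVn -!natrX -ek -el.
have -> : ((-1) ^+ (numq q < 0)%R) ^+ 3 = (-1) ^+ (numq q < 0)%R :> rat.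
  by case: (_ < _).
rewrite -[LHS]divq_num_den; congr (_ / _); last by rewrite -{1}absz_denq.
by rewrite {1}[numq q]intEsign intrM rmorph_sign.
Qed.

End Valuation.

(** The coordinates of [q] in the group of nonzero rationals modulo cubes: by [cube_vF] they detect
    cubes jointly. *)
HB.lock Definition vF (p : nat) (q : rat) : 'F_3 := (vq p q)%:~R.

Section CubeClass.
Implicit Types (p : nat) (q r : rat).

Lemma vFM p q r : q != 0 -> r != 0 -> vF p (q * r) = vF p q + vF p r.
Proof. by move=> q0 r0; rewrite !vF.unlock vqM // intrD. Qed.

Lemma vFV p q : q != 0 -> vF p q^-1 = - vF p q.
Proof. by move=> q0; rewrite !vF.unlock vqV // intrN. Qed.

Lemma vFN p q : vF p (- q) = vF p q.
Proof. by rewrite !vF.unlock vqN. Qed.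

Lemma vF_cube p q : q != 0 -> vF p (q ^+ 3) = 0.
Proof.
move=> q0; rewrite !vF.unlock vqX // -mulr_natr intrM.
by rewrite [X in _ * X](_ : _ = 0) ?mulr0 //; apply/eqP.
Qed.

Lemma vF_mul_cube p q r : q != 0 -> r != 0 -> vF p (q * r ^+ 3) = vF p q.
Proof. by move=> q0 r0; rewrite vFM ?expf_neq0 // vF_cube ?addr0. Qed.

Lemma F3_int_eq0 (c : int) : (c%:~R == 0 :> 'F_3) = (3 %| c)%Z.
Proof.
have nat_eq0 (m : nat) : (m%:R == 0 :> 'F_3) = (3 %| m)%N.
  by rewrite -(@dvdn_pcharf 'F_3 3) // pchar_Fp.
rewrite dvdzE; case: c => m /=; first exact: nat_eq0.
by rewrite NegzE intrN oppr_eq0 nat_eq0.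
Qed.

Lemma cube_vF (q : rat) : q != 0 ->
  (forall p, prime p -> vF p q = 0) -> exists t, q = t ^+ 3.
Proof.
move=> q0 h; apply: cube_vq => // p /h /eqP.
by rewrite !vF.unlock F3_int_eq0.
Qed.

Lemma dvd3X (x : int) n : (3 %| x ^+ n.+1)%Z = (3 %| x)%Z.
Proof. by rewrite !dvdzE abszX Euclid_dvdX // andbT. Qed.

Lemma dvd3M (x y : int) : (3 %| x * y)%Z = (3 %| x)%Z || (3 %| y)%Z.
Proof. by rewrite !dvdzE abszM Euclid_dvdM. Qed.

End CubeClass.

(** * The group law *)

(* The line [Y = l X + v] meets the curve [Y^2 = 4 X^3 + k] in the points with
   abscissae [x1], [x2], [x3], counted with multiplicity. *)
Definition line (F : numFieldType) (k : rat) (l v x1 x2 x3 : F) : Prop :=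
  [/\ l ^+ 2 = 4 * (x1 + x2 + x3),
      - (l * v) = 2 * (x1 * x2 + x1 * x3 + x2 * x3)
    & ratr k - v ^+ 2 = - 4 * x1 * x2 * x3].

Section Line.
Variables (F : numFieldType) (k : rat).
Hypothesis k_neq0 : k != 0.
Implicit Types (x y l v : F) (A B C X Y Z : ell k F).

Lemma line_perm l v x1 x2 x3 : line k l v x1 x2 x3 -> line k l v x2 x3 x1.
Proof. by case=> e1 e2 e3; split; rewrite ?e1 ?e2 ?e3; ring. Qed.

Lemma line_swap l v x1 x2 x3 : line k l v x1 x2 x3 -> line k l v x2 x1 x3.
Proof. by case=> e1 e2 e3; split; rewrite ?e1 ?e2 ?e3; ring. Qed.

Lemma line_on l v x1 x2 x3 : line k l v x1 x2 x3 ->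
  (l * x1 + v) ^+ 2 = 4 * x1 ^+ 3 + ratr k.
Proof.
case=> e1 e2 e3.
have -> : ratr k = v ^+ 2 - 4 * x1 * x2 * x3 by rewrite -[LHS](subrK (v ^+ 2)) e3; ring.
have -> : (l * x1 + v) ^+ 2 = l ^+ 2 * x1 ^+ 2 - 2 * x1 * (- (l * v)) + v ^+ 2 by ring.
by rewrite e1 e2; ring.
Qed.

Lemma add_raw_line x1 y1 x2 y2 :
    on_curve k (Some (x1, y1)) -> on_curve k (Some (x2, y2)) ->
    ~~ ((x1 == x2) && (y1 == - y2)) ->
  exists l v x3, [/\ line k l v x1 x2 x3, y1 = l * x1 + v, y2 = l * x2 + v &
    add_raw (Some (x1, y1)) (Some (x2, y2)) = Some (x3, - (l * x3 + v))].
Proof.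
move=> h1 h2 nopp; have := slopeP h1 h2 nopp; set l := slope _ _ _ _ => /= hl.
exists l, (y1 - l * x1), (l ^+ 2 / 4 - x1 - x2).
move: h1 h2 => /= /eqP h1 /eqP h2.
have hx : l ^+ 2 = 4 * (x1 + x2 + (l ^+ 2 / 4 - x1 - x2)) by field.
have hy : y2 = l * x2 + (y1 - l * x1).
  have [e|ne] := eqVneq x1 x2.
    rewrite e addrC subrK; move: nopp; rewrite e eqxx /= => nopp.
    have /eqP : (y2 - y1) * (y1 + y2) = 0.
      by transitivity (y2 ^+ 2 - y1 ^+ 2); [ring|rewrite h1 h2 e; ring].
    by rewrite mulf_eq0 subr_eq0 addr_eq0 (negPf nopp) orbF => /eqP.
  have := ne; rewrite eq_sym -subr_eq0 => d0.
  have : l * (x2 - x1) = y2 - y1 by rewrite /l /slope (negPf ne) divfK.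
  by move=> e; rewrite -[y2](subrK y1) -e; ring.
split=> //; last first.
- by rewrite /= (negPf nopp) -/l; congr (Some (_, - _)); ring.
- by ring.
set x3 := _ - x1 - x2 in hx *; split=> //.
- have -> : - (l * (y1 - l * x1))
      = - (l * (2 * y1 + l * (x2 - x1))) / 2 + l ^+ 2 * (x2 + x1) / 2 by field.
  by rewrite hl {1}hx; field.
- have -> : ratr k = y1 ^+ 2 - 4 * x1 ^+ 3 by rewrite h1; ring.
  have -> : y1 ^+ 2 - 4 * x1 ^+ 3 - (y1 - l * x1) ^+ 2
    = x1 * (l * (2 * y1 + l * (x2 - x1))) - l ^+ 2 * x1 * x2 - 4 * x1 ^+ 3 by ring.
  by rewrite hl {1}hx; ring.
Qed.

Lemma line_add_raw l v x1 x2 x3 : line k l v x1 x2 x3 ->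
  add_raw (Some (x1, l * x1 + v)) (Some (x2, l * x2 + v))
    = Some (x3, - (l * x3 + v)).
Proof.
move=> ln; case: (ln) => e1 e2 e3.
(* Opposite points on a line that is not vertical would coincide with ordinate 0, and such a tangent
   exists only at a singular point, which [k != 0] rules out. *)
have nopp : ~~ ((x1 == x2) && (l * x1 + v == - (l * x2 + v))).
  apply/negP => /andP[/eqP ex]; rewrite -ex => /eqP ey.
  have y0 : l * x1 + v = 0 by apply/eqP; have /eqP := ey; rewrite -addr_eq0 -mulr2n mulrn_eq0.
  have v0 : v = - (l * x1) by apply/eqP; rewrite -addr_eq0 addrC y0.
  move: e2 e3; rewrite v0 -ex sqrrN exprMn e1 -ex => e2 e3.
  have : 12 * x1 ^+ 2 = 0 :> F.
    have -> : 12 * x1 ^+ 2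
        = 2 * (- (l * - (l * x1)) - 2 * (x1 * x1 + x1 * x3 + x1 * x3)) - 2 * x1 * (l ^+ 2 - 4 * (x1 + x1 + x3)) :> F by ring.
    by rewrite e2 e1 -ex; ring.
  move/eqP; rewrite mulf_eq0 pnatr_eq0 /= sqrf_eq0 => /eqP x0.
  move: e3; rewrite x0 !(mulr0, mul0r, expr0n, subr0) /= => /eqP.
  by rewrite fmorph_eq0 (negPf k_neq0).
have on1 := line_on ln; have on2 := line_on (line_swap ln).
rewrite [LHS]/add_raw (negPf nopp) /slope.
have -> : (if x1 == x2 then 6 * x1 ^+ 2 / (l * x1 + v)
      else (l * x2 + v - (l * x1 + v)) / (x2 - x1)) = l.
  case: eqVneq => [ex|ne]; last by field; rewrite subr_eq0 eq_sym.
  have y0 : l * x1 + v != 0.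
    apply: contraNneq nopp => y0; rewrite ex eqxx -ex y0 oppr0 eqxx //.
  apply: (mulIf y0); rewrite divfK //.
  have -> : l * (l * x1 + v) = l ^+ 2 * x1 - (- (l * v)) by ring.
  by rewrite e1 e2 -ex; ring.
have -> : l ^+ 2 / 4 - x1 - x2 = x3 by rewrite e1; field.
by congr (Some (_, - _)); ring.
Qed.

Lemma ell_inj X Y : coords X = coords Y -> X = Y.
Proof. exact: val_inj. Qed.

Lemma ell_add0 X : ell_add X ell0 = X.
Proof. by apply: ell_inj => /=; case: (coords X) => [[]|]. Qed.

Lemma ell_0add X : ell_add ell0 X = X.
Proof. exact: ell_inj. Qed.

Lemma ell_addN X : ell_add (ell_opp X) X = ell0.
Proof. by apply: ell_inj => /=; case: (coords X) => [[x y]|] //=; rewrite !eqxx. Qed.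

Lemma ell_addC X Y : ell_add X Y = ell_add Y X.
Proof.
case: X Y => [[[x1 y1]|] h1] [[[x2 y2]|] h2]; apply: ell_inj => //=.
rewrite [x2 == x1]eq_sym -[y2 == _]eqr_oppLR [- y2 == _]eq_sym.
case: ifPn => // nopp.
have [l [v [x3 [ln e1 e2 e]]]] := add_raw_line h1 h2 nopp.
rewrite /= (negPf nopp) in e; rewrite e.
have := line_add_raw (line_swap ln); rewrite -e1 -e2 /=.
by rewrite [x2 == x1]eq_sym -[y2 == _]eqr_oppLR [- y2 == _]eq_sym (negPf nopp).
Qed.

Lemma ell_oppK X : ell_opp (ell_opp X) = X.
Proof. by apply: ell_inj; case: X => [[[x y]|] h] //=; rewrite opprK. Qed.

Variant ell_add_spec X Y : ell k F -> Prop :=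
  | EllAdd0l of X = ell0 : ell_add_spec X Y Y
  | EllAdd0r of Y = ell0 : ell_add_spec X Y X
  | EllAddN of X = ell_opp Y : ell_add_spec X Y ell0
  | EllAddLine l v x1 x2 x3 Z of line k l v x1 x2 x3 &
     coords X = Some (x1, l * x1 + v) & coords Y = Some (x2, l * x2 + v) &
     coords Z = Some (x3, - (l * x3 + v)) : ell_add_spec X Y Z.

Lemma ell_addP X Y : ell_add_spec X Y (ell_add X Y).
Proof.
case eX: (coords X) => [[x1 y1]|]; last first.
  have -> : X = ell0 by apply: ell_inj.
  by rewrite ell_0add; constructor.
case eY: (coords Y) => [[x2 y2]|]; last first.
  have -> : Y = ell0 by apply: ell_inj.
  by rewrite ell_add0; constructor 2.
have h1 := coordsP X; have h2 := coordsP Y; rewrite eX eY in h1 h2.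
have [/andP[/eqP ex /eqP ey]|nopp] := boolP ((x1 == x2) && (y1 == - y2)).
  have -> : X = ell_opp Y by apply: ell_inj; rewrite /= eX eY /= ex ey.
  by rewrite ell_addN; constructor 3.
have [l [v [x3 [ln e1 e2 e]]]] := add_raw_line h1 h2 nopp.
by apply: (EllAddLine ln); rewrite ?eX ?eY ?e1 ?e2 //= eX eY e.
Qed.

Lemma ell_add_line l v x1 x2 x3 X Y : line k l v x1 x2 x3 ->
  coords X = Some (x1, l * x1 + v) -> coords Y = Some (x2, l * x2 + v) ->
  coords (ell_add X Y) = Some (x3, - (l * x3 + v)).
Proof. by move=> ln eX eY; rewrite /= eX eY; apply: line_add_raw. Qed.

Lemma ell_opp0 : ell_opp ell0 = ell0 :> ell k F.
Proof. exact: ell_inj. Qed.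

Lemma ell_opp_add X Y : ell_opp (ell_add X Y) = ell_add (ell_opp X) (ell_opp Y).
Proof.
case: (ell_addP X Y) => [->|->|->|l v t1 t2 t3 W ln eX eY eW].
- by rewrite ell_opp0 ell_0add.
- by rewrite ell_opp0 ell_add0.
- by rewrite ell_oppK ell_addC ell_addN ell_opp0.
apply: ell_inj; rewrite (@ell_add_line (- l) (- v) t1 t2 t3) /= ?eX ?eY ?eW /=.
- by congr (Some (_, _)); ring.
- by case: ln => e1 e2 e3; split; rewrite ?sqrrN ?mulrNN.
- by congr (Some (_, _)); ring.
- by congr (Some (_, _)); ring.
Qed.

(* If [X], [Y] and [- (X + Y)] are collinear then so are, in another order,
   [X], [- (X + Y)] and [Y]. *)
Lemma ell_addK X Y : ell_add (ell_opp X) (ell_add X Y) = Y.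
Proof.
case: (ell_addP X Y) => [->|->|->|l v x1 x2 x3 Z ln eX eY eZ].
- by rewrite ell_opp0 ell_0add.
- by rewrite ell_addN.
- by rewrite ell_add0 ell_oppK.
rewrite -[Z]ell_oppK -ell_opp_add; apply: ell_inj.
have ln' : line k l v x1 x3 x2.
  by apply: line_swap; apply: line_perm; apply: line_perm.
rewrite -[LHS]/(opp_raw (coords (ell_add X (ell_opp Z)))).
by rewrite (ell_add_line ln' eX) /= ?eZ /= ?opprK ?eY.
Qed.

Definition affine X : bool := coords X.

Definition xcoord X : F := if coords X is Some (x, _) then x else 0.

Lemma xcoord_opp X : xcoord (ell_opp X) = xcoord X.
Proof. by rewrite /xcoord /=; case: (coords X) => [[]|]. Qed.

Lemma xcoord_eq X Y : affine X -> affine Y -> xcoord X = xcoord Y ->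
  X = Y \/ X = ell_opp Y.
Proof.
rewrite /affine /xcoord.
case eX: (coords X) => [[x1 y1]|//]; case eY: (coords Y) => [[x2 y2]|//] _ _ ex.
have h1 := coordsP X; have h2 := coordsP Y.
rewrite eX eY /= in h1 h2; move/eqP: h1 => h1; move/eqP: h2 => h2.
have /eqP : (y1 - y2) * (y1 + y2) = 0.
  by transitivity (y1 ^+ 2 - y2 ^+ 2); [ring|rewrite h1 h2 ex; ring].
rewrite mulf_eq0 subr_eq0 addr_eq0 => /orP[]/eqP ey; [left|right]; apply: ell_inj;
 by rewrite /= eX eY /= ex ey.
Qed.

(** Modulo the equation of the curve, the product of the two lines divided by [X - u] is
    [4 X^2 + b X + g - c Y] with [c = l1 + l2]. The first part computes [4 X^2 + b X + g] from
    either line; the second reads the sum of the four zeros off the norm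
    [(4 X^2 + b X + g)^2 - c^2 (4 X^3 + k)]. *)
Lemma two_lines l1 v1 l2 v2 x1 x2 u x3 s :
    line k l1 v1 x1 x2 u -> line k l2 v2 u x3 s ->
    - (l1 * u + v1) = l2 * u + v2 ->
  (forall x, 4 * (x - x1) * (x - x2) + (l1 + l2) * (l1 * x + v1)
           = 4 * (x - x3) * (x - s) + (l1 + l2) * (l2 * x + v2))
  /\ 16 * (x1 + x2 + x3 + s)
    = 4 * (l1 + l2) ^+ 2 - 8 * ((l1 + l2) * l1 - 4 * (x1 + x2)).
Proof.
move=> [/eqP + /eqP + _] [/eqP + /eqP + _] /eqP.
rewrite -!(subr_eq0 (_ ^+ 2)) -!(subr_eq0 (- _)).
set A1 := _ - _; set A2 := _ - _; set B1 := _ - _; set B2 := _ - _; set h := _ - _.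
move=> /eqP a1 /eqP a2 /eqP b1 /eqP b2 /eqP h0.
split=> [x|]; apply/eqP; rewrite -subr_eq0; apply/eqP.
  transitivity (x * (A1 - B1) - 2 * A2 + 2 * B2 + (l1 - l2) * h - u * (B1 - A1)).
    by rewrite /A1 /A2 /B1 /B2 /h; ring.
  by rewrite a1 a2 b1 b2 h0; ring.
transitivity (4 * (A1 - B1)); first by rewrite /A1 /B1; ring.
by rewrite a1 b1; ring.
Qed.

(* Both bracketings come with a function [4 X^2 + b X + g - c Y] that vanishes
   at [A], [B], [C] and, as fourth zero, at the opposite of the sum; three zeros
   determine it. *)
Lemma ell_addA_generic A B C :
    affine A -> affine B -> affine C ->
    xcoord A != xcoord B -> xcoord B != xcoord C -> xcoord A != xcoord C ->
    ell_add A B != ell_opp C ->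
  ell_add (ell_add A B) C = ell_add A (ell_add B C).
Proof.
move=> aA aB aC nAB nBC nAC nop.
have nop' : ell_add B C != ell_opp A.
  apply: contraNneq nop => e.
  by rewrite -[A]ell_oppK -e ell_opp_add ell_addC -{1}[B]ell_oppK ell_addK.
case: (ell_addP A B) nop => [eA|eB|eA|l1 v1 x1 x2 u S1 ln1 eA eB eS1] nop.
- by rewrite eA in aA.
- by rewrite eB in aB.
- by rewrite eA xcoord_opp eqxx in nAB.
case: (ell_addP S1 C) => [e|e|e|l2 v2 u' x3 s R1 ln2 eS1' eC eR1].
- by rewrite e in eS1.
- by rewrite e in aC.
- by rewrite e eqxx in nop.
case: (ell_addP B C) nop' => [e|e|e|m1 w1 x2' x3' t S2 lm1 eB' eC' eS2] nop'.
- by rewrite e in aB.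
- by rewrite e in aC.
- by rewrite e xcoord_opp eqxx in nBC.
case: (ell_addP A S2) => [e|e|e|m2 w2 x1' t' s' R2 lm2 eA' eS2' eR2].
- by rewrite e in aA.
- by rewrite e in eS2.
- by rewrite e ell_oppK eqxx in nop'.
apply: ell_inj; rewrite eR1 eR2.
rewrite /xcoord eA eB eC in nAB nBC nAC.
move: eS1'; rewrite eS1 => -[eu ey1]; subst u'.
move: eS2'; rewrite eS2 => -[et ey2]; subst t'.
move: eB'; rewrite eB => -[ex2 ey3]; subst x2'.
move: eC'; rewrite eC => -[ex3 ey4]; subst x3'.
move: eA'; rewrite eA => -[ex1 ey5]; subst x1'.
have [qE sE] := two_lines ln1 ln2 ey1.
have [q'E s'E] := two_lines lm1 (line_swap lm2) ey2.
set c := l1 + l2 in qE sE; set c' := m1 + m2 in q'E s'E.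
set b := c * l1 - 4 * (x1 + x2) in sE; set b' := c' * m1 - 4 * (x2 + x3) in s'E.
pose g := 4 * x1 * x2 + c * v1; pose g' := 4 * x2 * x3 + c' * w1.
have d12 : x1 - x2 != 0 by rewrite subr_eq0.
have d13 : x1 - x3 != 0 by rewrite subr_eq0.
have d23 : x2 - x3 != 0 by rewrite subr_eq0.
have q1 : 4 * x1 ^+ 2 + b * x1 + g = c * (l1 * x1 + v1) by rewrite /b /g; ring.
have q2 : 4 * x2 ^+ 2 + b * x2 + g = c * (l1 * x2 + v1) by rewrite /b /g; ring.
have q3 : 4 * x3 ^+ 2 + b * x3 + g = c * (l2 * x3 + v2).
  transitivity (4 * (x3 - x1) * (x3 - x2) + c * (l1 * x3 + v1)); first by rewrite /b /g; ring.
  by rewrite qE; ring.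
have q'1 : 4 * x1 ^+ 2 + b' * x1 + g' = c' * (l1 * x1 + v1).
  transitivity (4 * (x1 - x2) * (x1 - x3) + c' * (m1 * x1 + w1)); first by rewrite /b' /g'; ring.
  by rewrite q'E ey5; ring.
have q'2 : 4 * x2 ^+ 2 + b' * x2 + g' = c' * (l1 * x2 + v1).
  by rewrite ey3 /b' /g'; ring.
have q'3 : 4 * x3 ^+ 2 + b' * x3 + g' = c' * (l2 * x3 + v2).
  by rewrite ey4 /b' /g'; ring.
have qs : 4 * s ^+ 2 + b * s + g = c * (l2 * s + v2).
  transitivity (4 * (s - x1) * (s - x2) + c * (l1 * s + v1)); first by rewrite /b /g; ring.
  by rewrite qE; ring.
have q's : 4 * s' ^+ 2 + b' * s' + g' = c' * (m2 * s' + w2).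
  transitivity (4 * (s' - x2) * (s' - x3) + c' * (m1 * s' + w1)); first by rewrite /b' /g'; ring.
  by rewrite q'E; ring.
have r1 : (b - b') * x1 + (g - g') = (c - c') * (l1 * x1 + v1).
  by rewrite [RHS]mulrBl -q1 -q'1; ring.
have r2 : (b - b') * x2 + (g - g') = (c - c') * (l1 * x2 + v1).
  by rewrite [RHS]mulrBl -q2 -q'2; ring.
have r3 : (b - b') * x3 + (g - g') = (c - c') * (l2 * x3 + v2).
  by rewrite [RHS]mulrBl -q3 -q'3; ring.
have bE : b - b' = (c - c') * l1.
  apply: (mulIf d12).
  transitivity (((b - b') * x1 + (g - g')) - ((b - b') * x2 + (g - g'))); first by ring.
  by rewrite r1 r2; ring.
have gE : g - g' = (c - c') * v1.
  transitivity (((b - b') * x1 + (g - g')) - (b - b') * x1); first by ring.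
  by rewrite r1 bE; ring.
(* The difference of the two functions is affine in [X] and [Y] and vanishes at [A], [B], [C]. If
   [c] and [c'] differed, [C] would lie on the line through [A] and [B], so it would be the opposite
   of [A + B]. *)
have ec : c = c'.
  apply/eqP; rewrite -subr_eq0; apply: contraNT nop => dc.
  have ey : l2 * x3 + v2 = l1 * x3 + v1.
    by apply: (mulfI dc); rewrite -r3 bE gE; ring.
  have := line_on (line_perm ln2); rewrite ey => on3.
  have [a1 a2 a3] := ln1.
  have /eqP : (x1 - x3) * (x2 - x3) * (u - x3) = 0.
    apply: (@mulfI _ 4); first by rewrite pnatr_eq0.
    transitivity (x3 ^+ 2 * (4 * (x1 + x2 + u)) - 4 * x3 ^+ 3
      - 2 * x3 * (2 * (x1 * x2 + x1 * u + x2 * u)) - (- 4 * x1 * x2 * u)); first by ring.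
    rewrite -a1 -a2 -a3 mulr0.
    transitivity ((l1 * x3 + v1) ^+ 2 - (4 * x3 ^+ 3 + ratr k)); first by ring.
    by rewrite on3 subrr.
  rewrite !mulf_eq0 (negPf d13) (negPf d23) /= subr_eq0 => /eqP eu.
  by apply/eqP/ell_inj; rewrite eS1 /= eC ey eu.
have eb : b = b' by apply/eqP; rewrite -subr_eq0 bE ec subrr mul0r.
have eg : g = g' by apply/eqP; rewrite -subr_eq0 gE ec subrr mul0r.
(* Otherwise the quadratic [4 X^2 + b X + g] would have three distinct roots. *)
have c0 : c != 0.
  apply/eqP => c0; rewrite c0 !mul0r in q1 q2 q3.
  have /eqP : 4 * ((x1 - x2) * (x1 - x3) * (x2 - x3)) = 0 :> F.
    transitivity ((x2 - x3) * (4 * x1 ^+ 2 + b * x1 + g)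
      - (x1 - x3) * (4 * x2 ^+ 2 + b * x2 + g)
      + (x1 - x2) * (4 * x3 ^+ 2 + b * x3 + g)); first by ring.
    by rewrite q1 q2 q3; ring.
  by rewrite !mulf_eq0 pnatr_eq0 (negPf d12) (negPf d13) (negPf d23).
have es : s = s'.
  have : 16 * (x1 + x2 + x3 + s) = 16 * (x2 + x3 + x1 + s').
    by rewrite sE s'E -ec -eb.
  have n16 : 16 != 0 :> F by rewrite pnatr_eq0.
  by move/(mulfI n16) => e; apply: (addrI (x1 + x2 + x3)); rewrite e; ring.
congr (Some (_, - _)) => //; apply: (mulfI c0).
by rewrite -qs ec -q's -es -eb -eg.
Qed.

Lemma ell_canl X Y Z : ell_add X Y = ell_add X Z -> Y = Z.
Proof. by move=> e; rewrite -[Y](ell_addK X) e ell_addK. Qed.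

Lemma ell_canr X Y Z : ell_add X Z = ell_add Y Z -> X = Y.
Proof. by rewrite ![ell_add _ Z]ell_addC; apply: ell_canl. Qed.

Lemma not_affine X : ~~ affine X -> X = ell0.
Proof. by rewrite /affine; case: X => [[z|] h] // _; apply: ell_inj. Qed.

Lemma ell_addA_ne A B C :
    A != ell0 -> B != ell0 -> C != ell0 ->
    A != B -> A != ell_opp B -> B != C -> B != ell_opp C ->
    A != C -> A != ell_opp C -> ell_add A B != ell_opp C ->
  ell_add (ell_add A B) C = ell_add A (ell_add B C).
Proof.
have aff X : X != ell0 -> affine X by apply: contraNT => /not_affine ->.
have xne X Y : X != ell0 -> Y != ell0 -> X != Y -> X != ell_opp Y ->
    xcoord X != xcoord Y.
  move=> /aff aX /aff aY n1 n2; apply/eqP => /(xcoord_eq aX aY) [] e.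
    by rewrite e eqxx in n1.
  by rewrite e eqxx in n2.
by move=> *; apply: ell_addA_generic; rewrite ?aff ?xne.
Qed.

End Line.

(** * Associativity over an algebraically closed field *)

Section Assoc.
Variables (k : rat).
Hypothesis k_neq0 : k != 0.
Notation E := (ell k algC).
Implicit Types (A B C D G X Y : E) (s : seq E).

Let addC := @ell_addC algC k k_neq0.
Let canl := @ell_canl algC k k_neq0.
Let addK := @ell_addK algC k k_neq0.

(** Every abscissa carries a point over [algC], so an integer abscissa can avoid both those in [s]
    and the roots of [4 X^3 + k], which belong to the points equal to their opposite. *)
Lemma ell_avoid s : exists2 D, D \notin s & D != ell_opp D.
Proof.
pose p := (4 *: 'X^3 + (ratr k)%:P) * \prod_(x <- map (@xcoord _ _) s) ('X - x%:P) : {poly algC}.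
have p0 : p != 0.
  apply: mulf_neq0; last by rewrite monic_neq0 ?monic_prod_XsubC.
  apply/eqP => /(congr1 (fun q : {poly algC} => q`_3)).
  rewrite coefD coefZ coefXn coefC coef0 /= mulr1 addr0 => /eqP.
  by rewrite pnatr_eq0.
have [n n0] : exists n : nat, p.[n%:R] != 0.
  have nat_inj : injective (fun n : nat => n%:R : algC).
    by move=> i j /eqP; rewrite eqr_nat => /eqP.
  have := @max_poly_roots _ p [seq n%:R | n <- iota 0 (size p)] p0.
  rewrite size_map size_iota ltnn.
  move=> h; have /allPn[x /mapP[n _ ->] nr] : ~~ all (root p) [seq n%:R | n <- iota 0 (size p)].
    by apply/negP => al; have := h al; rewrite map_inj_uniq ?iota_uniq // => /(_ isT).
  by exists n.
have hy : on_curve k (Some (n%:R, sqrtC (4 * n%:R ^+ 3 + ratr k : algC))).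
  by rewrite /= sqrtCK.
move: n0; rewrite /p hornerM mulf_eq0 negb_or => /andP[n1 n2].
exists (Ell hy).
  apply: contraNN n2 => Ds; rewrite -[_ == 0]/(root _ _) root_prod_XsubC.
  by apply/mapP; exists (Ell hy).
apply: contraNneq n1 => /(congr1 (@coords _ _)) [] /eqP.
rewrite -addr_eq0 -mulr2n mulrn_eq0 /= sqrtC_eq0 => /eqP <-.
by rewrite !hornerE.
Qed.

Lemma assoc_avoid_ne A B : A != B -> exists s, forall D, D \notin s ->
  ell_add (ell_add A B) D = ell_add A (ell_add B D).
Proof.
move=> nAB; have [->|A0] := eqVneq A ell0.
  by exists [::] => D _; rewrite !ell_0add.
have [->|B0] := eqVneq B ell0.
  by exists [::] => D _; rewrite ell_0add ell_add0.
have [->|nAB'] := eqVneq A (ell_opp B).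
  by exists [::] => D _; rewrite ell_addN ell_0add addK.
exists [:: ell0; A; ell_opp A; B; ell_opp B; ell_opp (ell_add A B)] => D.
rewrite !inE !negb_or => /and5P[D0 DA DA' DB /andP[DB' DAB]].
apply: ell_addA_ne => //; rewrite 1?eq_sym //.
- by apply: contraNneq DB' => <-; rewrite ell_oppK.
- by apply: contraNneq DA' => <-; rewrite ell_oppK.
- by apply: contraNneq DAB => <-; rewrite ell_oppK.
Qed.

(** For [A = B], split one summand as [A = G + H] with [G] in general position:
    [(A + A) + D = ((A + G) + H) + D], and now only sums of distinct points have to be regrouped. *)
Lemma assoc_avoid A B : exists s, forall D, D \notin s ->
  ell_add (ell_add A B) D = ell_add A (ell_add B D).
Proof.
have [<-{B}|/assoc_avoid_ne //] := eqVneq A B.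
have [->|A0] := eqVneq A ell0.
  by exists [::] => D _; rewrite !ell_0add.
have [eA|nA] := eqVneq A (ell_opp A).
  by exists [::] => D _; rewrite {1 3}eA ell_addN ell_0add addK.
pose s0 := [:: ell0; A; ell_opp A; ell_add A A; ell_opp (ell_add A A)].
(* The condition that [G + G] differs from [A] makes [G] and [H] distinct; if it fails for [G] it
   holds for its opposite, as [A] is not its own opposite. *)
have [G [Gs nG nGA]] : exists G, [/\ G \notin s0, G != ell_opp G & ell_add G G != A].
  have [G Gs nG] := ell_avoid s0.
  have [e|] := eqVneq (ell_add G G) A; last by exists G.
  exists (ell_opp G); split.
  - apply: contraNN Gs; rewrite !inE => /or4P[|||/orP[]] /eqP e';
      by rewrite -[G]ell_oppK e' ?ell_opp0 ?ell_oppK eqxx ?orbT.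
  - by rewrite ell_oppK eq_sym.
  - by rewrite -ell_opp_add // e eq_sym.
move: Gs; rewrite !inE !negb_or => /and5P[G0 GA GA' GAA GAA'].
pose H := ell_add A (ell_opp G).
have GH : ell_add G H = A by rewrite addC /H -{2}[G]ell_oppK addC [ell_add A _]addC addK.
have nGH : G != H by apply: contraNneq nGA => e; rewrite {2}e GH.
have H0 : H != ell0.
  by apply: contraNneq GA => e; rewrite -GH e ell_add0.
have AAE : ell_add (ell_add A G) H = ell_add A A.
  rewrite -{3}GH; apply: ell_addA_ne => //.
  - by rewrite eq_sym.
  - by rewrite eq_sym; apply: contraNneq GA' => <-; rewrite ell_oppK.
  - by apply: contraNneq A0 => e; rewrite -GH e ell_addN.
  - rewrite eq_sym; apply: contraNneq G0 => e; apply/eqP; apply: (@canl H).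
    by rewrite ell_add0 addC GH e.
  - apply: contraNneq GAA => e.
    by apply/eqP; rewrite -[LHS](addK H) [ell_add H G]addC GH -e.
  - apply: contraNneq nA => e; rewrite -{1}GH -[H]ell_oppK -e ell_opp_add //.
    by rewrite [ell_add (ell_opp A) _]addC -{1}[G]ell_oppK addK.
have nAG : ell_add A G != H.
  by apply: contraNneq nG => /canl/eqP.
have [s1 h1] := assoc_avoid_ne nAG.
have nAG' : A != G by rewrite eq_sym.
have [s2 h2] := assoc_avoid_ne nAG'.
have [s3 h3] := assoc_avoid_ne nGH.
exists (s1 ++ s3 ++ map (ell_add (ell_opp H)) s2) => D.
rewrite !mem_cat !negb_or => /and3P[D1 D3 D2].
rewrite -AAE h1 // h2 -?h3 ?GH //.
  by apply: contraNN D2 => /(map_f (ell_add (ell_opp H))); rewrite addK.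
Qed.

(** Add a point [D] that avoids the four exceptional sets: [((A+B)+C)+D = (A+B)+(C+D) = A+(B+(C+D))
    = A+((B+C)+D) = (A+(B+C))+D], then cancel [D]. *)
Lemma ell_addA_algC A B C :
  ell_add (ell_add A B) C = ell_add A (ell_add B C).
Proof.
have [s1 h1] := assoc_avoid (ell_add A B) C.
have [s2 h2] := assoc_avoid A B.
have [s3 h3] := assoc_avoid B C.
have [s4 h4] := assoc_avoid A (ell_add B C).
have [D + _] := ell_avoid (s1 ++ map (ell_add (ell_opp C)) s2 ++ s3 ++ s4).
rewrite !mem_cat !negb_or => /and4P[D1 D2 D3 D4].
apply: (@ell_canr _ _ k_neq0 _ _ D).
rewrite h1 // h2 -?h3 -?h4 //.
by apply: contraNN D2 => /(map_f (ell_add (ell_opp C))); rewrite addK.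
Qed.

End Assoc.

Section EllMap.
Variables (k : rat) (F F' : numFieldType) (f : {rmorphism F -> F'}).
Hypothesis k_neq0 : k != 0.
Implicit Types X Y : ell k F.

Lemma ell_map_opp X : ell_map f (ell_opp X) = ell_opp (ell_map f X).
Proof. by apply: ell_inj => /=; case: (coords X) => [[x y]|] //=; rewrite rmorphN. Qed.

Lemma ell_map_add X Y : ell_map f (ell_add X Y) = ell_add (ell_map f X) (ell_map f Y).
Proof.
have map0 : ell_map f ell0 = ell0 :> ell k F' by apply: ell_inj.
case: (ell_addP X Y) => [->|->|->|l v x1 x2 x3 Z [e1 e2 e3] eX eY eZ].
- by rewrite map0 ell_0add.
- by rewrite map0 ell_add0.
- by rewrite map0 ell_map_opp ell_addN.
apply: ell_inj; rewrite (@ell_add_line _ _ k_neq0 (f l) (f v) (f x1) (f x2) (f x3)) /= ?eX ?eY ?eZ /=.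
- by rewrite rmorphN rmorphD rmorphM.
- split.
  + by rewrite -rmorphXn e1 rmorphM rmorph_nat !rmorphD.
  + by rewrite -rmorphM -rmorphN e2 rmorphM rmorph_nat !rmorphD !rmorphM.
  + by have := congr1 f e3; rewrite rmorphB /= fmorph_rat rmorphXn 3!rmorphM rmorphN rmorph_nat.
- by rewrite rmorphD rmorphM.
- by rewrite rmorphD rmorphM.
Qed.

Lemma ell_map_inj : injective (@ell_map k F F' f).
Proof.
move=> X Y /(congr1 (@coords _ _)) /= e; apply: ell_inj; move: e.
case: (coords X) (coords Y) => [[x1 y1]|] [[x2 y2]|] //=.
by case=> /fmorph_inj -> /fmorph_inj ->.
Qed.

End EllMap.

(* Associativity is proved over [algC], hence the embedding [i]. *)
Definition ellg (k : rat) (k_neq0 : k != 0) (F : numFieldType)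
  (i : {rmorphism F -> algC}) : Type := ell k F.

Section Group.
Variables (k : rat) (k_neq0 : k != 0) (F : numFieldType).
Variable (i : {rmorphism F -> algC}).
Notation G := (ellg k_neq0 i).

HB.instance Definition _ := [Choice of ell k F by <:].
HB.instance Definition _ := Choice.on G.

Lemma ell_addA : associative (@ell_add k F).
Proof.
move=> X Y Z; apply: (@ell_map_inj _ _ _ i).
by rewrite !(ell_map_add i k_neq0) ell_addA_algC.
Qed.

HB.instance Definition _ := GRing.isZmodule.Build G
  ell_addA (@ell_addC F k k_neq0) (@ell_0add F k) (@ell_addN F k).

Lemma ell_mulnE (X : G) n : ell_muln X n = X *+ n.
Proof. by elim: n => [|n IHn] //; rewrite mulrS -IHn. Qed.

End Group.

(** * The descent map *)

Lemma dvdz3_mul3 (a : int) : (3 %| a *+ 3)%Z.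
Proof. by apply/dvdzP; exists a; lia. Qed.

(* Without this, unification computes with rational literals. *)
Local Opaque addq mulq oppq invq.

Lemma ratr_id (x : rat) : ratr x = x.
Proof. by rewrite -(fmorph_eq_rat idfun). Qed.

(* The class of [4 (y - c)] modulo cubes, on the curve [y^2 = 4 x^3 + c^2]; since
   [4 (y - c) * 4 (y + c)] is a cube, [4 (y + c)] can replace it at [y = c]. *)
Definition kap (c y : rat) : rat :=
  if y == c then (4 * (y + c))^-1 else 4 * (y - c).

(** On the target, [Y^2 - d^2 = 4 X^3], so [Y - d] has a triple zero at [(0, d)]; its pullback along
    the isogeny is a cube. It is used for both square roots [d] of [- 27 D]. *)
Lemma isog_cube (F : numFieldType) (x y D d : F) : x != 0 ->
    y ^+ 2 = 4 * x ^+ 3 + D -> d ^+ 2 = - 27 * D ->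
  4 * (y * (x ^+ 3 - 2 * D) / x ^+ 3 - d) = ((y - d / 3) / x) ^+ 3.
Proof.
move=> x0 h hd; have x30 : x ^+ 3 != 0 by rewrite expf_neq0.
apply: (mulIf x30); rewrite expr_div_n divfK //.
set Y := _ / _; transitivity (4 * (Y * x ^+ 3) - 4 * d * x ^+ 3); first by ring.
rewrite /Y divfK //.
have DE : D = - d ^+ 2 / 27 by rewrite hd; field.
have x3E : x ^+ 3 = (y ^+ 2 - D) / 4 by rewrite h; field.
by rewrite x3E DE; field.
Qed.

Section Descent.
Variables (N : nat) (D c : rat).
Hypothesis N_gt0 : (0 < N)%N.
Hypothesis D_eq : D = N%:R ^+ 2 * - 27.
Hypothesis c_eq : c = N%:R * 27.
Notation E := (ell (- 27 * D) rat).
Implicit Types (x y : rat) (X Y Z T : E) (q : nat).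

Lemma N_neq0 : N%:R != 0 :> rat.
Proof. by rewrite pnatr_eq0 -lt0n. Qed.

Lemma c_neq0 : c != 0.
Proof. by rewrite c_eq mulf_neq0 ?N_neq0. Qed.

Lemma cNc : c != - c.
Proof. by rewrite -subr_eq0 opprK -mulr2n mulrn_eq0 /= c_neq0. Qed.

Lemma cDc : c + c != 0.
Proof. by rewrite -mulr2n mulrn_eq0 /= c_neq0. Qed.

Lemma kD : - 27 * D = c ^+ 2.
Proof. by rewrite D_eq c_eq; ring. Qed.

Lemma k_neq0 : - 27 * D != 0.
Proof. by rewrite kD expf_neq0 ?c_neq0. Qed.

Lemma on_curveE x y : on_curve (- 27 * D) (Some (x, y)) = (y ^+ 2 == 4 * x ^+ 3 + c ^+ 2).
Proof. by rewrite /= ratr_id kD. Qed.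

Lemma kap_neq0 x y : y ^+ 2 = 4 * x ^+ 3 + c ^+ 2 -> kap c y != 0.
Proof.
move=> h; rewrite /kap; case: (eqVneq y c) => [->|n].
  by rewrite invr_neq0 // mulf_neq0 ?cDc.
by rewrite mulf_neq0 // subr_eq0.
Qed.

(** Both factors of [(4 x)^3 = 4 (y - c) * 4 (y + c)] are cubes up to inverse classes. In this form
    the point [y = c] needs no separate treatment later: there [u = 0]. *)
Lemma kapE x y : y ^+ 2 = 4 * x ^+ 3 + c ^+ 2 ->
  exists u v, [/\ u * v = 4 * x, 4 * (y - c) = kap c y * u ^+ 3
    & 4 * (y + c) = (kap c y)^-1 * v ^+ 3].
Proof.
move=> h; have := kap_neq0 h; rewrite /kap; case: (eqVneq y c) => [ey|n] k0.
  have x0 : x = 0.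
    have /eqP : 4 * x ^+ 3 = 0 by rewrite -[LHS](addrK (c ^+ 2)) -h ey subrr.
    by rewrite mulf_eq0 expf_eq0 => /eqP.
  exists 0, 1; rewrite x0 ey subrr invrK; split; [ring|ring|].
    by rewrite expr1n mulr1.
exists 1, (4 * x); split; [ring|ring|].
apply: (mulfI k0); rewrite mulVKf //.
transitivity (16 * (y ^+ 2 - c ^+ 2)); first by ring.
by rewrite h; ring.
Qed.

Section AtPrime.
Variable q : nat.

Definition vkap X : 'F_3 := if coords X is Some (_, y) then vF q (kap c y) else 0.

Lemma vF_conj x y : y ^+ 2 = 4 * x ^+ 3 + c ^+ 2 -> y != c -> y != - c ->
  vF q (4 * (y - c)) = - vF q (4 * (y + c)).
Proof.
move=> h n1 n2; apply/eqP; rewrite -addr_eq0.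
have a0 : 4 * (y - c) != 0 by rewrite mulf_neq0 // subr_eq0.
have b0 : 4 * (y + c) != 0 by rewrite mulf_neq0 // addr_eq0.
rewrite -vFM //.
have e : 4 * (y - c) * (4 * (y + c)) = (4 * x) ^+ 3.
  transitivity (16 * (y ^+ 2 - c ^+ 2)); first by ring.
  by rewrite h; ring.
have : (4 * x) ^+ 3 != 0 by rewrite -e mulf_neq0.
by rewrite expf_eq0 /= => x0; rewrite e vF_cube.
Qed.

Lemma vkap_sub X x y : coords X = Some (x, y) -> y != c ->
  vkap X = vF q (4 * (y - c)).
Proof. by rewrite /vkap /kap => -> /negPf ->. Qed.

Lemma vkap_add X x y : coords X = Some (x, y) -> y != - c ->
  vkap X = - vF q (4 * (y + c)).
Proof.
move=> e n; have := coordsP X; rewrite e on_curveE => /eqP h.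
rewrite /vkap e /kap; case: (eqVneq y c) => [ey|n'].
  by rewrite vFV // mulf_neq0 // addr_eq0.
exact: vF_conj h n' n.
Qed.

Lemma vkapN X : vkap (ell_opp X) = - vkap X.
Proof.
case e: (coords X) => [[x y]|]; last by rewrite /vkap /= e oppr0.
have e' : coords (ell_opp X) = Some (x, - y) by rewrite /= e.
have [ey|n] := eqVneq y c.
  rewrite (vkap_add e) ?ey ?cNc // (vkap_sub e') ?ey; last first.
    by rewrite eq_sym cNc.
  by rewrite -opprD mulrN vFN opprK.
rewrite (vkap_sub e n) (vkap_add e') ?eqr_opp //.
by rewrite addrC -opprB mulrN vFN.
Qed.

Lemma vkap0 : vkap ell0 = 0. Proof. by []. Qed.

(** Evaluate [4 (X - x1) (X - x2) (X - x3) = 4 X^3 + c^2 - (l X + v)^2] where the line has ordinate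
    [c] or [- c]: the squares cancel and a cube remains. *)
Lemma line_prod l v x1 x2 x3 : line (- 27 * D) l v x1 x2 x3 ->
  (l * x1 + v - c) * (l * x2 + v - c) * (l * x3 + v - c) = (v - c) ^+ 3
  /\ (l * x1 + v + c) * (l * x2 + v + c) * (l * x3 + v + c) = (v + c) ^+ 3.
Proof.
case=> e1 e2; rewrite ratr_id kD => e3.
have key (d : rat) : d ^+ 2 = c ^+ 2 ->
    (l * x1 + v - d) * (l * x2 + v - d) * (l * x3 + v - d) = (v - d) ^+ 3.
  move=> hd; rewrite -hd in e3.
  transitivity (- (l ^+ 3) / 4 * (- 4 * x1 * x2 * x3)
     + l ^+ 2 * (v - d) / 2 * (2 * (x1 * x2 + x1 * x3 + x2 * x3))
     + l * (v - d) ^+ 2 / 4 * (4 * (x1 + x2 + x3)) + (v - d) ^+ 3); first by field.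
  by rewrite -e1 -e2 -e3; field.
split; first exact: key.
by have := key (- c); rewrite !opprK; apply; rewrite sqrrN.
Qed.

Lemma vkapD X Y : vkap (ell_add X Y) = vkap X + vkap Y.
Proof.
case: (ell_addP X Y) => [->|->|->|l v x1 x2 x3 Z ln eX eY eZ].
- by rewrite vkap0 add0r.
- by rewrite vkap0 addr0.
- by rewrite vkapN addNr.
have eZ' : coords (ell_opp Z) = Some (x3, l * x3 + v) by rewrite /= eZ /= opprK.
rewrite -[Z]ell_oppK vkapN; apply/eqP; rewrite eq_sym -addr_eq0; apply/eqP.
have [p1 p2] := line_prod ln.
have on1 := line_on ln; have on2 := line_on (line_perm ln).
have on3 := line_on (line_perm (line_perm ln)).
have x0 (x : rat) : (l * x + v) ^+ 2 = 4 * x ^+ 3 + ratr (- 27 * D) ->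
    (l * x + v) ^+ 2 = c ^+ 2 -> l * x + v = v.
  rewrite ratr_id kD => -> e.
  have /eqP : 4 * x ^+ 3 = 0 :> rat by rewrite -[LHS](addrK (c ^+ 2)) e subrr.
  by rewrite mulf_eq0 expf_eq0 => /eqP ->; rewrite mulr0 add0r.
have four (t : rat) : (4 * t != 0) = (t != 0) by rewrite mulf_eq0.
(* A point of ordinate [c] or [- c] has abscissa 0, where the line has ordinate [v]. So if [v = c]
   none of the three ordinates is [- c], and [y + c] serves for all; otherwise none is [c], and
   [y - c] does. *)
have [vc|vc] := eqVneq v c.
  have ne (x : rat) : (l * x + v) ^+ 2 = 4 * x ^+ 3 + ratr (- 27 * D) -> l * x + v != - c.
    move=> on; apply/eqP => e; have := x0 _ on; rewrite e sqrrN => /(_ erefl) e'.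
    by have := cNc; rewrite e' vc eqxx.
  rewrite (vkap_add eX) ?(vkap_add eY) ?(vkap_add eZ') ?ne // -!opprD.
  have n4 (x : rat) : (l * x + v) ^+ 2 = 4 * x ^+ 3 + ratr (- 27 * D) -> 4 * (l * x + v + c) != 0.
    by move=> on; rewrite four addr_eq0 ne.
  have [[h1 h2] h3] := (n4 _ on1, n4 _ on2, n4 _ on3).
  rewrite -(vFM _ h1 h2) -(vFM _ (mulf_neq0 h1 h2) h3).
  have -> : 4 * (l * x1 + v + c) * (4 * (l * x2 + v + c)) * (4 * (l * x3 + v + c))
     = (4 * (v + c)) ^+ 3.
    by rewrite [RHS]exprMn -p2; ring.
  by rewrite vF_cube ?oppr0 // four vc cDc.
have ne (x : rat) : (l * x + v) ^+ 2 = 4 * x ^+ 3 + ratr (- 27 * D) -> l * x + v != c.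
  move=> on; apply/eqP => e; have := x0 _ on; rewrite e => /(_ erefl) e'.
  by rewrite -e' eqxx in vc.
rewrite (vkap_sub eX) ?(vkap_sub eY) ?(vkap_sub eZ') ?ne //.
have n4 (x : rat) : (l * x + v) ^+ 2 = 4 * x ^+ 3 + ratr (- 27 * D) -> 4 * (l * x + v - c) != 0.
  by move=> on; rewrite four subr_eq0 ne.
have [[h1 h2] h3] := (n4 _ on1, n4 _ on2, n4 _ on3).
rewrite -(vFM _ h1 h2) -(vFM _ (mulf_neq0 h1 h2) h3).
have -> : 4 * (l * x1 + v - c) * (4 * (l * x2 + v - c)) * (4 * (l * x3 + v - c))
   = (4 * (v - c)) ^+ 3.
  by rewrite [RHS]exprMn -p1; ring.
by rewrite vF_cube // four subr_eq0.
Qed.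

Lemma vkap_isog (R : ell D rat) : vkap (isog R) = 0.
Proof.
rewrite /vkap /=; case e: (coords R) => [[x y]|] //=.
have := coordsP R; rewrite e /= ratr_id => /eqP h.
case: (eqVneq x 0) => //= x0.
set Y := _ / _.
have cube d : d ^+ 2 = c ^+ 2 -> 4 * (Y - d) = ((y - d / 3) / x) ^+ 3.
  by move=> hd; apply: isog_cube => //; rewrite hd kD.
rewrite /kap; case: (eqVneq Y c) => [eY|nY].
  have := cube (- c); rewrite sqrrN opprK => /(_ erefl) e'.
  have e0 : 4 * (Y + c) != 0 by rewrite eY mulf_neq0 // cDc.
  rewrite vFV // e' vF_cube ?oppr0 //.
  by apply: contraNneq e0 => z; rewrite e' z expr0n.
have e0 : 4 * (Y - c) != 0 by rewrite mulf_neq0 // subr_eq0.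
rewrite cube // vF_cube //.
by apply: contraNneq e0 => z; rewrite cube // z expr0n.
Qed.

(* Away from [N], the factors [(y - c) / 54] and [(y + c) / 54] of [(x / 9)^3]
   differ by the unit [N]. *)
Lemma vkap_unramified X : prime q -> ~~ (q %| N)%N -> vkap X = 0.
Proof.
move=> pr qN; case e: (coords X) => [[x y]|]; last by rewrite /vkap e.
have := coordsP X; rewrite e on_curveE => /eqP h.
have vN : vq q N%:R = 0 by rewrite vq_nat lognE (negPf qN) !andbF.
have [ey|n1] := eqVneq y c.
  rewrite (vkap_add e) ?ey ?cNc //.
  have -> : 4 * (c + c) = N%:R * 6 ^+ 3 by rewrite c_eq; ring.
  by rewrite vF_mul_cube ?N_neq0 // vF.unlock vN oppr0.
have [ey|n2] := eqVneq y (- c).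
  rewrite (vkap_sub e) ?ey //; last by rewrite eq_sym cNc.
  have -> : 4 * (- c - c) = - (N%:R * 6 ^+ 3) by rewrite c_eq; ring.
  by rewrite vFN vF_mul_cube ?N_neq0 // vF.unlock vN.
rewrite (vkap_sub e) //.
pose A := (y - c) / 54; pose B := (y + c) / 54.
have A0 : A != 0 by rewrite mulf_neq0 // subr_eq0.
have B0 : B != 0 by rewrite mulf_neq0 // addr_eq0.
have -> : 4 * (y - c) = A * 6 ^+ 3 by rewrite /A; field.
rewrite vF_mul_cube //.
have AB : A * B = (x / 9) ^+ 3.
  transitivity ((y ^+ 2 - c ^+ 2) / 54 ^+ 2); first by rewrite /A /B; field.
  by rewrite h; field.
have x0 : x / 9 != 0.
  by apply: contraTneq (mulf_neq0 A0 B0) => z; rewrite AB z expr0n.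
have BA : B - A = N%:R by rewrite /A /B c_eq; field.
have vAB : vq q A + vq q B = vq q (x / 9) *+ 3 by rewrite -vqM // AB vqX.
apply/eqP; rewrite vF.unlock F3_int_eq0.
(* If the valuations differ, the smaller one is that of [N], namely 0, so the other one is the
   multiple of 3; if they agree, twice their value is a multiple of 3. *)
have [lt|lt|eqv] := ltgtP (vq q A) (vq q B).
- have := @vqD_lt q (- A) B; rewrite oppr_eq0 vqN addrC BA vN => /(_ A0 B0 lt) [_ <-].
  exact: dvdz0.
- have := @vqD_lt q B (- A); rewrite oppr_eq0 vqN BA vN => /(_ B0 A0 lt) [_ e0].
  move: vAB; rewrite -e0 addr0 => ->.
  exact: dvdz3_mul3.
have : (3 %| 2 * vq q A)%Z.
  have -> : 2 * vq q A = vq q A + vq q B by rewrite eqv; ring.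
  by rewrite vAB dvdz3_mul3.
by rewrite Gauss_dvdzr.
Qed.

End AtPrime.

Lemma isog_of_vkap X : (forall q, prime q -> vkap q X = 0) ->
  exists R : ell D rat, X = isog R.
Proof.
move=> h0; case e: (coords X) => [[x y]|]; last first.
  by exists ell0; apply: ell_inj; rewrite e.
have := coordsP X; rewrite e on_curveE => /eqP h.
have [t et] : exists t, kap c y = t ^+ 3.
  apply: cube_vF; first exact: kap_neq0 h.
  by move=> q /h0; rewrite /vkap e.
have t0 : t != 0.
  by apply: contraNneq (kap_neq0 h) => z; rewrite et z expr0n.
have [u' [v' [uv eu ev]]] := kapE h; rewrite et in eu ev.
pose u := t * u'; pose v := t^-1 * v'.
have ux : x = u * v / 4.
  by rewrite /u /v mulrACA divff // mul1r uv mulrC mulKf.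
have {}eu : 4 * (y - c) = u ^+ 3 by rewrite eu /u exprMn.
have {}ev : 4 * (y + c) = v ^+ 3 by rewrite ev /v exprMn exprVn.
have yE : y = (u ^+ 3 + v ^+ 3) / 8 by rewrite -eu -ev; field.
have cE : N%:R = (v ^+ 3 - u ^+ 3) / 216 by rewrite -eu -ev c_eq; field.
(* By [isog_cube] a preimage should satisfy [y0 - 9 N = u x0] and [y0 + 9 N = v x0]. Solving with
   [216 N = v^3 - u^3] gives these coordinates. *)
pose x0 := (u ^+ 2 + u * v + v ^+ 2) / 12.
pose y0 := (u + v) * (u ^+ 2 + u * v + v ^+ 2) / 24.
have x0n : x0 != 0.
  apply: contraNneq N_neq0 => z.
  have -> : N%:R = x0 * (v - u) / 18 by rewrite cE /x0; field.
  by rewrite z !mul0r.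
have on0 : on_curve D (Some (x0, y0)).
  by apply/eqP; rewrite ratr_id D_eq cE /x0 /y0; field.
exists (Ell on0); apply: ell_inj; rewrite e /= (negPf x0n) ratr_id D_eq cE.
have w0 : u ^+ 2 + u * v + v ^+ 2 != 0.
  by apply: contraNneq x0n => z; rewrite /x0 z mul0r.
congr (Some (_, _)).
  by rewrite ux /x0; field.
by rewrite yE /y0 /x0; field.
Qed.

End Descent.

(** * Torsion *)

(** The equation that [not_three] produces for [r = y / e]. In lowest terms it forces 3 to divide
    the numerator and then, after division by 9, the denominator. *)
Lemma cubic_no_root (r : rat) : r ^+ 3 - 9 * r ^+ 2 - 9 * r + 9 != 0.
Proof.
apply/eqP => h; pose a := numq r; pose b := denq r.
have b0 : b%:~R != 0 :> rat by rewrite intr_eq0 denq_neq0.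
have rE : r = a%:~R / b%:~R by rewrite divq_num_den.
have {h} e : a ^+ 3 - 9 * a ^+ 2 * b - 9 * a * b ^+ 2 + 9 * b ^+ 3 = 0.
  apply/eqP; rewrite -(eqr_int rat) !(intrD, intrN, intrM, rmorphXn) /=; apply/eqP.
  transitivity (b%:~R ^+ 3 * (r ^+ 3 - 9 * r ^+ 2 - 9 * r + 9)).
    by rewrite rE; field.
  by rewrite h mulr0.
have /dvdzP[d ad] : (3 %| a)%Z.
  rewrite -(dvd3X _ 2); apply/dvdzP; exists (3 * a ^+ 2 * b + 3 * a * b ^+ 2 - 3 * b ^+ 3).
  by rewrite -[LHS]subr0 -e; ring.
have /dvdzP[f bf] : (3 %| b)%Z.
  rewrite -(dvd3X _ 2); apply/dvdzP; exists (- d ^+ 3 + 3 * d ^+ 2 * b + d * b ^+ 2).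
  by apply: (@mulfI _ 9) => //; rewrite -[RHS]addr0 -e ad; ring.
have := coprime_num_den r; rewrite -/a -/b ad bf !abszM /=.
by rewrite coprimeMl !coprimeMr (_ : coprime 3 3 = false) // !andbF.
Qed.

Section Torsion.
Variables (N : nat) (D c : rat).
Hypothesis N_gt0 : (0 < N)%N.
Hypothesis D_eq : D = N%:R ^+ 2 * - 27.
Hypothesis c_eq : c = N%:R * 27.
Let k0 := k_neq0 N_gt0 D_eq c_eq.
Notation G := (ellg k0 (ratr : {rmorphism rat -> algC})).
Variable P0 : G.
Hypothesis P0_eq : coords P0 = Some (0, c).
Implicit Types S T P : G.

Lemma coords_oppg S : coords (- S) = opp_raw (coords S).
Proof. by []. Qed.

Lemma coords_eq S T : coords S = coords T -> S = T.
Proof. exact: ell_inj. Qed.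

Lemma P0_cases S y : coords S = Some (0, y) -> S = P0 \/ S = - P0.
Proof.
move=> e; have := coordsP S; rewrite e (on_curveE D_eq c_eq) expr0n mulr0 add0r.
rewrite eqf_sqr => /orP[]/eqP ey; [left|right]; apply: coords_eq.
  by rewrite e P0_eq ey.
by rewrite e coords_oppg P0_eq ey /= .
Qed.

(** Such a point is a flex: its tangent meets the curve in three equal abscissae. Apart from
    [x1 = 0] this gives [v^2 = 3 x1^3], hence [3 c^2 + v^2 = 0], impossible over the rationals. *)
Lemma three_torsion S : S *+ 3 = 0 -> [\/ S = 0, S = P0 | S = - P0].
Proof.
have cn0 := c_neq0 N_gt0 c_eq.
move=> h; have [->|S0] := eqVneq S 0; first by constructor.
have SS : S + S = - S by apply/eqP; rewrite -addr_eq0 -mulr2n -mulrSr h.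
move: (SS); rewrite -[S + S]/(ell_add S S).
case: (ell_addP S S) => [e|e|e|l v x1 x2 x3 Z [e1 e2 e3] eS eS' eZ] SS'.
- by case/eqP: S0.
- by case/eqP: S0.
- by case/eqP: S0; apply: oppr_inj; rewrite -SS' oppr0.
move: eS'; rewrite eS => -[ex _]; subst x2.
move: eZ; rewrite SS' coords_oppg eS /= => -[ex _]; subst x3.
rewrite ratr_id (kD D_eq c_eq) in e3.
have hx : x1 * (v ^+ 2 - 3 * x1 ^+ 3) = 0.
  transitivity ((v ^+ 2 * (4 * (x1 + x1 + x1))
    - (2 * (x1 * x1 + x1 * x1 + x1 * x1)) ^+ 2) / 12); first by field.
  by rewrite -e1 -e2; field.
have x0 : x1 = 0.
  move/eqP: hx; rewrite mulf_eq0 => /orP[/eqP //|]; rewrite subr_eq0 => /eqP v2.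
  have : c ^+ 2 * 3 + v ^+ 2 = 0.
    transitivity (3 * (c ^+ 2 - v ^+ 2) + 4 * v ^+ 2); first by ring.
    by rewrite e3 v2; ring.
  have c2 : 0 < c ^+ 2 by rewrite exprn_even_gt0.
  by have := sqr_ge0 v; lra.
rewrite x0 in eS; have [->|->] := P0_cases eS; [by constructor 2|by constructor 3].
Qed.

(** The tangent at [S] gives the abscissa [w] of [2 S], and the line through [S] and [2 S] has to
    meet the curve again at [(0, - e)]. Eliminating [w] and [x1] leaves the cubic of [cubic_no_root]
    in [y / e]. *)
Lemma not_three S P e : e ^+ 2 = c ^+ 2 -> coords P = Some (0, e) -> S *+ 3 <> P.
Proof.
move=> e2; have e0 : e != 0 by rewrite -sqrf_eq0 e2 sqrf_eq0 (c_neq0 N_gt0 c_eq).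
move=> eP h; have {}h : S + (S + S) = P by rewrite -h (mulrS S 2) (mulr2n S).
have P0' : P != 0 by apply/eqP => z; rewrite z in eP.
move: h; rewrite -[S + S]/(ell_add S S).
case: (ell_addP S S) => [z|z|z|l v x1 x2 w W ln1 eS eS' eW].
- by have {}z : S = 0 := z; rewrite z addr0 => z'; case/eqP: P0'.
- by have {}z : S = 0 := z; rewrite z addr0 => z'; case/eqP: P0'.
- rewrite -[ell0]/(0 : G) addr0 => z'; case/eqP: e0; apply/eqP.
  have := congr1 (@coords _ _) z; rewrite coords_oppg z' eP /= => -[/eqP].
  by rewrite -addr_eq0 -mulr2n mulrn_eq0.
move: eS'; rewrite eS => -[ex _]; subst x2.
rewrite -[S + W]/(ell_add S W).
case: (ell_addP S W) => [z|z|z|m u x1' w' x3 Z ln2 eS'' eW' eZ] h.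
- by rewrite z in eS.
- by rewrite z in eW.
- by case/eqP: P0'.
move: eS''; rewrite eS => -[ex y1]; subst x1'.
move: eW'; rewrite eW => -[ex y2]; subst w'.
move: eZ; rewrite h eP => -[z3 eu]; subst x3.
have {}eu : u = - e by rewrite eu; ring.
have [a1 a2 a3] := ln1; have [b1 b2 b3] := ln2.
have on1 := line_on ln1; rewrite ratr_id (kD D_eq c_eq) -e2 in on1.
set y := l * x1 + v in on1 y1.
have mx : m * x1 = y + e by rewrite y1 eu subrK.
have ly : l * y = 6 * x1 ^+ 2.
  transitivity (l ^+ 2 * x1 - - (l * v)); first by rewrite /y; ring.
  by rewrite a1 a2; ring.
have hw1 : y ^+ 2 * w = 9 * x1 ^+ 4 - 2 * x1 * y ^+ 2.
  transitivity ((l * y) ^+ 2 / 4 - 2 * x1 * y ^+ 2); last by rewrite ly; field.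
  by rewrite exprMn a1; field.
have hw2 : 4 * x1 ^+ 2 * w = (y + e) ^+ 2 - 4 * x1 ^+ 3.
  by rewrite -mx exprMn b1; ring.
have x0 : x1 != 0.
  apply/eqP => x0.
  have w0 : w = 0.
    have y0 : y ^+ 2 != 0 by rewrite on1 x0 expr0n mulr0 add0r expf_neq0.
    by apply: (mulfI y0); rewrite hw1 x0 mulr0; ring.
  have yv : y = v by rewrite /y x0 mulr0 add0r.
  have yu : y = u by rewrite y1 x0 mulr0 add0r.
  move: y2; rewrite w0 !mulr0 !add0r -yv yu eu => /eqP.
  by rewrite opprK -subr_eq0 opprK -mulr2n mulrn_eq0 (negPf e0).
have four : 4 * x1 ^+ 3 = (y - e) * (y + e).
  by rewrite -[LHS](addrK (e ^+ 2)) -on1; ring.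
have ye : y + e != 0.
  apply: contraNneq x0 => z; move/eqP: four; rewrite z mulr0 mulf_eq0 expf_eq0 /=.
  by [].
have key : 8 * y ^+ 3 = 9 * (y - e) ^+ 2 * (y + e).
  apply: (mulIf ye).
  have k1 : y ^+ 2 * ((y + e) ^+ 2 - 4 * x1 ^+ 3)
      = 9 / 4 * (4 * x1 ^+ 3) ^+ 2 - 2 * (4 * x1 ^+ 3) * y ^+ 2.
    transitivity (4 * x1 ^+ 2 * (y ^+ 2 * w)); first by rewrite -hw2; ring.
    by rewrite hw1; field.
  move: k1; rewrite four => k1.
  transitivity (4 * (y ^+ 2 * ((y + e) ^+ 2 - (y - e) * (y + e)) + 2 * ((y - e) * (y + e)) * y ^+ 2)).
    by ring.
  by rewrite k1; field.
have := cubic_no_root (y / e); case/eqP.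
transitivity ((9 * (y - e) ^+ 2 * (y + e) - 8 * y ^+ 3) / e ^+ 3); first by field.
by rewrite key subrr mul0r.
Qed.

Lemma pow3_torsion e S : S *+ (3 ^ e) = 0 -> [\/ S = 0, S = P0 | S = - P0].
Proof.
elim: e S => [|e IHe] S; first by rewrite mulr1n; constructor.
rewrite expnS mulrnA => /IHe [h|h|h].
- exact: three_torsion.
- by case: (not_three (erefl _) P0_eq h).
- by case: (@not_three S (- P0) (- c)); rewrite ?sqrrN // coords_oppg P0_eq /= ?oppr0.
Qed.

(** Multiplication by the part [m] of the order prime to 3 lands in [0], [P0] or [- P0], and [m] is
    invertible in [F_3]. *)
Lemma torsion_vkap (T : G) : torsion T ->
  exists a : 'F_3, forall q, vkap c q T = a * vkap c q P0.
Proof.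
case=> n n0; rewrite (ell_mulnE T) => hn.
have [m cop en] := pfactor_coprime (isT : prime 3) n0.
have vn q (X : G) j : vkap c q (X *+ j) = vkap c q X *+ j.
  elim: j => [|j IHj]; first exact: vkap0.
  by rewrite (mulrS X) (mulrS (vkap c q X)) -IHj; apply: (vkapD N_gt0 D_eq c_eq).
have m0 : m%:R != 0 :> 'F_3 by rewrite (F3_int_eq0 m) dvdzE /= -prime_coprime //.
have hS : T *+ m *+ (3 ^ logn 3 n) = 0 by rewrite -mulrnA -en.
have [h|h|h] := pow3_torsion hS.
- exists 0 => q; rewrite mul0r; apply: (mulfI m0).
  by rewrite mulr_natl -vn h mulr0 vkap0.
- exists m%:R^-1 => q; apply: (mulfI m0).
  by rewrite mulVKf // mulr_natl -vn h.
exists (- m%:R^-1) => q; apply: (mulfI m0).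
rewrite mulNr mulrN mulVKf // mulr_natl -vn h.
exact: (vkapN N_gt0 D_eq c_eq).
Qed.

End Torsion.

(** * Galois cocycles *)

(** The splitting field of the minimal polynomial of [z] is Galois, and each of its automorphisms
    extends to [algC]; so [z] lies in the fixed field, which is the rationals. *)
Lemma galQ_fixed (z : algC) : (forall g : galQ, g z = z) -> z \in Crat.
Proof.
move=> fix_z; have [p [Dp mon_p] _] := minCpolyP z.
have [rs Drs] := closed_field_poly_normal (minCpoly z).
rewrite (monicP (minCpoly_monic z)) scale1r in Drs.
have z_rs : z \in rs by rewrite -root_prod_XsubC -Drs root_minCpoly.
have [Qs [QsC [rs1 Drs1 gen]]] := num_field_exists rs.
have ax : SplittingField.axiom Qs.
  exists (map_poly (in_alg Qs) p); first exact: alg_polyOver.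
  exists rs1 => //; suff -> : map_poly (in_alg Qs) p = \prod_(z <- rs1) ('X - z%:P).
    exact: eqpxx.
  apply: (map_poly_inj QsC); rewrite -map_poly_comp rmorph_prod /=.
  have -> : map_poly (QsC \o in_alg Qs) p = minCpoly z.
    by rewrite Dp; apply: eq_map_poly => a /=; rewrite alg_num_field fmorph_rat.
  rewrite Drs -Drs1 big_map; apply: eq_bigr => y _.
  by rewrite map_polyXsubC.
pose L : splittingFieldType rat := HB.pack Qs (FieldExt_isSplittingField.Build rat Qs ax).
pose LC : {rmorphism L -> algC} := QsC.
have [z1 _ Dz1] : exists2 z1 : L, z1 \in rs1 & z = LC z1.
  by apply/mapP; rewrite Drs1.
have gal1 : galois 1 {:L}.
  rewrite /galois sub1v normalFieldf andbT /=.
  by apply/separableP => y _; apply: pcharf0_separable => q; rewrite -(fmorph_pchar LC) pchar_num.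
have : z1 \in fixedField 'Gal({:L} / 1)%g.
  apply/fixedFieldP; first exact: memvf.
  move=> x _; have [nu Dnu] := extend_algC_subfield_aut LC x.
  by apply: (fmorph_inj LC); rewrite Dnu -Dz1; apply: fix_z.
rewrite (galois_fixedField gal1) => /vlineP[a Da].
by rewrite Dz1 Da alg_num_field fmorph_rat Crat_rat.
Qed.

Section Translation.
Variables (D : rat) (F : numFieldType).
Hypothesis D_neq0 : D != 0.
Variable w : F.
Hypothesis w2 : w ^+ 2 = ratr D.
Notation Pw := (zero_point w2).
Implicit Types (Q T : ell D F).

Lemma w_neq0 : w != 0.
Proof. by rewrite -sqrf_eq0 w2 fmorph_eq0. Qed.

Lemma zero_point_double : ell_add Pw Pw = ell_opp Pw.
Proof.
have ln : line D 0 w (0 : F) 0 0.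
  by split; rewrite ?w2; ring.
apply: ell_inj; by rewrite (ell_add_line D_neq0 ln) /=; congr (Some (_, _)); ring.
Qed.

(* The function [(y - d) / x], whose cube is [4 (Y - 3 d)] on the target of the
   isogeny, is multiplied by a cube root of unity under translation by [Pw]. *)
Lemma translate_zero_point d Q x y : d ^+ 2 = - 3 * w ^+ 2 ->
    coords Q = Some (x, y) -> x != 0 ->
  exists x' y', [/\ coords (ell_add Q Pw) = Some (x', y'), x' != 0
    & (y' - d) / x' = (d - w) / (2 * w) * ((y - d) / x)].
Proof.
move=> d2 eQ x0; have w0 := w_neq0.
case: (ell_addP Q Pw) => [e|e|e|l v x1 x2 x3 Z [a1 a2 _] eQ' eP eZ].
- by rewrite e in eQ.
- by have := congr1 (@coords _ _) e.
- by move: eQ; rewrite e /= => -[e0]; rewrite -e0 eqxx in x0.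
move: eQ'; rewrite eQ => -[ex ey]; subst x1.
move: eP => /= -[ex2 ew]; subst x2.
have {}ew : v = w by rewrite ew mulr0 add0r.
rewrite ew in a2 ey eZ; rewrite addr0 in a1.
have lw : l * w = - 2 * x * x3.
  by rewrite -[LHS]opprK a2; ring.
have x30 : x3 != 0.
  apply: contraNneq x0 => x30; move/eqP: lw.
  rewrite x30 mulr0 mulf_eq0 (negPf w0) orbF => /eqP l0.
  move/eqP: a1; rewrite l0 x30 addr0 expr0n /= eq_sym mulf_eq0 pnatr_eq0 /=.
  by move=> /eqP ->.
exists x3, (- (l * x3 + w)); split=> //.
have nz : 2 * w * x * x3 != 0 by rewrite !mulf_neq0 // pnatr_eq0.
have -> : y = l * x + w by [].
apply: (mulIf nz).
transitivity (2 * w * x * (- (l * x3 + w) - d)); first by field.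
transitivity ((d - w) * (l * x + w - d) * x3); last by (field; rewrite x0 w0).
have a1w : w ^+ 2 * (x + x3) = x ^+ 2 * x3 ^+ 2.
  transitivity ((l * w) ^+ 2 / 4); last by rewrite lw; field.
  by rewrite exprMn a1; field.
transitivity (2 * x ^+ 2 * x3 ^+ 2 + 2 * w ^+ 2 * x3 - 2 * d * w * x).
  transitivity (- 2 * x * x3 * (l * w) - 2 * w ^+ 2 * x - 2 * d * w * x); first by ring.
  have -> : 2 * w ^+ 2 * x = 2 * (w ^+ 2 * (x + x3)) - 2 * w ^+ 2 * x3 by ring.
  by rewrite lw a1w; ring.
have dl : d * l * x * x3 = - 2 * d * w * (x + x3).
  apply: (mulfI w0).
  transitivity (d * (l * w) * x * x3); first by ring.
  by rewrite lw; transitivity (- 2 * d * (x ^+ 2 * x3 ^+ 2)); [ring|rewrite -a1w; ring].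
symmetry; transitivity (d * l * x * x3 - (l * w) * x * x3 - x3 * d ^+ 2 + x3 * (2 * d * w - w ^+ 2)).
  by ring.
by rewrite dl lw d2; ring.
Qed.

End Translation.

Section Kernel.
Variables (D : rat).
Hypothesis D_neq0 : D != 0.
Notation G := (ellg D_neq0 (idfun : {rmorphism algC -> algC})).
Let w : algC := sqrtC (ratr D).
Let w2 : w ^+ 2 = ratr D := sqrtCK (ratr D).
Let PD : G := P_D D.
Implicit Types (Q T : G) (g : galQ).

Lemma PD3 : PD *+ 3 = 0.
Proof.
have e : PD + PD = - PD by apply: (zero_point_double D_neq0 w2).
by rewrite (mulrS PD 2) (mulr2n PD) e addrN.
Qed.

Lemma in_kernel_PD T : in_kernel T -> exists j, T = PD *+ j.
Proof.
move=> /(congr1 (@coords _ _)) /=.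
case e: (coords T) => [[x y]|] /=; last by exists 0%N; apply: ell_inj.
case: (eqVneq x 0) => [x0 _|//].
have := coordsP T.
rewrite e /= x0 expr0n mulr0 add0r -w2 eqf_sqr => /orP[]/eqP ey.
  by exists 1%N; apply: ell_inj; rewrite e x0 ey.
exists 2%N; rewrite -[PD *+ 2](addrK PD) -mulrSr PD3 sub0r.
by apply: ell_inj; rewrite e x0 ey.
Qed.

Lemma translate_PD d Q x y m : d ^+ 2 = - 3 * w ^+ 2 ->
    coords Q = Some (x, y) -> x != 0 ->
  exists x' y', [/\ coords (Q + PD *+ m) = Some (x', y'), x' != 0
    & (y' - d) / x' = ((d - w) / (2 * w)) ^+ m * ((y - d) / x)].
Proof.
move=> d2 eQ x0; elim: m => [|m [x1 [y1 [e1 x10 h1]]]].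
  by exists x, y; rewrite addr0 expr0 mul1r.
have [x2 [y2 [e2 x20 h2]]] := translate_zero_point D_neq0 w2 d2 e1 x10.
exists x2, y2; split=> //; last by rewrite h2 h1 mulrA -exprS.
by rewrite mulrSr addrA.
Qed.

Lemma gal_w g : g w = w \/ g w = - w.
Proof.
have /eqP : (g w) ^+ 2 = w ^+ 2 by rewrite -rmorphXn w2 fmorph_rat.
by rewrite eqf_sqr => /orP[]/eqP; [left|right].
Qed.

Lemma gal_PD g : (g w = w -> ell_map g PD = PD) /\ (g w = - w -> ell_map g PD = - PD).
Proof. by split=> e; apply: ell_inj; rewrite /= rmorph0 e. Qed.

Lemma gal_PDn g m : ell_map g (PD *+ m) = (ell_map g PD : G) *+ m.
Proof.
elim: m => [|m IHm]; first by apply: ell_inj.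
by rewrite !mulrS -IHm; apply: (ell_map_add g D_neq0).
Qed.

(* [om] is the factor of [translate_PD]; the factor [om ^+ j] corrects for the
   coboundary of [T = j P_D], which moves [Q] to [Q + T]. *)
Lemma cocycle_cube_root (d : rat) Q x y (e : galQ -> nat) :
    (ratr d) ^+ 2 = - 3 * w ^+ 2 -> coords Q = Some (x, y) -> x != 0 ->
    cohomologous (fun g => ell_muln (P_D D) (e g))
      (fun g => ell_sub (ell_map g Q) Q) ->
  let om := (ratr d - w) / (2 * w) in
  exists j, forall g : galQ, g ((y - ratr d) / x * om ^+ j)
     = om ^+ (e g) * ((y - ratr d) / x * om ^+ j).
Proof.
move=> d2 eQ x0 [T kT hT] om; have w0 : w != 0 by apply: w_neq0 w2.
have [j eT] := in_kernel_PD kT; exists j => g.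
(* [om = (-1 + d / w) / 2], where [d / w] is a square root of -3. *)
have om2 : om ^+ 2 + om + 1 = 0.
  transitivity (((ratr d) ^+ 2 + 3 * w ^+ 2) / (4 * w ^+ 2)); first by rewrite /om; field.
  by rewrite d2 mulNr addNr mul0r.
have om3 : om ^+ 3 = 1.
  apply/eqP; rewrite -subr_eq0; apply/eqP.
  by transitivity ((om - 1) * (om ^+ 2 + om + 1)); [ring|rewrite om2 mulr0].
have {hT} : (PD *+ e g) - ((ell_map g Q : G) - Q) = (ell_map g T : G) - (T : G).
  by rewrite -(ell_mulnE PD); apply: hT.
have main m : (ell_map g Q : G) = Q + PD *+ m ->
    g ((y - ratr d) / x) = om ^+ m * ((y - ratr d) / x).
  move=> eg; have [x' [y' [e' _ <-]]] := translate_PD m d2 eQ x0.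
  move: e'; rewrite -eg /= eQ /= => -[<- <-].
  by rewrite fmorph_div rmorphB /= fmorph_rat.
(* If [g] fixes [w] it fixes [P_D] and [om], and the coboundary vanishes. Otherwise the coboundary
   of [T] adds [2 j] to the exponent, while [g] squares [om]: the total [e g + 4 j] agrees with
   [e g + j] modulo 3. *)
case: (gal_w g) => gw; rewrite eT gal_PDn.
  rewrite (gal_PD g).1 // subrr => /eqP; rewrite subr_eq0 eq_sym subr_eq addrC => /eqP eg.
  have gom : g om = om.
    by rewrite /om fmorph_div rmorphB /= fmorph_rat rmorphM /= rmorph_nat gw.
  by rewrite rmorphM /= (main _ eg) rmorphXn /= gom [RHS]mulrA.
rewrite (gal_PD g).2 // mulNrn => eg0.
have eg : (ell_map g Q : G) = Q + PD *+ (e g + 2 * j).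
  have -> : PD *+ (e g + 2 * j) = PD *+ e g - (- (PD *+ j) - PD *+ j).
    by rewrite opprD !opprK mul2n -addnn !mulrnDr.
  by rewrite -eg0 subKr addrC subrK.
have gom : g om = om ^+ 2.
  rewrite /om fmorph_div rmorphB /= fmorph_rat rmorphM /= rmorph_nat gw.
  apply/eqP; rewrite -subr_eq0; apply/eqP; rewrite -[RHS]oppr0 -om2 /om.
  by field.
rewrite rmorphM /= (main _ eg) rmorphXn /= gom exprD.
have a3 : (om ^+ j) ^+ 3 = 1 by rewrite -exprM mulnC exprM om3 expr1n.
rewrite [(2 * j)%N]mulnC exprM [(om ^+ 2) ^+ j]exprAC.
transitivity (om ^+ e g * ((y - ratr d) / x * om ^+ j) * (om ^+ j) ^+ 3).
  by ring.
by rewrite a3 mulr1.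
Qed.

End Kernel.

(** * Kummer characters and coefficient vectors *)

Lemma logn_prodn (I : finType) (F : I -> nat) q : (forall i, 0 < F i)%N ->
  logn q (\prod_i F i) = (\sum_i logn q (F i))%N.
Proof.
move=> F0; have [] : (0 < \prod_i F i)%N /\ logn q (\prod_i F i) = (\sum_i logn q (F i))%N.
  elim/big_rec2: _ => [|i m k _ [m0 <-]]; first by rewrite logn1.
  by rewrite muln_gt0 F0 m0 lognM.
by [].
Qed.

Lemma cube_neq0 (R : idomainType) (x : R) : x ^+ 3 != 0 -> x != 0.
Proof. by rewrite expf_eq0. Qed.

Section LiftProd.
Variables (s : nat) (p : s.-tuple nat).
Hypothesis p_prime : forall i, prime (tnth p i).
Hypothesis p_uniq : uniq p.
Implicit Types (lam : 'rV['F_3]_s) (j : 'I_s).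

Lemma lift_prod_gt0 lam : (0 < lift_prod p lam)%N.
Proof. by apply: prodn_gt0 => i; rewrite expn_gt0 prime_gt0. Qed.

Lemma logn_lift_prod lam j : logn (tnth p j) (lift_prod p lam) = lam 0 j.
Proof.
rewrite /lift_prod logn_prodn => [|i]; last by rewrite expn_gt0 prime_gt0.
rewrite (bigD1 j) //= big1 ?addn0 => [|i ij].
  by rewrite lognX logn_prime // eqxx muln1.
rewrite lognX logn_prime // !(tnth_nth 0%N) nth_uniq ?size_tuple //.
by rewrite eq_sym (inj_eq val_inj) (negPf ij) muln0.
Qed.

Lemma vF_lift_prod lam j : vF (tnth p j) (lift_prod p lam)%:R = lam 0 j.
Proof.
rewrite vF.unlock vq_nat logn_lift_prod -[RHS]natr_Zp.
by [].
Qed.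

End LiftProd.

Lemma prim3_sum (F : fieldType) (z : F) : 3.-primitive_root z -> z ^+ 2 + z + 1 = 0.
Proof.
move=> zp; have z1 : z - 1 != 0.
  rewrite subr_eq0; apply/eqP => e; have := prim_order_dvd zp 1.
  by rewrite e expr1 eqxx.
apply: (mulfI z1); rewrite mulr0; transitivity (z ^+ 3 - 1); first by ring.
by rewrite (prim_expr_order zp) subrr.
Qed.

Section Zeta.
Variables (zeta : algC).
Hypothesis zeta_prim : 3.-primitive_root zeta.
Let z3 : zeta ^+ 3 = 1 := prim_expr_order zeta_prim.

Lemma exp_zetaD (a b : 'F_3) : zeta ^+ (a + b)%R = zeta ^+ a * zeta ^+ b.
Proof. by rewrite -exprD -[RHS](expr_mod _ z3). Qed.

Lemma exp_zetaM (a b : 'F_3) : zeta ^+ (a * b)%R = (zeta ^+ b) ^+ a.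
Proof. by rewrite -exprM mulnC -[RHS](expr_mod _ z3). Qed.

Lemma cube_root1 (u : algC) : u ^+ 2 + u + 1 = 0 -> u = zeta \/ u = zeta ^+ 2.
Proof.
move=> h; have hz := prim3_sum zeta_prim.
have /eqP : (u - zeta) * (u - zeta ^+ 2) = 0.
  transitivity ((u ^+ 2 + u + 1) - (zeta ^+ 2 + zeta + 1) * u + (zeta ^+ 3 - 1)); first by ring.
  by rewrite h hz z3; ring.
by rewrite mulf_eq0 !subr_eq0 => /orP[]/eqP; [left|right].
Qed.

Lemma exp_log3 (u : algC) : u ^+ 3 = 1 -> zeta ^+ log3 zeta u = u.
Proof.
move=> u3; rewrite /log3; case: pickP => [e /eqP //|h].
have [k k3 uk] : exists2 k : nat, (k < 3)%N & u = zeta ^+ k.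
  have /eqP : (u - 1) * (u ^+ 2 + u + 1) = 0.
    by transitivity (u ^+ 3 - 1); [ring|rewrite u3 subrr].
  rewrite mulf_eq0 subr_eq0 => /orP[]/eqP; first by exists 0%N; rewrite ?expr0.
  by case/cube_root1 => ->; [exists 1%N|exists 2%N].
by have := h (Ordinal k3 : 'F_3); rewrite /= uk eqxx.
Qed.

Lemma exp_kummer (p : nat) (g : galQ) : (0 < p)%N ->
  g (3.-root p%:R) = zeta ^+ kummer_char zeta p g * 3.-root p%:R.
Proof.
move=> p0; have c3 : (3.-root (p%:R : algC)) ^+ 3 = p%:R by rewrite rootCK.
have c0 : 3.-root (p%:R : algC) != 0 by rewrite rootC_eq0 // pnatr_eq0 -lt0n.
rewrite exp_log3 ?divfK // expr_div_n -rmorphXn c3 rmorph_nat divff //.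
by rewrite pnatr_eq0 -lt0n.
Qed.

Variables (s : nat) (p : s.-tuple nat).
Hypothesis p_prime : forall i, prime (tnth p i).

(** A cube root of [lift_prod p lam]; its Kummer character is the multiplier of [P_D] in
    [is_coef_vector] ([gal_lift_root]). *)
Definition lift_root (lam : 'rV['F_3]_s) : algC :=
  \prod_(i < s) (3.-root (tnth p i)%:R) ^+ lam 0 i.

Lemma lift_root3 lam : lift_root lam ^+ 3 = (lift_prod p lam)%:R.
Proof.
rewrite /lift_root /lift_prod natr_prod -prodrXl; apply: eq_bigr => i _.
by rewrite exprAC rootCK // natrX.
Qed.

Lemma lift_root_neq0 lam : lift_root lam != 0.
Proof.
by apply: cube_neq0; rewrite lift_root3 pnatr_eq0 -lt0n lift_prod_gt0.
Qed.

Lemma gal_lift_root lam (g : galQ) : g (lift_root lam)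
  = zeta ^+ (\sum_(i < s) lam 0 i * kummer_char zeta (tnth p i) g : 'F_3)%R * lift_root lam.
Proof.
rewrite /lift_root rmorph_prod.
rewrite (big_morph (fun a : 'F_3 => zeta ^+ a) exp_zetaD (expr0 _ : zeta ^+ (0%R : 'F_3) = 1)) -big_split /=.
apply: eq_bigr => i _; rewrite rmorphXn /= exp_kummer ?prime_gt0 //.
by rewrite exprMn exp_zetaM.
Qed.

End Zeta.

Section Coef.
Variables (N : nat) (D c : rat).
Hypothesis N_gt0 : (0 < N)%N.
Hypothesis D_eq : D = N%:R ^+ 2 * - 27.
Hypothesis c_eq : c = N%:R * 27.
Variables (zeta : algC) (s : nat) (p : s.-tuple nat).
Hypothesis zeta_prim : 3.-primitive_root zeta.
Hypothesis p_prime : forall i, prime (tnth p i).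
Hypothesis p_uniq : uniq p.

Lemma D_neq0 : D != 0.
Proof.
by have := k_neq0 N_gt0 D_eq c_eq; rewrite mulf_eq0 negb_or => /andP[].
Qed.

(** The Galois group multiplies a cube root [H] of [t], taken from a preimage of [X], and the cube
    root [C] of [lift_prod p lam] by powers of [om] and of [zeta] with the same exponent. Hence [t]
    is [lift_prod p lam] or its inverse, up to a rational cube. *)
Lemma coef_vector_vkap (X : ell (- 27 * D) rat) (lam : 'rV['F_3]_s) :
    X <> ell0 -> is_coef_vector zeta p X lam ->
  (forall i, lam 0 i = vkap c (tnth p i) X) \/
  (forall i, lam 0 i = - vkap c (tnth p i) X).
Proof.
move=> X0 [Q eQ coh].
case eX: (coords X) => [[x0 Y]|]; last by case: X0; apply: ell_inj.
have cN := cNc N_gt0 c_eq.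
(* At [Y = c] the root [c] would give [t = 0]; the other root gives the inverse class. *)
have [d0 [d02 Yd sgn]] : exists d0, [/\ d0 ^+ 2 = c ^+ 2, Y != d0 &
    (forall q, vkap c q X = vF q (4 * (Y - d0))) \/
    (forall q, vkap c q X = - vF q (4 * (Y - d0)))].
  have [eY|nY] := eqVneq Y c; last first.
    by exists c; split=> //; left => q; apply: vkap_sub eX nY.
  exists (- c); split; [by rewrite sqrrN|by rewrite eY|right => q].
  by rewrite opprK; apply: (vkap_add D_eq c_eq _ eX); rewrite eY.
set t := 4 * (Y - d0) in sgn.
have t0 : t != 0 by rewrite mulf_neq0 // subr_eq0.
have [x [y [eQ' x_neq0 yY]]] : exists x y, [/\ coords Q = Some (x, y), x != 0 &
    y * (x ^+ 3 - 2 * ratr D) / x ^+ 3 = ratr Y].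
  have := congr1 (@coords _ _) eQ; rewrite /= eX /=.
  case: (coords Q) => [[x y]|] //=; case: (eqVneq x 0) => // x_neq0 [_ e].
  by exists x, y.
have onQ := coordsP Q; rewrite eQ' in onQ; move/eqP: onQ => onQ.
have w2 : sqrtC (ratr D : algC) ^+ 2 = ratr D := sqrtCK _.
pose d := d0 / 3.
have d2 : (ratr d : algC) ^+ 2 = - 3 * sqrtC (ratr D) ^+ 2.
  have e : d ^+ 2 = - 3 * D by rewrite /d expr_div_n d02 -(kD D_eq c_eq); field.
  by rewrite w2 -rmorphXn /= e rmorphM rmorphN /= ratr_nat.
have [j] := @cocycle_cube_root D D_neq0 d Q x y _ d2 eQ' x_neq0 coh.
set om := (ratr d - _) / _; set H := _ * om ^+ j => gH.
have w0 : sqrtC (ratr D : algC) != 0 by rewrite sqrtC_eq0 fmorph_eq0 D_neq0.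
have om2 : om ^+ 2 + om + 1 = 0.
  move: @om @H gH w0 d2; set w := sqrtC _ => om H _ w0 d2.
  transitivity (((ratr d) ^+ 2 + 3 * w ^+ 2) / (4 * w ^+ 2)); first by rewrite /om; field.
  by rewrite d2 mulNr addNr mul0r.
have z3 := prim_expr_order zeta_prim.
have omz := cube_root1 zeta_prim om2.
have om3 : om ^+ 3 = 1.
  by case: omz => ->; rewrite // exprAC z3 expr1n.
have H3 : H ^+ 3 = ratr t.
  have -> : ratr t = 4 * (ratr Y - ratr d0) :> algC.
    by rewrite rmorphM rmorph_nat rmorphB.
  rewrite /H exprMn exprAC om3 expr1n mulr1 -yY.
  rewrite (@isog_cube _ x y (ratr D) (ratr d0)) //.
    by rewrite /d fmorph_div /= ratr_nat.
  by rewrite -rmorphXn /= d02 -(kD D_eq c_eq) rmorphM rmorphN /= ratr_nat.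
clearbody t.
have ratr0 r : (ratr r == 0 :> algC) = (r == 0) := fmorph_eq0 _ r.
have H0 : H != 0 by apply: cube_neq0; rewrite H3 ratr0.
set C := lift_root p lam; have C0 : C != 0 := lift_root_neq0 p_prime lam.
have C3 : C ^+ 3 = ratr (lift_prod p lam)%:R by rewrite lift_root3 ratr_nat.
have m0 : (lift_prod p lam)%:R != 0 :> rat.
  by rewrite pnatr_eq0 -lt0n lift_prod_gt0.
have gC g := gal_lift_root zeta_prim p_prime lam g; rewrite -/C in gC.
have key : (forall i, vF (tnth p i) t = lam 0 i) \/
    (forall i, vF (tnth p i) t = - lam 0 i).
  have nz g : zeta ^+ (\sum_(i < s) lam 0 i * kummer_char zeta (tnth p i) g : 'F_3)%R != 0.
    by rewrite expf_neq0 //; apply: cube_neq0; rewrite z3 oner_neq0.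
  (* For [om = zeta] the quotient [H / C] is Galois invariant, for [om = zeta^2] the product [H * C]
     is. *)
  case: omz => omz; [left|right] => i.
    have /CratP[r er] : H / C \in Crat.
      apply: galQ_fixed => g.
      by rewrite fmorph_div gH gC omz -mulf_div divff ?mul1r.
    have r0 : r != 0 by rewrite -ratr0 -er mulf_neq0 ?invr_eq0.
    have -> : t = (lift_prod p lam)%:R * r ^+ 3.
      apply: (fmorph_inj (ratr : {rmorphism rat -> algC})).
      by rewrite rmorphM rmorphXn /= -er -H3 -C3 expr_div_n mulrC divfK ?expf_neq0.
    by rewrite vF_mul_cube // vF_lift_prod.
  have /CratP[r er] : H * C \in Crat.
    apply: galQ_fixed => g.
    rewrite rmorphM /= gH gC omz mulrACA -exprM -exprD -mulSnr exprM.
    by rewrite z3 expr1n mul1r.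
  have r0 : r != 0 by rewrite -ratr0 -er mulf_neq0.
  have -> : t = (lift_prod p lam)%:R^-1 * r ^+ 3.
    apply: (fmorph_inj (ratr : {rmorphism rat -> algC})).
    by rewrite rmorphM rmorphXn fmorphV /= -er -C3 exprMn H3 mulrCA mulVf ?mulr1 ?expf_neq0.
  by rewrite vF_mul_cube ?invr_eq0 // vFV // vF_lift_prod.
case: sgn => sgn; case: key => key; [left|right|right|left] => i;
  by rewrite sgn key ?opprK.
Qed.

End Coef.

(** * The cokernel of the isogeny *)

Section Cokernel.
Variables (N : nat) (D c : rat).
Hypothesis N_gt0 : (0 < N)%N.
Hypothesis D_eq : D = N%:R ^+ 2 * - 27.
Hypothesis c_eq : c = N%:R * 27.
Variables (zeta : algC) (s : nat) (p : s.-tuple nat).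
Hypothesis zeta_prim : 3.-primitive_root zeta.
Hypothesis p_eq : perm_eq p (primes N).
Notation E := (ell (- 27 * D) rat).
Implicit Types X Y : E.

Lemma p_uniq : uniq p.
Proof. by rewrite (perm_uniq p_eq) primes_uniq. Qed.

Lemma mem_p q : (q \in p) = prime q && (q %| N)%N.
Proof. by rewrite (perm_mem p_eq) mem_primes N_gt0. Qed.

Lemma p_prime i : prime (tnth p i).
Proof. by have := mem_tnth i p; rewrite mem_p => /andP[]. Qed.

Definition descent X : 'rV['F_3]_s := \row_i vkap c (tnth p i) X.

Lemma descentD X Y : descent (ell_add X Y) = descent X + descent Y.
Proof. by apply/rowP => i; rewrite !mxE; apply: (vkapD N_gt0 D_eq c_eq). Qed.

Lemma descentN X : descent (ell_opp X) = - descent X.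
Proof. by apply/rowP => i; rewrite !mxE; apply: (vkapN N_gt0 D_eq c_eq). Qed.

Lemma descent0 : descent ell0 = 0.
Proof. by apply/rowP => i; rewrite !mxE. Qed.

Lemma descent_muln X m : descent (ell_muln X m) = descent X *+ m.
Proof.
elim: m => [|m IHm]; first exact: descent0.
by rewrite (mulrS (descent X)) -IHm; apply: descentD.
Qed.

Lemma descent_mulz X m : descent (ell_mulz X m) = descent X *~ m.
Proof.
by case: m => m; rewrite /ell_mulz ?descentN descent_muln // NegzE mulrNz.
Qed.

Lemma descent_int_comb r (P : 'I_r -> E) (a : 'I_r -> int) :
  descent (int_comb P a) = \sum_i descent (P i) *~ a i.
Proof.
rewrite /int_comb (big_morph _ descentD descent0).
by apply: eq_bigr => i _; apply: descent_mulz.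
Qed.

Lemma descent_isog X : descent X = 0 <-> exists R : ell D rat, X = isog R.
Proof.
split=> [h|[R ->]]; last first.
  by apply/rowP => i; rewrite !mxE; apply: (vkap_isog N_gt0 D_eq c_eq).
apply: (isog_of_vkap N_gt0 D_eq c_eq) => q pr.
have [qp|qp] := boolP (q \in p).
  by have /tnthP[i ->] := qp; move/rowP: h => /(_ i); rewrite !mxE.
by apply: (vkap_unramified N_gt0 D_eq c_eq) => //; move: qp; rewrite mem_p pr.
Qed.

Variables (r : nat) (P : 'I_r.+1 -> E) (M : 'M['F_3]_(r.+1, s)).
Hypothesis P0_eq : coords (P ord0) = Some (0, c).
Hypothesis P_free : free_part_generators (fun i : 'I_r => P (lift ord0 i)).
Hypothesis M_rows : forall i, is_coef_vector zeta p (P i) (row i M).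
Notation V := (<<[seq row i M | i <- enum 'I_r.+1]>>%VS : {vspace 'rV['F_3]_s}).

(** [coef_vector_vkap] requires an affine point. If a free generator were [ell0], the combination
    with the single coefficient 1 at it would be torsion. *)
Lemma gen_neq0 i : P i <> ell0.
Proof.
have [j ->|->] := unliftP ord0 i; last by move=> e; have := P0_eq; rewrite e.
move=> e; have [_ indep] := P_free.
pose a (k : 'I_r) : int := if k == j then 1 else 0.
suff e0 : int_comb (fun k : 'I_r => P (lift ord0 k)) a = ell0.
  have := indep a; rewrite e0 => /(_ _ j) h.
  have : a j = 0 by apply: h; exists 1%N => //; apply: ell_0add.
  by rewrite /a eqxx.
rewrite /int_comb; apply: (big_ind (fun Z : E => Z = ell0)) => // [X Y -> ->|k _].
  exact: ell_add0.
by rewrite /a; case: eqVneq => [->|_] //; rewrite e; apply: ell_0add.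
Qed.

(** The sign is left open for each [i]; the span [V] does not see it. *)
Lemma row_descent i : row i M = descent (P i) \/ row i M = - descent (P i).
Proof.
have [h|h] := coef_vector_vkap N_gt0 D_eq c_eq zeta_prim p_prime p_uniq
  (@gen_neq0 i) (M_rows i); [left|right]; by apply/rowP => j; rewrite h !mxE.
Qed.

Lemma row_mem i : row i M \in V.
Proof. by apply/memv_span/mapP; exists i; rewrite ?mem_enum. Qed.

Lemma descent_gen_mem i : descent (P i) \in V.
Proof.
have [<-|h] := row_descent i; first exact: row_mem.
by rewrite -[descent _]opprK -h memvN row_mem.
Qed.

Lemma mem_descent (v : 'rV['F_3]_s) : v \in V <-> exists X, descent X = v.
Proof.
split=> [|[X <-]].
  set S := [seq _ | i <- _] => vV; rewrite (coord_span (X := in_tuple S) vV).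
  pose Q (u : 'rV['F_3]_s) := exists X, descent X = u.
  apply: (@big_ind _ Q) => [|u1 u2 [X1 <-] [X2 <-]|i _].
  - by exists ell0; apply: descent0.
  - by exists (ell_add X1 X2); apply: descentD.
  have /mapP[k _ ->] : S`_i \in S by rewrite mem_nth.
  set a : 'F_3 := coord _ _ _.
  have aE u : a *: u = u *+ a :> 'rV['F_3]_s by rewrite -[in LHS](natr_Zp a) scaler_nat.
  rewrite aE; case: (row_descent k) => ->; rewrite -?descentN -descent_muln.
    by exists (ell_muln (P k) a).
  by exists (ell_muln (ell_opp (P k)) a).
have [T [a [tT ->]]] := P_free.1 X.
rewrite descentD descent_int_comb memvD //; last first.
  by apply: memv_suml => i _; rewrite rpredMz // descent_gen_mem.
have [b hb] := @torsion_vkap N D c N_gt0 D_eq c_eq _ P0_eq T tT.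
have -> : descent T = b *: descent (P ord0) by apply/rowP => i; rewrite !mxE hb.
by rewrite memvZ // descent_gen_mem.
Qed.

Lemma cokernel_iso_descent : cokernel_iso D V.
Proof.
exists descent; split; [|exact: mem_descent|exact: descentD|] => [X Y|a X].
  rewrite -descent_isog descentD descentN.
  by split=> [->|/eqP]; rewrite ?subrr // subr_eq0 => /eqP.
by rewrite descent_muln -[in RHS](natr_Zp a) scaler_nat.
Qed.

End Cokernel.

(** * Integers of pure cubic fields *)

Definition squarefree (n : nat) : Prop := forall q, prime q -> ~~ (q ^ 2 %| n)%N.

Lemma vq_int_ge0 q (r : rat) : r \is a Num.int -> 0 <= vq q r.
Proof. by rewrite Qint_def /vq => /eqP ->; rewrite logn1 subr0. Qed.

Lemma vq_add_int q (t1 t2 : rat) : t1 != 0 -> t2 != 0 -> t1 + t2 \is a Num.int ->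
  vq q t1 != vq q t2 -> 0 <= vq q t1 /\ 0 <= vq q t2.
Proof.
move=> n1 n2 /(vq_int_ge0 q) h; case: (ltgtP (vq q t1) (vq q t2)) => // lt _.
  have [_ e] := vqD_lt n1 n2 lt; rewrite e in h; split=> //.
  exact: le_trans h (ltW lt).
have [_ e] := vqD_lt n2 n1 lt; rewrite addrC e in h; split=> //.
exact: le_trans h (ltW lt).
Qed.

Section AwayFromThree.
Variables (a b : nat) (y z : rat).
Hypothesis ab_sqf : squarefree (a * b).
Hypotheses (a_gt0 : (0 < a)%N) (b_gt0 : (0 < b)%N).
Hypothesis Ny_int : (a * b)%:R * y \is a Num.int.
Hypothesis cubes_int : (a * b ^ 2)%:R * y ^+ 3 + (a ^ 2 * b)%:R * z ^+ 3 \is a Num.int.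

(** At a prime dividing [a b], squarefreeness makes the valuations of the two cubic terms differ
    modulo 3, so they cannot cancel: each is nonnegative, and that of [y] is at least -2/3. At any
    other prime [Ny_int] is enough. *)
Lemma cubes_int_l : y \is a Num.int.
Proof.
have [->|y0] := eqVneq y 0; first exact: rpred0.
apply: vq_int => q pr.
have nz k : (0 < k)%N -> k%:R != 0 :> rat by rewrite pnatr_eq0 -lt0n.
have ab0 : (0 < a * b)%N by rewrite muln_gt0 a_gt0.
have := vq_int_ge0 q Ny_int; rewrite vqM ?nz // vq_nat lognM //.
have := ab_sqf pr; rewrite pfactor_dvdn // -ltnNge lognM // => v1 v2.
have T1 : vq q ((a * b ^ 2)%:R * y ^+ 3) = (logn q a + 2 * logn q b)%N%:Z + vq q y *+ 3.
  rewrite vqM ?nz ?expf_neq0 ?muln_gt0 ?expn_gt0 ?a_gt0 ?b_gt0 //.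
  by rewrite vqX // vq_nat lognM ?expn_gt0 ?b_gt0 // lognX.
have [z0|z0] := eqVneq z 0.
  move: cubes_int; rewrite z0 expr0n /= mulr0 addr0 => /(vq_int_ge0 q).
  by rewrite T1; lia.
have T2 : vq q ((a ^ 2 * b)%:R * z ^+ 3) = (2 * logn q a + logn q b)%N%:Z + vq q z *+ 3.
  rewrite vqM ?nz ?expf_neq0 ?muln_gt0 ?expn_gt0 ?a_gt0 ?b_gt0 //.
  by rewrite vqX // vq_nat lognM ?expn_gt0 ?a_gt0 // lognX.
have [ab|ab] := posnP (logn q a + logn q b)%N; first by move: v2; lia.
have n1 : (a * b ^ 2)%:R * y ^+ 3 != 0.
  by rewrite mulf_neq0 ?expf_neq0 ?nz ?muln_gt0 ?expn_gt0 ?a_gt0 ?b_gt0.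
have n2 : (a ^ 2 * b)%:R * z ^+ 3 != 0.
  by rewrite mulf_neq0 ?expf_neq0 ?nz ?muln_gt0 ?expn_gt0 ?a_gt0 ?b_gt0.
have := @vq_add_int q _ _ n1 n2 cubes_int; rewrite T1 T2 => h.
have [] : 0 <= (logn q a + 2 * logn q b)%N%:Z + vq q y *+ 3 /\
   0 <= (2 * logn q a + logn q b)%N%:Z + vq q z *+ 3 by apply: h; lia.
by lia.
Qed.

End AwayFromThree.

Lemma dvd3_dec (x : int) : (3 %| x)%Z \/ ~~ (3 %| x)%Z.
Proof. by case: (3 %| x)%Z; [left|right]. Qed.

Lemma sign_mod3 (x : int) : ~~ (3 %| x)%Z ->
  exists2 k : int, x = 1 + 3 * k \/ x = - (1 + 3 * k) & True.
Proof.
move=> x3; have r0 : (x %% 3)%Z != 0 by apply: contraNneq x3 => /dvdz_mod0P.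
have e := divz_eq x 3; have := modz_ge0 x (isT : 3 != 0 :> int).
have := ltz_pmod x (isT : 0 < 3 :> int); move: r0.
case: (x %% 3)%Z e => [[|[|[|?]]]|?] // e _ _ _.
  by exists (x %/ 3)%Z => //; left; rewrite {1}e; ring.
by exists (- (x %/ 3)%Z - 1) => //; right; rewrite {1}e; ring.
Qed.

(** * Congruences at the prime 3 *)

Section AtThree.
Implicit Types (a b x y z : int).

(** The two divisibilities say that the element with coordinates [x / 3], [y / 3], [z / 3] has
    integral second symmetric function and norm. As 3 divides [a] once and not [b], the pure terms
    of the norm have valuations 0, 1, 2 modulo 3, so a factor 3 comes off [x], [y], [z] in turn. *)
Lemma three_ramified a b x y z : (3 %| a)%Z -> ~~ (9 %| a * b)%Z ->
    (3 %| x ^+ 2 - a * b * (y * z))%Z ->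
    (27 %| x ^+ 3 + a * b ^+ 2 * y ^+ 3 + a ^+ 2 * b * z ^+ 3
       - 3 * (a * b) * (x * y * z))%Z ->
  [/\ (3 %| x)%Z, (3 %| y)%Z & (3 %| z)%Z].
Proof.
move=> /dvdzP[a1 ->] n9 d2 /dvdzP[c ec].
have n3 : ~~ (3 %| a1 * b)%Z.
  by apply: contraNN n9 => /dvdzP[k e]; apply/dvdzP; exists k; rewrite mulrAC e; ring.
move: n3; rewrite dvd3M negb_or => /andP[na nb].
have /dvdzP[x1 ex] : (3 %| x)%Z.
  rewrite -(dvd3X _ 1); move/dvdzP: d2 => [k e].
  apply/dvdzP; exists (k + a1 * b * (y * z)).
  by rewrite mulrDl -e; ring.
rewrite {}ex in ec *.
have ec2 : a1 * b ^+ 2 * y ^+ 3 + 3 * (a1 ^+ 2 * b * z ^+ 3)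
   = 9 * (c - x1 ^+ 3 + a1 * b * x1 * y * z).
  apply: (@mulfI _ 3) => //.
  transitivity (c * 27 - 27 * x1 ^+ 3 + 27 * (a1 * b * x1 * y * z)); last by ring.
  by rewrite -ec; ring.
have /dvdzP[y1 ey] : (3 %| y)%Z.
  have : (3 %| a1 * b ^+ 2 * y ^+ 3)%Z.
    apply/dvdzP; exists (3 * (c - x1 ^+ 3 + a1 * b * x1 * y * z) - a1 ^+ 2 * b * z ^+ 3).
    transitivity (9 * (c - x1 ^+ 3 + a1 * b * x1 * y * z) - 3 * (a1 ^+ 2 * b * z ^+ 3)).
      by rewrite -ec2; ring.
    by ring.
  by rewrite !dvd3M (negPf na) (negPf nb) /= !orbb.
rewrite {}ey in ec2 *.
have : (3 %| a1 ^+ 2 * b * z ^+ 3)%Z.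
  apply/dvdzP; exists (c - x1 ^+ 3 + a1 * b * x1 * (y1 * 3) * z - 3 * a1 * b ^+ 2 * y1 ^+ 3).
  apply: (@mulfI _ 3) => //.
  transitivity (9 * (c - x1 ^+ 3 + a1 * b * x1 * (y1 * 3) * z) - a1 * b ^+ 2 * (y1 * 3) ^+ 3).
    by rewrite -ec2; ring.
  by ring.
rewrite !dvd3M (negPf nb) (negPf na) /= !orbb => z3.
by split; rewrite ?orbT.
Qed.

(** The sum gives [i + j = 3 (l - k + 3 c)]. Modulo 27 the product then leaves [9 i j = 0], so 3
    divides both [i + j] and [i j]. *)
Lemma mod9_key (k i j l c : int) :
    (1 + 9 * k) * (1 + 3 * i) * (1 + 3 * j) = (1 + 3 * l) ^+ 3 ->
    (1 + 9 * k) + (1 + 3 * i) + (1 + 3 * j) = 3 * (1 + 3 * l) + 27 * c ->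
  (3 %| i)%Z.
Proof.
move=> hp hs; have hj : j = 3 * (l - k + 3 * c) - i.
  by apply: (@mulfI _ 3) => //; move: hs; lia.
have : (3 %| i * j)%Z.
  apply/dvdzP; exists (l ^+ 2 + l ^+ 3 - c - 3 * k * (l - k + 3 * c + i * j)).
  apply: (@mulfI _ 9) => //.
  transitivity ((1 + 9 * k) * (1 + 3 * i) * (1 + 3 * j) - 1 - 9 * k
    - (1 + 9 * k) * 3 * (i + j) - 81 * k * (i * j)); first by ring.
  by rewrite hp hj; ring.
rewrite dvd3M => /orP[//|/dvdzP[t et]].
by apply/dvdzP; exists (l - k + 3 * c - t); rewrite mulrBl -et hj; ring.
Qed.

Lemma cube_mod9 x : ~~ (3 %| x)%Z ->
  exists k e : int, [/\ e = 1 \/ e = -1, x ^+ 3 = e * (1 + 9 * k) & (3 %| x - e)%Z].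
Proof.
move=> /sign_mod3[k [->|->] _].
  exists (k + 3 * k ^+ 2 + 3 * k ^+ 3), 1; split; [by left|by ring|].
  by apply/dvdzP; exists k; ring.
exists (k + 3 * k ^+ 2 + 3 * k ^+ 3), (-1); split; [by right|by ring|].
by apply/dvdzP; exists (- k); ring.
Qed.

(** Three signs whose sum is 0 modulo 3 are equal. *)
Lemma signs_agree (e k v w V W t c : int) : e = 1 \/ e = -1 ->
    V = 1 + 3 * v \/ V = - (1 + 3 * v) -> W = 1 + 3 * w \/ W = - (1 + 3 * w) ->
    e * (1 + 9 * k) + V + W = 3 * t + 27 * c ->
  V = e * (1 + 3 * v) /\ W = e * (1 + 3 * w).
Proof. by case=> -> [|] -> [|] ->; lia. Qed.

(** One coordinate divisible by 3 forces the others to be. Otherwise [x^3], [V = a b^2 y^3] and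
    [W = a^2 b z^3] are units modulo 3 with product [(a b x y z)^3] and sum [3 a b x y z] modulo 27;
    [mod9_key] makes [V] congruent to 1 or -1 modulo 9, and then so is [a b^2]. *)
Lemma three_unramified a b x y z : ~~ (3 %| a * b)%Z ->
    ~~ (9 %| a * b ^+ 2 - 1)%Z -> ~~ (9 %| a * b ^+ 2 + 1)%Z ->
    (3 %| x ^+ 2 - a * b * (y * z))%Z ->
    (27 %| x ^+ 3 + a * b ^+ 2 * y ^+ 3 + a ^+ 2 * b * z ^+ 3
       - 3 * (a * b) * (x * y * z))%Z ->
  [/\ (3 %| x)%Z, (3 %| y)%Z & (3 %| z)%Z].
Proof.
move=> nab m1 m2 /dvdzP[d ed] /dvdzP[c ec].
have [na nb] : ~~ (3 %| a)%Z /\ ~~ (3 %| b)%Z.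
  by move: nab; rewrite dvd3M negb_or => /andP[].
have dvdD u v : (3 %| u)%Z -> (3 %| v)%Z -> (3 %| u + v)%Z by apply: rpredD.
have x_of_yz : (3 %| y * z)%Z -> (3 %| x)%Z.
  move=> h; rewrite -(dvd3X x 1) -[x ^+ 2](subrK (a * b * (y * z))).
  by rewrite ed dvdD // dvd3M ?orbT // h orbT.
have z_of_xy : (3 %| x)%Z -> (3 %| y)%Z -> (3 %| z)%Z.
  move=> /dvdzP[x1 ex] /dvdzP[y1 ey].
  have : (3 %| a ^+ 2 * b * z ^+ 3)%Z.
    apply/dvdzP; exists (9 * c - 9 * x1 ^+ 3 - 9 * a * b ^+ 2 * y1 ^+ 3 + (a * b) * (x * y * z)).
    transitivity (c * 27 - x ^+ 3 - a * b ^+ 2 * y ^+ 3 + 3 * (a * b) * (x * y * z)).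
      by rewrite -ec; ring.
    by rewrite ex ey; ring.
  by rewrite !dvd3M (negPf nb) (negPf na) /= !orbb.
have y_of_xz : (3 %| x)%Z -> (3 %| z)%Z -> (3 %| y)%Z.
  move=> /dvdzP[x1 ex] /dvdzP[z1 ez].
  have : (3 %| a * b ^+ 2 * y ^+ 3)%Z.
    apply/dvdzP; exists (9 * c - 9 * x1 ^+ 3 - 9 * a ^+ 2 * b * z1 ^+ 3 + (a * b) * (x * y * z)).
    transitivity (c * 27 - x ^+ 3 - a ^+ 2 * b * z ^+ 3 + 3 * (a * b) * (x * y * z)).
      by rewrite -ec; ring.
    by rewrite ex ez; ring.
  by rewrite !dvd3M (negPf nb) (negPf na) /= !orbb.
have [y3|ny] := dvd3_dec y.
  have x3 : (3 %| x)%Z by apply: x_of_yz; rewrite dvd3M y3.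
  exact: (And3 x3 y3 (z_of_xy x3 y3)).
have [z3|nz] := dvd3_dec z.
  have x3 : (3 %| x)%Z by apply: x_of_yz; rewrite dvd3M z3 orbT.
  exact: (And3 x3 (y_of_xz x3 z3) z3).
have [x3|nx] := dvd3_dec x.
  have : (3 %| a * b * (y * z))%Z.
    have -> : a * b * (y * z) = x ^+ 2 + - d * 3 by rewrite mulNr -ed; ring.
    by apply: dvdD; rewrite dvd3M ?x3 ?orbT.
  by rewrite !dvd3M (negPf na) (negPf nb) (negPf ny) (negPf nz).
have [k [e [he xe ex]]] := cube_mod9 nx.
have [k' [e' [he' ye ey]]] := cube_mod9 ny.
have e2 : e * e = 1 by case: he => ->.
have e'2 : e' * e' = 1 by case: he' => ->.
pose m := a * b ^+ 2; pose V := m * y ^+ 3; pose W := a ^+ 2 * b * z ^+ 3.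
pose l := 3 * k - e * d * x.
have tl : a * b * (x * y * z) = e * (1 + 3 * l).
  transitivity (x * (x ^+ 2 - (x ^+ 2 - a * b * (y * z)))); first by ring.
  rewrite ed; transitivity (x ^+ 3 - 3 * d * x); first by ring.
  by rewrite xe -[d]mul1r -e2 /l; ring.
have hsum : e * (1 + 9 * k) + V + W = 3 * (e * (1 + 3 * l)) + 27 * c.
  rewrite -tl -xe -[27 * c]mulrC -ec /V /W /m; ring.
have hprod : e * (1 + 9 * k) * V * W = (e * (1 + 3 * l)) ^+ 3.
  by rewrite -tl -xe /V /W /m; ring.
have nV : ~~ (3 %| V)%Z.
  by rewrite /V /m !dvd3M (negPf na) (negPf nb) (negPf ny).
have nW : ~~ (3 %| W)%Z.
  by rewrite /W !dvd3M (negPf na) (negPf nb) (negPf nz).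
have [i eV] : exists i, V = e * (1 + 3 * i) /\ (3 %| i)%Z.
  have [v hV _] := sign_mod3 nV; have [w hW _] := sign_mod3 nW.
  have [eV eW] : V = e * (1 + 3 * v) /\ W = e * (1 + 3 * w).
    exact: signs_agree he hV hW hsum.
  exists v; split=> //; apply: (@mod9_key k v w l (e * c)).
    have e3 : e ^+ 3 * ((1 + 9 * k) * (1 + 3 * v) * (1 + 3 * w)) = e ^+ 3 * (1 + 3 * l) ^+ 3.
      by rewrite -exprMn -hprod eV eW; ring.
    by move: e3; rewrite !exprS expr0 mulr1 e2 mulr1; case: he => -> /mulfI; apply.
  have hs2 : e * e * ((1 + 9 * k) + (1 + 3 * v) + (1 + 3 * w))
      = e * e * (3 * (1 + 3 * l)) + 27 * (e * c).
    transitivity (e * (e * (1 + 9 * k) + V + W)); first by rewrite eV eW; ring.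
    by rewrite hsum; ring.
  by rewrite e2 !mul1r in hs2.
case: eV => eV /dvdzP[i1 ei].
have em : m = e * e' + 9 * (e * e' * i1 - m * k').
  rewrite -[LHS]mulr1 -e'2 -[e' in _ * (_ * e')](addrK (e' * (9 * k'))).
  transitivity (e' * (m * (e' * (1 + 9 * k'))) - (e' * e') * (9 * m * k')); first by ring.
  by rewrite -ye -/V eV ei e'2; ring.
have d9 : (9 %| m - e * e')%Z.
  by apply/dvdzP; exists (e * e' * i1 - m * k'); rewrite {1}em; ring.
have [ee|ee] : e * e' = 1 \/ e * e' = -1.
  by case: he => ->; case: he' => ->; [left|right|right|left].
  by move: d9; rewrite ee => d9; rewrite -/m d9 in m1.
by move: d9; rewrite ee opprK => d9; rewrite -/m d9 in m2.
Qed.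

End AtThree.

(** Gauss's lemma: a proportional integer polynomial divides [p], and its leading coefficient is 1
    or -1 because [p] is monic. *)
Lemma monic_factor_int (q : {poly rat}) (p : {poly int}) :
    q \is monic -> p \is monic -> q %| map_poly intr p ->
  forall i, q`_i \is a Num.int.
Proof.
move=> mq mp /dvdpP_rat_int[q1 [c c0 eq] [r ep]] i.
have : lead_coef q1 * lead_coef r = 1 by rewrite -lead_coefM -ep (monicP mp).
move=> /(congr1 absz); rewrite abszM => /eqP; rewrite muln_eq1 => /andP[/eqP l1 _].
have : c * (lead_coef q1)%:~R = 1.
  have := monicP mq; rewrite eq lead_coefZ lead_coef_map_inj ?rmorph0 //.
  exact: intr_inj.
have -> : q`_i = c * (q1`_i)%:~R by rewrite eq coefZ coef_map.
have [e|e] : lead_coef q1 = 1 \/ lead_coef q1 = - 1.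
  by case: (lead_coef q1) l1 => [[|[|?]]|[|?]] //; [left|right].
  by rewrite e mulr1 => ->; rewrite mul1r intr_int.
by rewrite e mulrN1 => /(canRL (@opprK _)) ->; rewrite mulN1r rpredN intr_int.
Qed.

(* [al] and [be] behave like the cube roots of [a b^2] and [a^2 b]. *)
Definition pure_gens (K : fieldType) (a b : nat) (al be : K) : Prop :=
  [/\ al ^+ 2 = b%:R * be, be ^+ 2 = a%:R * al & al * be = (a * b)%:R].

Definition not_cube (n : nat) : Prop := forall t : rat, t ^+ 3 <> n%:R.

(** * Arithmetic in the span of 1, [al] and [be] *)

Section Pure.
Variables (K : fieldType) (f : {rmorphism rat -> K}) (a b : nat) (al be : K).
Hypotheses (a_gt0 : (0 < a)%N) (b_gt0 : (0 < b)%N).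
Hypothesis gens : pure_gens a b al be.
Hypothesis nc : not_cube (a * b ^ 2).
Implicit Types x y z r : rat.
Notation A := (a%:R : rat).
Notation B := (b%:R : rat).

Lemma B_neq0 : B != 0. Proof. by rewrite pnatr_eq0 -lt0n. Qed.

Definition pelt x y z : K := f x + f y * al + f z * be.

Lemma pelt_mul x1 y1 z1 x2 y2 z2 : pelt x1 y1 z1 * pelt x2 y2 z2
  = pelt (x1 * x2 + A * B * (y1 * z2 + z1 * y2))
      (x1 * y2 + y1 * x2 + A * (z1 * z2)) (x1 * z2 + z1 * x2 + B * (y1 * y2)).
Proof.
case: gens => e1 e2 e3; rewrite /pelt.
transitivity (f x1 * f x2 + f y1 * f y2 * al ^+ 2 + f z1 * f z2 * be ^+ 2
  + (f y1 * f z2 + f z1 * f y2) * (al * be) + (f x1 * f y2 + f y1 * f x2) * al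
  + (f x1 * f z2 + f z1 * f x2) * be); first by ring.
by rewrite e1 e2 e3 natrM; ring.
Qed.

Lemma pelt_add x1 y1 z1 x2 y2 z2 :
  pelt x1 y1 z1 + pelt x2 y2 z2 = pelt (x1 + x2) (y1 + y2) (z1 + z2).
Proof. by rewrite /pelt; ring. Qed.

Lemma pelt_sub x1 y1 z1 x2 y2 z2 :
  pelt x1 y1 z1 - pelt x2 y2 z2 = pelt (x1 - x2) (y1 - y2) (z1 - z2).
Proof. by rewrite /pelt; ring. Qed.

Lemma pelt_one : 1 = pelt 1 0 0. Proof. by rewrite /pelt; ring. Qed.

Lemma pelt_scale r x y z : f r * pelt x y z = pelt (r * x) (r * y) (r * z).
Proof. by rewrite /pelt; ring. Qed.

Lemma al_def : al = pelt 0 1 0. Proof. by rewrite /pelt; ring. Qed.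
Lemma be_def : be = pelt 0 0 1. Proof. by rewrite /pelt; ring. Qed.
Lemma pelt_scalar x : f x = pelt x 0 0. Proof. by rewrite /pelt; ring. Qed.

(** Otherwise [B y / z] would be a rational cube root of [a b^2]. *)
Lemma not_cube_ratio y z : B * y ^+ 3 = A * z ^+ 3 -> y = 0 /\ z = 0.
Proof.
move=> e; have [z0|z0] := eqVneq z 0.
  move: e; rewrite z0 expr0n /= mulr0 => /eqP.
  by rewrite mulf_eq0 (negPf B_neq0) expf_eq0 /= => /eqP.
case: (nc (t := B * (y / z))); rewrite natrM natrX.
transitivity (B ^+ 2 * (B * y ^+ 3) / z ^+ 3); first by field.
by rewrite e; field.
Qed.

Lemma pelt_eq0 x y z : pelt x y z = 0 -> [/\ x = 0, y = 0 & z = 0].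
Proof.
have ft r : f r = 0 -> r = 0 by move/eqP; rewrite fmorph_eq0 => /eqP.
have al_irr r1 r2 : f r1 + f r2 * al = 0 -> r1 = 0 /\ r2 = 0.
  move=> e; have r20 : r2 = 0.
    apply/eqP; apply: contra_notT (nc (t := - r1 / r2)) => r20.
    apply: (fmorph_inj f); rewrite rmorphXn fmorph_div rmorphN /=.
    have fr2 : f r2 != 0 by rewrite fmorph_eq0.
    have -> : - f r1 / f r2 = al.
      apply: (mulfI fr2); rewrite mulrCA divff // mulr1.
      by rewrite -[LHS](addKr (f r1)) addrN addr0 -[LHS]addr0 -e addKr.
    case: gens => e1 e2 e3; rewrite exprS e1 mulrCA e3 rmorph_nat natrM.
    by rewrite natrM natrX; ring.
  by split=> //; move: e; rewrite r20 rmorph0 mul0r addr0 => /ft.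
move=> e; have e' : pelt x y z * al = 0 by rewrite e mul0r.
(* This combination has no [be] component, so the independence of 1 and [al] applies. *)
have : f (B * y) * pelt x y z - f z * (pelt x y z * al) = 0.
  by rewrite e' e !mulr0 subr0.
rewrite {1}al_def pelt_mul pelt_scale.
rewrite [f z * _]pelt_scale /pelt => h.
have [] := @al_irr (B * y * x - A * B * z ^+ 2) (B * y ^+ 2 - z * x).
  by rewrite -[RHS]h; ring.
move=> h1 h2.
have [y0 z0] : y = 0 /\ z = 0.
  apply: not_cube_ratio; apply: (mulfI B_neq0).
  transitivity (B * y * (B * y ^+ 2 - z * x) + z * (B * y * x - A * B * z ^+ 2)
    + A * B * z ^+ 3); first by ring.
  by rewrite h1 h2; ring.
by split=> //; apply: ft; move: e; rewrite /pelt y0 z0 rmorph0 !mul0r !addr0.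
Qed.

(** Trace, second symmetric function and norm of [pelt x y z], see [pelt_charpoly]. *)
Definition ptr x : rat := 3 * x.
Definition pe2 x y z : rat := 3 * (x ^+ 2 - A * B * (y * z)).
Definition pnorm x y z : rat :=
  x ^+ 3 + A * B ^+ 2 * y ^+ 3 + A ^+ 2 * B * z ^+ 3 - 3 * (A * B) * (x * y * z).

Lemma pelt_charpoly x y z (g := pelt x y z) :
  g ^+ 3 - f (ptr x) * g ^+ 2 + f (pe2 x y z) * g - f (pnorm x y z) = 0.
Proof.
rewrite [g ^+ 3]exprS expr2 /g !pelt_mul !pelt_scale [f (pnorm _ _ _)]pelt_scalar.
rewrite /pelt /ptr /pe2 /pnorm; ring.
Qed.

Lemma pelt_free3 x y z (g := pelt x y z) r0 r1 r2 : (y != 0) || (z != 0) ->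
  f r0 + f r1 * g + f r2 * g ^+ 2 = 0 -> [/\ r0 = 0, r1 = 0 & r2 = 0].
Proof.
move=> yz; rewrite expr2 /g pelt_mul !pelt_scale pelt_scalar !pelt_add.
case/pelt_eq0; rewrite !add0r => h0 h1 h2.
have r20 : r2 = 0.
  apply/eqP; apply: contraTT yz => r2n; rewrite negb_or !negbK.
  suff [-> ->] : y = 0 /\ z = 0 by rewrite eqxx.
  apply: not_cube_ratio; apply: (mulfI r2n).
  (* Eliminating [r1] leaves [r2 (B y^3 - A z^3) = 0]: the determinant of the coordinates of
     [1, g, g^2] is the index form. *)
  transitivity (y * (r1 * z + r2 * (x * z + z * x + B * (y * y)))
    - z * (r1 * y + r2 * (x * y + y * x + A * (z * z))) + r2 * (A * z ^+ 3)); first by ring.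
  by rewrite h1 h2; ring.
move: h0 h1 h2; rewrite r20 !mul0r !addr0 => h0 h1 h2.
have r10 : r1 = 0.
  apply/eqP; apply: contraTT yz => r1n; rewrite negb_or !negbK.
  move/eqP: h1; move/eqP: h2; rewrite !mulf_eq0 (negPf r1n) /=.
  by move=> -> ->.
by split=> //; move: h0; rewrite r10 mul0r addr0.
Qed.

Lemma integral_scalar x : integralOver (intr : int -> K) (f x) -> x \is a Num.int.
Proof.
case=> p mp rp.
have rx : root (map_poly intr p) x.
  rewrite -(fmorph_root f) -map_poly_comp; move: rp; congr (root _ _).
  by apply: eq_map_poly => i /=; rewrite rmorph_int.
have := @monic_factor_int ('X - x%:P) p (monicXsubC _) mp.
rewrite dvdp_XsubCl => /(_ rx 0%N).
by rewrite coefB coefX coefC /= sub0r rpredN.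
Qed.

(** For irrational [g] the powers [1, g, g^2] are independent, so dividing an integral equation of
    [g] by its characteristic polynomial leaves no remainder, and Gauss's lemma applies. *)
Lemma charpoly_int x y z : integralOver (intr : int -> K) (pelt x y z) ->
  [/\ ptr x \is a Num.int, pe2 x y z \is a Num.int & pnorm x y z \is a Num.int].
Proof.
have int3 : (3 : rat) \is a Num.int by apply: rpred_nat.
have [yz|] := boolP ((y != 0) || (z != 0)); last first.
  rewrite negb_or !negbK => /andP[/eqP-> /eqP->]; rewrite -pelt_scalar.
  move=> /integral_scalar xi; have -> : pe2 x 0 0 = 3 * x ^+ 2 by rewrite /pe2; ring.
  have -> : pnorm x 0 0 = x ^+ 3 by rewrite /pnorm; ring.
  by split; rewrite ?rpredM ?rpredX.
case=> p mp rp; set g := pelt x y z in rp.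
pose l := [:: - pnorm x y z; pe2 x y z; - ptr x; 1]; pose q : {poly rat} := Poly l.
have ql : q = l :> seq rat by rewrite /q (@PolyK _ 0) //= oner_neq0.
have mq : q \is monic by rewrite monicE lead_coefE ql.
have hq : (map_poly f q).[g] = 0.
  rewrite horner_coef size_map_poly ql /= !big_ord_recl big_ord0 !coef_map /= ql /=.
  rewrite -[RHS](pelt_charpoly x y z) -/g !rmorphN rmorph1; ring.
have dq : q %| map_poly intr p.
  set pq := map_poly _ p; have hp : (map_poly f pq).[g] = 0.
    apply/eqP; rewrite -[_ == 0]/(root _ _) -map_poly_comp; move: rp; congr (root _ _).
    by apply: eq_map_poly => i /=; rewrite rmorph_int.
  rewrite /dvdp; set r := pq %% q.
  have hr : (map_poly f r).[g] = 0.
    have := divp_eq pq q; rewrite -/r => e.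
    have := congr1 (fun u => (map_poly f u).[g]) e.
    by rewrite hp rmorphD rmorphM /= hornerD hornerM hq mulr0 add0r.
  have sr : (size r <= 3)%N.
    by have := ltn_modpN0 pq (monic_neq0 mq); rewrite ql.
  move: hr; rewrite (@horner_coef_wide _ 3) ?size_map_poly //.
  rewrite !big_ord_recl big_ord0 !coef_map /= expr0 expr1 mulr1 addr0 addrA.
  case/(pelt_free3 yz) => r0 r1 r2; apply/eqP/polyP => i; rewrite coef0.
  by case: i => [|[|[|i]]] //; rewrite nth_default // (leq_trans sr).
have := monic_factor_int mq mp dq; rewrite ql => hi.
by split; [have := hi 2%N|exact: hi 1%N|have := hi 0%N]; rewrite /= ?rpredN.
Qed.

Lemma cube_integral (x : K) m : x ^+ 3 = m%:R -> integralOver (intr : int -> K) x.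
Proof.
move=> e; exists ('X^3 - (m%:Z)%:P); first by rewrite monicXnsubC.
by rewrite /root rmorphB /= map_polyXn map_polyC /= !hornerE e subrr.
Qed.

Lemma al_cube : al ^+ 3 = (a * b ^ 2)%:R.
Proof. by case: gens => e1 _ e3; rewrite exprS e1 mulrCA e3 -natrM; congr _%:R; lia. Qed.

Lemma be_cube : be ^+ 3 = (a ^ 2 * b)%:R.
Proof.
case: gens => _ e2 e3; rewrite exprS e2 mulrCA [be * _]mulrC e3 -natrM.
by congr _%:R; lia.
Qed.

Lemma integral_f (r : rat) : r \is a Num.int -> integralOver (intr : int -> K) (f r).
Proof. by case/intrP => m ->; rewrite rmorph_int; apply: integral_id. Qed.

Lemma integral_pelt x y z : x \is a Num.int -> y \is a Num.int ->
  z \is a Num.int -> integralOver (intr : int -> K) (pelt x y z).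
Proof.
move=> xi yi zi; have ai := cube_integral al_cube; have bi := cube_integral be_cube.
apply: integral_add; last by apply: integral_mul => //; apply: integral_f.
apply: integral_add; first exact: integral_f.
by apply: integral_mul => //; apply: integral_f.
Qed.

Lemma pelt_mul_al x y z : pelt x y z * al = pelt (A * B * z) x (B * y).
Proof. by rewrite al_def pelt_mul; congr pelt; ring. Qed.

Lemma pelt_mul_be x y z : pelt x y z * be = pelt (A * B * y) (A * z) x.
Proof. by rewrite be_def pelt_mul; congr pelt; ring. Qed.

(** The traces of [g], [g * be] and [g * al] make [3 x], [3 a b y] and [3 a b z] integers. Removing
    the trace from [3 g] leaves an integral element of norm [a b^2 (3 y)^3 + a^2 b (3 z)^3], whence
    [3 y] and [3 z] are integers by [cubes_int_l]. The congruences at 3 remove the last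
    denominator. *)
Lemma integral_coords x y z : squarefree (a * b) ->
    ~~ (9 %| a%:Z * b%:Z ^+ 2 - 1)%Z -> ~~ (9 %| a%:Z * b%:Z ^+ 2 + 1)%Z ->
    integralOver (intr : int -> K) (pelt x y z) ->
  [/\ x \is a Num.int, y \is a Num.int & z \is a Num.int].
Proof.
move=> sqf m1 m2 gi; have [x3 e2 e3] := charpoly_int gi.
have ai := cube_integral al_cube; have bi := cube_integral be_cube.
have [ny _ _] : [/\ ptr (A * B * y) \is a Num.int, pe2 (A * B * y) (A * z) x \is a Num.int
    & pnorm (A * B * y) (A * z) x \is a Num.int].
  by apply: charpoly_int; rewrite -pelt_mul_be; apply: integral_mul.
have [nz _ _] : [/\ ptr (A * B * z) \is a Num.int, pe2 (A * B * z) x (B * y) \is a Num.int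
    & pnorm (A * B * z) x (B * y) \is a Num.int].
  by apply: charpoly_int; rewrite -pelt_mul_al; apply: integral_mul.
have [_ _ cubes] : [/\ ptr 0 \is a Num.int, pe2 0 (3 * y) (3 * z) \is a Num.int
    & pnorm 0 (3 * y) (3 * z) \is a Num.int].
  apply: charpoly_int.
  have -> : pelt 0 (3 * y) (3 * z) = f 3 * pelt x y z - f (3 * x).
    by rewrite /pelt; ring.
  apply: integral_sub; last exact: integral_f x3.
  by apply: integral_mul => //; apply: integral_f; apply: rpred_nat.
have yi : 3 * y \is a Num.int.
  apply: (@cubes_int_l a b _ (3 * z) sqf) => //.
    by rewrite natrM; move: ny; rewrite /ptr mulrCA.
  by move: cubes; rewrite /pnorm; congr (_ \is a _); rewrite !natrM ?natrX; ring.
have zi : 3 * z \is a Num.int.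
  apply: (@cubes_int_l b a _ (3 * y)) => //; first by rewrite mulnC.
    by rewrite natrM; move: nz; rewrite /ptr mulrCA [B * A]mulrC.
  by move: cubes; rewrite /pnorm; congr (_ \is a _); rewrite !natrM ?natrX; ring.
move/intrP: x3 => [X eX]; move/intrP: yi => [Y eY]; move/intrP: zi => [Z eZ].
have xE : x = X%:~R / 3 by rewrite -eX /ptr; field.
have yE : y = Y%:~R / 3 by rewrite -eY; field.
have zE : z = Z%:~R / 3 by rewrite -eZ; field.
have dvd2 : (3 %| X ^+ 2 - a%:Z * b%:Z * (Y * Z))%Z.
  move/intrP: e2 => [k ek]; apply/dvdzP; exists k; apply/eqP.
  rewrite -(eqr_int rat) rmorphM /= -ek rmorphB !rmorphM ?rmorphXn /= /pe2 xE yE zE.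
  by apply/eqP; field.
have dvd3 : (27 %| X ^+ 3 + a%:Z * b%:Z ^+ 2 * Y ^+ 3 + a%:Z ^+ 2 * b%:Z * Z ^+ 3
       - 3 * (a%:Z * b%:Z) * (X * Y * Z))%Z.
  move/intrP: e3 => [k ek]; apply/dvdzP; exists k; apply/eqP.
  rewrite -(eqr_int rat) rmorphM /= -ek rmorphB !rmorphD !rmorphM ?rmorphXn /=.
  by rewrite /pnorm xE yE zE; apply/eqP; field.
have n9 : ~~ (9 %| a%:Z * b%:Z)%Z by rewrite -PoszM dvdzE; apply: (sqf 3%N).
(* If 3 divides [b] instead of [a], exchange [a] with [b] and [Y] with [Z]. *)
have [X3 Y3 Z3] : [/\ (3 %| X)%Z, (3 %| Y)%Z & (3 %| Z)%Z].
  have [/orP[a3|b3]|n3] : (3 %| a%:Z)%Z || (3 %| b%:Z)%Z \/ ~~ (3 %| a%:Z * b%:Z)%Z.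
  - by rewrite dvd3M; case: (_ || _); [left|right].
  - exact: three_ramified a3 n9 dvd2 dvd3.
  - have [] := @three_ramified b%:Z a%:Z X Z Y b3; last by move=> *; split.
    + by rewrite mulrC.
    + by rewrite [b%:Z * _]mulrC [Z * Y]mulrC.
    by move: dvd3; congr (_ %| _)%Z; ring.
  exact: three_unramified n3 m1 m2 dvd2 dvd3.
have third (T : int) : (3 %| T)%Z -> (T%:~R / 3 : rat) \is a Num.int.
  by move=> /dvdzP[k ->]; rewrite rmorphM /= mulfK // intr_int.
by rewrite xE yE zE !third.
Qed.

(* The integral element [(1 + u + u^2) / 3] with [u = e al], [u^3 = e a b^2 = 1]
   modulo 9. *)
Lemma integral_third (e : int) : e = 1 \/ e = -1 ->
    (9 %| a%:Z * b%:Z ^+ 2 - e)%Z ->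
  integralOver (intr : int -> K) (pelt (1 / 3) (e%:~R / 3) (B / 3)).
Proof.
move=> he /dvdzP[k ek].
pose g := pelt (1 / 3) (e%:~R / 3) (B / 3).
have ee : e * e = 1 by case: he => ->.
pose l : seq int := [:: - (3 * k ^+ 2); - 3 * (e * k); -1; 1].
have mE : A * B ^+ 2 = 9 * k%:~R + e%:~R.
  by move/eqP: ek; rewrite -(eqr_int rat) rmorphB !rmorphM ?rmorphXn /= subr_eq => /eqP ->; ring.
have eeq : e%:~R * e%:~R = 1 :> rat by rewrite -intrM ee.
have h : g ^+ 3 = g ^+ 2 + f (3 * (e%:~R * k%:~R)) * g + f (3 * k%:~R ^+ 2).
  have := pelt_charpoly (1 / 3) (e%:~R / 3) (B / 3); rewrite -/g.
  have -> : ptr (1 / 3) = 1 by rewrite /ptr; field.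
  have -> : pe2 (1 / 3) (e%:~R / 3) (B / 3) = - (3 * (e%:~R * k%:~R)).
    transitivity ((1 - e%:~R * (A * B ^+ 2)) / 3); first by rewrite /pe2; field.
    by rewrite mE mulrDr eeq; field.
  have -> : pnorm (1 / 3) (e%:~R / 3) (B / 3) = 3 * k%:~R ^+ 2.
    transitivity ((1 + (e%:~R * e%:~R) * e%:~R * (A * B ^+ 2) + (A * B ^+ 2) ^+ 2
      - 3 * e%:~R * (A * B ^+ 2)) / 27); first by rewrite /pnorm; field.
    rewrite eeq mul1r mE.
    transitivity ((1 - e%:~R * e%:~R + 81 * k%:~R ^+ 2) / 27 : rat); first by field.
    by rewrite eeq; field.
  by move=> E; rewrite -[LHS]subr0 -E; ring.
pose q : {poly int} := Poly l.
have ql : q = l :> seq int by rewrite /q (@PolyK _ 0).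
exists q; first by rewrite monicE lead_coefE ql.
rewrite /root (@horner_coef_wide _ 4); last by rewrite (leq_trans (size_poly _ _)) ?ql.
rewrite !big_ord_recl big_ord0 !coef_map /= ql /= -/g; apply/eqP.
rewrite /bump /= addr0 [g ^+ 3]h.
rewrite !rmorphN !rmorphM ?rmorphXn /= !rmorph_int; ring.
Qed.

End Pure.

(** * Traces and discriminants *)

Lemma det3 (R : comNzRingType) (F : nat -> nat -> R) :
  \det (\matrix_(i < 3, j < 3) F i j)
  = F 0 0 * (F 1 1 * F 2 2 - F 1 2 * F 2 1)
    - F 0 1 * (F 1 0 * F 2 2 - F 1 2 * F 2 0)
    + F 0 2 * (F 1 0 * F 2 1 - F 1 1 * F 2 0).
Proof.
rewrite (expand_det_row _ ord0) !big_ord_recl big_ord0 /cofactor.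
rewrite !(expand_det_row _ ord0) !big_ord_recl !big_ord0 /cofactor !det_mx11 !mxE /=.
by rewrite /bump /= !(expr0, expr1, exprS, mulr1, mul1r, addr0); ring.
Qed.

Section Trace.
Variable L : fieldExtType rat.
Implicit Types (x y : L).

Lemma field_traceD x y : field_trace (x + y) = field_trace x + field_trace y.
Proof.
by rewrite /field_trace -big_split; apply: eq_bigr => i _; rewrite mulrDl linearD.
Qed.

Lemma field_traceZ a x : field_trace (a *: x) = a * field_trace x.
Proof.
by rewrite /field_trace mulr_sumr; apply: eq_bigr => i _; rewrite -scalerAl linearZ.
Qed.

Lemma field_trace0 : field_trace (0 : L) = 0.
Proof. by rewrite -[0 in LHS](scale0r (0 : L)) field_traceZ mul0r. Qed.

Lemma field_trace_sum (I : finType) (F : I -> L) :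
  field_trace (\sum_i F i) = \sum_i field_trace (F i).
Proof. exact: (big_morph _ field_traceD field_trace0). Qed.

Lemma field_trace_basis n (e : n.-tuple L) x : basis_of fullv e ->
  field_trace x = \sum_(i < n) coord e i (x * e`_i).
Proof.
move=> be; rewrite /field_trace; set b := vbasis _.
have -> : \sum_(i < \dim {:L}) coord b i (x * b`_i)
    = \sum_(i < \dim {:L}) \sum_(j < n) coord e j b`_i * coord b i (x * e`_j).
  apply: eq_bigr => i _; rewrite {1}(coord_basis be (memvf b`_i)) mulr_sumr linear_sum.
  by apply: eq_bigr => j _; rewrite -scalerAr linearZ.
rewrite exchange_big; apply: eq_bigr => j _ /=.
rewrite [in RHS](coord_vbasis (memvf (x * e`_j))) linear_sum.
by apply: eq_bigr => i _; rewrite linearZ mulrC.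
Qed.

Definition gram n (w : n.-tuple L) : 'M[rat]_n :=
  \matrix_(i < n, j < n) field_trace (w`_i * w`_j).

Lemma gram_change n (w e : n.-tuple L) (C : 'M[rat]_n) :
  (forall i : 'I_n, w`_i = \sum_j C i j *: e`_j) -> gram w = C *m gram e *m C^T.
Proof.
move=> h; apply/matrixP => i k; rewrite !mxE !h mulr_suml field_trace_sum.
under eq_bigr => j _ do rewrite mulr_sumr field_trace_sum.
rewrite exchange_big; apply: eq_bigr => l _; rewrite !mxE mulr_suml.
by apply: eq_bigr => j _; rewrite !mxE -scalerAl -scalerAr !field_traceZ; ring.
Qed.

Lemma det_gram_change n (w e : n.-tuple L) (C : 'M[rat]_n) :
  (forall i : 'I_n, w`_i = \sum_j C i j *: e`_j) ->
  \det (gram w) = (\det C) ^+ 2 * \det (gram e).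
Proof. by move/gram_change->; rewrite !det_mulmx det_tr; ring. Qed.

Lemma int_matrix n (w e : n.-tuple L) : integral_basis w ->
    (forall i : 'I_n, algebraic_integer e`_i) ->
  exists C : 'M[int]_n, forall i : 'I_n, e`_i = \sum_j (map_mx intr C) i j *: w`_j.
Proof.
move=> [_ iw] ie; have /fin_all_exists[c hc] : forall i : 'I_n, exists c : 'I_n -> int,
    e`_i = \sum_(j < n) w`_j *~ c j by move=> i; apply/iw.
exists (\matrix_(i, j) c i j) => i; rewrite hc; apply: eq_bigr => j _.
by rewrite !mxE scaler_int.
Qed.

Lemma coord_mx_inv n (w e : n.-tuple L) (C : 'M[rat]_n) : basis_of fullv e ->
    (forall i : 'I_n, e`_i = \sum_j C i j *: w`_j) ->
  C *m (\matrix_(j < n, k < n) coord e k w`_j) = 1%:M.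
Proof.
move=> be h; apply/matrixP => i k; rewrite !mxE.
rewrite -(coord_free i k (basis_free be)) [in RHS]h linear_sum.
by apply: eq_bigr => j _; rewrite !mxE linearZ.
Qed.

(* An integral basis spans as soon as the algebraic integers do. *)
Lemma integral_basis_basis n m (w : n.-tuple L) (e : m.-tuple L) :
    integral_basis w -> basis_of fullv e -> (forall i : 'I_m, algebraic_integer e`_i) ->
  basis_of fullv w /\ n = m.
Proof.
move=> [fw iw] be ie; have sp : (<<w>> = fullv)%VS.
  apply/vspaceP => x; rewrite memvf (coord_basis be (memvf x)).
  apply: memv_suml => i _; rewrite memvZ //.
  have /iw[c ->] := ie i; apply: memv_suml => j _.
  by rewrite -scaler_int memvZ // memv_span // mem_nth // size_tuple.
have bw : basis_of fullv w by rewrite basisEfree fw sp subvf /= -sp dim_span.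
by split=> //; rewrite -(size_basis bw) (size_basis be).
Qed.

(** [det C] is, up to sign, the index of the lattice spanned by [e] in the ring of integers. *)
Lemma disc_compare (e : 3.-tuple L) d : basis_of fullv e ->
    (forall i : 'I_3, algebraic_integer e`_i) -> has_discriminant L d ->
  exists (w : 3.-tuple L) (C : 'M[int]_3), [/\ integral_basis w, basis_of fullv w,
    \det (gram e) = (\det C)%:~R ^+ 2 * d, \det C != 0
    & forall i : 'I_3, e`_i = \sum_j (map_mx intr C) i j *: w`_j].
Proof.
move=> be ie [n [w [iw dw]]]; have [bw en] := integral_basis_basis iw be ie.
move: w iw dw bw; rewrite en => w iw dw bw.
have [C hC] := int_matrix iw ie; exists w, C; split=> //; last first.
  have /(congr1 (fun X => \det X)) := coord_mx_inv be hC.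
  rewrite det_mulmx det1 det_map_mx; apply: contra_eq_neq => ->.
  by rewrite mul0r eq_sym oner_neq0.
by rewrite (det_gram_change hC) det_map_mx -dw.
Qed.

Lemma coord3 (e : 3.-tuple L) c0 c1 c2 (i : 'I_3) : free e ->
  coord e i (c0 *: e`_0 + c1 *: e`_1 + c2 *: e`_2) = [:: c0; c1; c2]`_i.
Proof.
move=> fe; rewrite -(coord_sum_free (fun j : 'I_3 => [:: c0; c1; c2]`_j) i fe).
by rewrite !big_ord_recl big_ord0 /= addr0 addrA.
Qed.

Lemma basis3 (e : 3.-tuple L) :
    (forall c0 c1 c2, c0 *: e`_0 + c1 *: e`_1 + c2 *: e`_2 = 0 ->
       [/\ c0 = 0, c1 = 0 & c2 = 0]) ->
    (forall x, exists c0 c1 c2, x = c0 *: e`_0 + c1 *: e`_1 + c2 *: e`_2) ->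
  basis_of fullv e.
Proof.
move=> fr sp; have fe : free e.
  apply/freeP => k; rewrite !big_ord_recl big_ord0 addr0 addrA => /fr[k0 k1 k2].
  case=> [[|[|[|i]]] hi] //.
  - by rewrite -k0; congr k; apply: val_inj.
  - by rewrite -k1; congr k; apply: val_inj.
  by rewrite -k2; congr k; apply: val_inj.
have se : (<<e>> = fullv)%VS.
  apply/vspaceP => x; rewrite memvf; have [c0 [c1 [c2 ->]]] := sp x.
  by rewrite !memvD // memvZ // memv_span // mem_nth // size_tuple.
by rewrite basisEfree fe se subvf /= -se dim_span.
Qed.

End Trace.

(** * Cubic fields of discriminant -3 times a square *)

Section Cardano.
Variables (K : fieldType) (f : {rmorphism rat -> K}) (t : K) (P Q : rat).
Hypothesis t3 : t ^+ 3 = f P * t + f Q.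

Definition celt (u0 u1 u2 : rat) : K := f u0 + f u1 * t + f u2 * t ^+ 2.

Lemma celt_quadratic r : celt (r ^+ 2) r 1 = t ^+ 2 + f r * t + f r ^+ 2.
Proof. by rewrite /celt; ring. Qed.

Lemma celt_zero : 0 = celt 0 0 0. Proof. by rewrite /celt; ring. Qed.

Lemma celt_scalar r : f r = celt r 0 0. Proof. by rewrite /celt; ring. Qed.

Lemma celt_one : 1 = celt 1 0 0. Proof. by rewrite /celt; ring. Qed.

Lemma celt_gen : t = celt 0 1 0. Proof. by rewrite /celt; ring. Qed.

Lemma celt_sqr : t ^+ 2 = celt 0 0 1. Proof. by rewrite /celt; ring. Qed.

Lemma celt_mul u0 u1 u2 v0 v1 v2 : celt u0 u1 u2 * celt v0 v1 v2
  = celt (u0 * v0 + Q * (u1 * v2 + u2 * v1))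
      (u0 * v1 + u1 * v0 + P * (u1 * v2 + u2 * v1) + Q * (u2 * v2))
      (u0 * v2 + u1 * v1 + u2 * v0 + P * (u2 * v2)).
Proof.
rewrite /celt; transitivity (f u0 * f v0 + (f u0 * f v1 + f u1 * f v0) * t
  + (f u0 * f v2 + f u1 * f v1 + f u2 * f v0) * t ^+ 2
  + (f u1 * f v2 + f u2 * f v1) * t ^+ 3 + f u2 * f v2 * (t * t ^+ 3)); first by ring.
by rewrite t3; ring.
Qed.

(* With [t = u + c / u], [u^3] and [(c / u)^3] are the roots [A] and [B] of
   [X^2 - Q X + c^3]; the element below is [u]. *)
Lemma cardano (k : rat) : 4 * P ^+ 3 - 27 * Q ^+ 2 = - 3 * k ^+ 2 ->
  k != 0 -> P != 0 ->
  exists A u0 u1 u2 : rat, [/\ A != 0, u1 != 0 & celt u0 u1 u2 ^+ 3 = f A].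
Proof.
move=> hk k0 P0; pose A := Q / 2 + k / 6; pose B := Q / 2 - k / 6; pose c := P / 3.
have AB : A * B = c ^+ 3.
  transitivity ((Q ^+ 2 * 9 - k ^+ 2) / 36); first by rewrite /A /B; field.
  transitivity ((4 * P ^+ 3 - (4 * P ^+ 3 - 27 * Q ^+ 2) - 3 * k ^+ 2) / 108); first by field.
  by rewrite hk /c; field.
have c0 : c != 0 by rewrite mulf_neq0.
have A0 : A != 0 by apply: contraNneq c0 => A0; move/esym/eqP: AB; rewrite A0 mul0r expf_eq0.
have d0 : A - B != 0.
  have -> : A - B = k / 3 by rewrite /A /B; field.
  by rewrite mulf_neq0.
pose d := A - B.
have QE : Q = A + B by rewrite /A /B; field.
have PE : P = 3 * c by rewrite /c; field.
exists A, (2 * c ^+ 2 / d), (A / d), (- c / d); split=> //.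
  by rewrite mulf_neq0 ?invr_eq0.
have BE : B = c ^+ 3 / A by rewrite -AB; field.
have d0'' : A * A - c ^+ 3 != 0 by rewrite -AB -mulrBr mulf_neq0.
rewrite [celt _ _ _ ^+ 3]exprS [celt _ _ _ ^+ 2]expr2 !celt_mul.
rewrite -[f A](_ : celt A 0 0 = _); last by rewrite /celt; ring.
have ceq u0 u1 u2 v0 v1 v2 : u0 = v0 -> u1 = v1 -> u2 = v2 ->
    celt u0 u1 u2 = celt v0 v1 v2 by move=> -> -> ->.
by apply: ceq; rewrite /d QE PE BE; field; rewrite A0 d0''.
Qed.

End Cardano.

Lemma depress (K : fieldType) (f : {rmorphism rat -> K}) (t : K) r0 r1 r2 :
    t ^+ 3 = f r0 + f r1 * t + f r2 * t ^+ 2 ->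
  exists (d c : rat) (P Q : int), d != 0 /\
    (f d * t - f c) ^+ 3 = f P%:~R * (f d * t - f c) + f Q%:~R.
Proof.
have [c ->] : exists c, r2 = 3 * c by exists (r2 / 3); field.
move=> e.
pose P := r1 + 3 * c ^+ 2; pose Q := r0 + r1 * c + 2 * c ^+ 3.
(* The shift by [c] removes the quadratic term; scaling by [d] multiplies [P] by [d^2] and [Q] by
   [d^3], which clears both denominators. *)
pose d : rat := (denq P * denq Q)%:~R.
exists d, (d * c), (denq P * denq Q ^+ 2 * numq P), (denq P ^+ 3 * denq Q ^+ 2 * numq Q).
split; first by rewrite intr_eq0 mulf_neq0 ?denq_neq0.
have -> : (denq P * denq Q ^+ 2 * numq P)%:~R = d ^+ 2 * P.
  by rewrite /d !intrM numqE; ring.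
have -> : (denq P ^+ 3 * denq Q ^+ 2 * numq Q)%:~R = d ^+ 3 * Q.
  by rewrite /d !intrM numqE; ring.
transitivity (f d ^+ 3 * (t ^+ 3 - 3 * f c * t ^+ 2 + 3 * f c ^+ 2 * t - f c ^+ 3)); first by ring.
by rewrite e /P /Q; ring.
Qed.

Lemma integral_depressed (K : fieldType) (f : {rmorphism rat -> K}) (t : K) (P Q : int) :
  t ^+ 3 = f P%:~R * t + f Q%:~R -> integralOver (intr : int -> K) t.
Proof.
move=> t3; pose l : seq int := [:: - Q; - P; 0; 1].
pose q : {poly int} := Poly l.
have ql : q = l :> seq int by rewrite /q (@PolyK _ 0).
exists q; first by rewrite monicE lead_coefE ql.
rewrite /root (@horner_coef_wide _ 4); last by rewrite (leq_trans (size_poly _ _)) ?ql.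
rewrite !big_ord_recl big_ord0 !coef_map /= ql /= /bump /= addr0 [t ^+ 3]t3.
by rewrite !rmorph_int; apply/eqP; ring.
Qed.

Lemma sub_cube (R : comNzRingType) (x y : R) :
  x ^+ 3 - y ^+ 3 = (x - y) * (x ^+ 2 + y * x + y ^+ 2).
Proof. by ring. Qed.

Lemma pure_gens_sqr (K : fieldType) (a b : nat) (al : K) : b%:R != 0 :> K ->
  al ^+ 3 = (a * b ^ 2)%:R -> pure_gens a b al (al ^+ 2 / b%:R).
Proof.
move=> b0 al3; split; first by rewrite mulrC divfK.
  apply: (mulIf (expf_neq0 2 b0)); rewrite expr_div_n divfK ?expf_neq0 //.
  transitivity (al ^+ 3 * al); first by ring.
  by rewrite al3 natrM natrX; ring.
by rewrite mulrA -exprS al3 expnS expn1 !natrM mulrA mulfK.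
Qed.

(** Primes are multiplied in one at a time: a new prime goes into [a], at its second occurrence it
    moves from [a] to [b], at its third from [b] to [t]. *)
Lemma cubefree_nat n : (0 < n)%N -> exists a b t : nat,
  [/\ (0 < a)%N, (0 < b)%N, (0 < t)%N, squarefree (a * b) & n = (a * b ^ 2 * t ^ 3)%N].
Proof.
elim/ltn_ind: n => n IHn n0; have [n1|n_gt1] := leqP n 1.
  exists 1%N, 1%N, 1%N; split=> //; last by lia.
  by move=> q /prime_gt1 q1; rewrite dvdn1; apply/eqP => e; nia.
have pr := pdiv_prime n_gt1; set p := pdiv n in pr.
have /dvdnP[m en] : (p %| n)%N := pdiv_dvd n.
have p1 := prime_gt1 pr.
have m0 : (0 < m)%N by lia.
have [a [b [t [a0 b0 t0 sqf em]]]] := IHn m ltac:(nia) m0.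
have [pa|pa] := boolP (p %| a)%N.
  have /dvdnP[a' ea] := pa; exists a', (b * p)%N, t; split; [nia|nia|nia| |].
    by move=> q /sqf; rewrite ea -mulnA [(p * b)%N]mulnC.
  by rewrite en em ea !expnS !expn0; lia.
have [pb|pb] := boolP (p %| b)%N.
  have /dvdnP[b' eb] := pb; exists a, b', (t * p)%N; split; [nia|nia|nia| |].
    move=> q /sqf; apply: contraNN => h; apply: (dvdn_trans h).
    by rewrite eb mulnA dvdn_mulr.
  by rewrite en em eb !expnS !expn0; lia.
exists (a * p)%N, b, t; split; [nia|nia|nia| |by rewrite en em; lia].
move=> q prq; have [->|qp] := eqVneq q p.
  have -> : (a * p * b = p * (a * b))%N by lia.
  by rewrite expnS expn1 dvdn_pmul2l ?prime_gt0 // Euclid_dvdM // negb_or pa.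
have -> : (a * p * b = p * (a * b))%N by lia.
rewrite Gauss_dvdr ?sqf // coprime_sym coprimeXr // prime_coprime // dvdn_prime2 //.
by rewrite eq_sym.
Qed.

Lemma cubefree_rat (A : rat) : A != 0 -> exists (a b : nat) (t : rat),
  [/\ (0 < a)%N, (0 < b)%N, squarefree (a * b), t != 0 & A = (a * b ^ 2)%:R * t ^+ 3].
Proof.
(* [A] is numerator times squared denominator over the cube of the denominator; the sign joins the
   cube. *)
move=> A0; have [|a [b [t [a0 b0 t0 sqf e]]]] := @cubefree_nat (`|numq A| * `|denq A| ^ 2)%N.
  by rewrite muln_gt0 expn_gt0 !absz_gt0 numq_eq0 A0 denq_neq0.
have dn : (denq A)%:~R != 0 :> rat by rewrite intr_eq0 denq_neq0.
exists a, b, ((-1) ^+ (numq A < 0)%R * t%:R / (denq A)%:~R); split=> //.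
  by rewrite !mulf_neq0 ?signr_eq0 ?invr_eq0 // pnatr_eq0 -lt0n.
rewrite !exprMn exprVn -natrX.
have -> : ((-1) ^+ (numq A < 0)%R) ^+ 3 = (-1) ^+ (numq A < 0)%R :> rat.
  by case: (_ < _).
have -> : (a * b ^ 2)%:R * ((-1) ^+ (numq A < 0)%R * (t ^ 3)%:R / (denq A)%:~R ^+ 3)
   = (-1) ^+ (numq A < 0)%R * (`|numq A| * `|denq A| ^ 2)%N%:R / (denq A)%:~R ^+ 3 :> rat.
  by rewrite e !natrM; ring.
rewrite natrM natrX -[_%:R ^+ 2]/((`|denq A|%N%:Z)%:~R ^+ 2) absz_denq.
rewrite -[(absz (numq A))%:R]/((`|numq A|%N%:Z)%:~R) -{1}[A]divq_num_den.
rewrite {1}[numq A]intEsign intrM rmorph_sign; field.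
exact: dn.
Qed.

Section CubicField.
Variable L : fieldExtType rat.
Hypothesis dimL : \dim {:L} = 3%N.
Notation f := (in_alg L : {rmorphism rat -> L}).
Implicit Types (x t : L) (r : rat).

Lemma in_algM r x : f r * x = r *: x.
Proof. by rewrite /= mulr_algl. Qed.

Lemma mem1_rat x : reflect (exists r, x = f r) (x \in 1%VS).
Proof. exact: vlineP. Qed.

Lemma cubic_basis t : t \notin 1%VS -> basis_of fullv [tuple 1; t; t ^+ 2].
Proof.
move=> t1; have dvd3 : (adjoin_degree 1 t %| 3)%N.
  have := @field_dimS _ L <<1; t>>%AS {:L}%AS (subvf _).
  by rewrite /= dim_Fadjoin dimv1 muln1 dimL.
have deg3 : adjoin_degree 1 t = 3%N.
  apply/eqP; move: dvd3; rewrite dvdn_divisors // => /=.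
  rewrite !inE => /orP[/eqP d1|//].
  by have := adjoin_deg_eq1 1 t; rewrite d1 eqxx (negPf t1).
have full : (<<1; t>> = fullv)%VS.
  by apply/eqP; rewrite eqEdim subvf /= dim_Fadjoin deg3 dimv1 dimL.
rewrite basisEdim /= dimL leqnn andbT; apply/subvP => x _.
have tx : x \in <<1; t>>%VS by rewrite full memvf.
rewrite -(Fadjoin_poly_eq tx) (@horner_coef_wide _ 3); last first.
  by rewrite -deg3 size_Fadjoin_poly.
apply: memv_suml => i _; have /mem1_rat[r ->] : (Fadjoin_poly 1 t x)`_i \in 1%VS.
  by apply/polyOverP; apply: Fadjoin_polyOver.
rewrite in_algM memvZ // memv_span //.
by case: i => [[|[|[|i]]] hi] //=; rewrite !inE ?expr0 ?expr1 eqxx ?orbT.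
Qed.

Lemma celtE t r0 r1 r2 : celt f t r0 r1 r2 = r0 *: 1 + r1 *: t + r2 *: t ^+ 2.
Proof. by rewrite /celt !in_algM. Qed.

Lemma cubic_coords t x : t \notin 1%VS -> exists r0 r1 r2, x = celt f t r0 r1 r2.
Proof.
move=> t1; have be := cubic_basis t1; set e := [tuple _; _; _] in be.
exists (coord e 0 x), (coord e 1 x), (coord e 2%:R x).
rewrite {1}(coord_basis be (memvf x)) !big_ord_recl big_ord0 addr0 addrA celtE.
by congr (_ *: _ + _ *: _ + _ *: _); congr (coord e _ x); apply: val_inj.
Qed.

Lemma coord_celt t r0 r1 r2 i : t \notin 1%VS ->
  coord [tuple 1; t; t ^+ 2] i (celt f t r0 r1 r2) = [:: r0; r1; r2]`_i.
Proof. by move=> t1; rewrite celtE -(coord3 _ _ _ i (basis_free (cubic_basis t1))). Qed.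

Lemma celt_inj t r0 r1 r2 r0' r1' r2' : t \notin 1%VS ->
  celt f t r0 r1 r2 = celt f t r0' r1' r2' -> [/\ r0 = r0', r1 = r1' & r2 = r2'].
Proof.
move=> t1 e; have c i := congr1 (coord [tuple 1; t; t ^+ 2] i) e.
by split; [have := c 0|have := c 1|have := c 2%:R]; rewrite !coord_celt.
Qed.

Section Depressed.
Variables (t : L) (P Q : rat).
Hypothesis t_irr : t \notin 1%VS.
Hypothesis t3 : t ^+ 3 = f P * t + f Q.
Let e := [tuple 1; t; t ^+ 2].

Lemma trace_celt r0 r1 r2 :
  field_trace (celt f t r0 r1 r2) = 3 * r0 + 2 * P * r2.
Proof.
rewrite (field_trace_basis _ (cubic_basis t_irr)) !big_ord_recl big_ord0.
have -> : [tuple 1; t; t ^+ 2]`_(@ord0 2) = celt f t 1 0 0 by rewrite -celt_one.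
have -> : [tuple 1; t; t ^+ 2]`_(lift ord0 (@ord0 1)) = celt f t 0 1 0 by rewrite -celt_gen.
have -> : [tuple 1; t; t ^+ 2]`_(lift ord0 (lift ord0 (@ord0 0))) = celt f t 0 0 1.
  by rewrite -celt_sqr.
by rewrite !(celt_mul t3) !coord_celt //=; ring.
Qed.

Lemma det_gram_depressed : \det (gram e) = 4 * P ^+ 3 - 27 * Q ^+ 2.
Proof.
pose F (i j : nat) : rat :=
  nth 0 (nth [::] [:: [:: 3; 0; 2 * P]; [:: 0; 2 * P; 3 * Q]; [:: 2 * P; 3 * Q; 2 * P ^+ 2]] i) j.
have -> : gram e = \matrix_(i < 3, j < 3) F i j.
  apply/matrixP => i j; rewrite !mxE.
  have ek k : (k < 3)%N -> e`_k = celt f t (k == 0)%:R (k == 1)%:R (k == 2)%:R.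
    by case: k => [|[|[|k]]] // _; rewrite -?celt_one -?celt_gen -?celt_sqr.
  rewrite !ek // (celt_mul t3) trace_celt /F.
  by case: i j => [[|[|[|i]]] hi] [[|[|[|j]]] hj] //=; ring.
by rewrite det3 /F /=; ring.
Qed.

End Depressed.

Lemma scalar_in1 r : f r \in 1%VS.
Proof. by apply/mem1_rat; exists r. Qed.

Lemma in1_shift t d c : d != 0 -> f d * t - f c \in 1%VS -> t \in 1%VS.
Proof.
move=> d0 /mem1_rat[r er]; have fd : f d != 0 by rewrite fmorph_eq0.
have -> : t = f ((r + c) / d).
  by apply: (mulfI fd); rewrite -rmorphM [d * _]mulrC divfK // rmorphD -er subrK.
exact: scalar_in1.
Qed.

(* The quadratic resolvent of the cubic of a generator is [Q(sqrt(-3))], so by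
   Cardano's formulas the cube root of a rational number generates [L]. *)
Lemma cubic_pure N D : (0 < N)%N -> D = N%:R ^+ 2 * - 27 -> has_discriminant L D ->
  exists (a b : nat) (al be : L), [/\ (0 < a)%N && (0 < b)%N, squarefree (a * b),
     pure_gens a b al be, not_cube (a * b ^ 2) & al \notin 1%VS].
Proof.
move=> N0 D_eq [n [w [iw dw]]].
have Dneq : D != 0 by rewrite D_eq mulf_neq0 ?sqrf_eq0 ?pnatr_eq0 -?lt0n ?oppr_eq0.
have [t0 t01] : exists t0 : L, t0 \notin 1%VS.
  have : ~~ (fullv <= (1 : {vspace L}))%VS.
    by apply/negP => /dimvS; rewrite dimL dimv1.
  by case/subvPn => t0 _ t01; exists t0.
have [r0 [r1 [r2 e0]]] := cubic_coords (t0 ^+ 3) t01.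
have [d [c [P [Q [dn t3]]]]] := depress e0.
set t := f d * t0 - f c in t3.
have t1 : t \notin 1%VS by apply: contraNN t01; apply: in1_shift.
have ti : algebraic_integer t := integral_depressed t3.
have be := cubic_basis t1.
have ie (i : 'I_3) : algebraic_integer [tuple 1; t; t ^+ 2]`_i.
  case: i => [[|[|[|i]]] hi] //=; first exact: integral1.
  by rewrite expr2; apply: integral_mul.
have hD : has_discriminant L D by exists n, w.
have [w' [C [iw' bw' dC C0 _]]] := disc_compare be ie hD.
rewrite (det_gram_depressed t1 t3) in dC.
have [A [al [A0 al1 al3]]] : exists (A : rat) (al : L),
    [/\ A != 0, al \notin 1%VS & al ^+ 3 = f A].
  have [P0|P0] := eqVneq (P%:~R : rat) 0.
    exists Q%:~R, t; split=> //; last by rewrite t3 P0 rmorph0 mul0r add0r.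
    apply: contraNneq t1 => Q0; move/eqP: t3.
    rewrite P0 Q0 rmorph0 mul0r addr0 expf_eq0 /= => /eqP ->.
    exact: mem0v.
  (* The discriminant of the depressed cubic is [(det C)^2 D], that is -3 times the square of this
     number. *)
  have k0 : 3 * N%:R * (\det C)%:~R != 0 :> rat.
    by rewrite !mulf_neq0 ?intr_eq0 // pnatr_eq0 -lt0n.
  have hk : 4 * P%:~R ^+ 3 - 27 * Q%:~R ^+ 2 = - 3 * (3 * N%:R * (\det C)%:~R) ^+ 2 :> rat.
    by rewrite dC D_eq; ring.
  have [A [u0 [u1 [u2 [A0 u10 h]]]]] := cardano t3 hk k0 P0.
  exists A, (celt f t u0 u1 u2); split=> //.
  apply: contraNN u10 => /mem1_rat[r er].
  have e1 : celt f t u0 u1 u2 = celt f t r 0 0 by rewrite er (celt_scalar _ t).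
  by have [_ ->] := celt_inj t1 e1.
have [a [b [s [a0 b0 sqf s0 As]]]] := cubefree_rat A0.
have fs : f s != 0 by rewrite fmorph_eq0.
pose al' := al / f s.
have al'1 : al' \notin 1%VS.
  apply: contraNN al1 => /mem1_rat[r er]; apply/mem1_rat; exists (r * s).
  by rewrite rmorphM -er divfK.
have al'3 : al' ^+ 3 = (a * b ^ 2)%:R.
  by rewrite expr_div_n al3 As rmorphM rmorphXn mulfK ?expf_neq0 // rmorph_nat.
have bL : b%:R != 0 :> L by rewrite -(rmorph_nat f) fmorph_eq0 pnatr_eq0 -lt0n.
exists a, b, al', (al' ^+ 2 / b%:R); split=> //; first by rewrite a0 b0.
  exact: pure_gens_sqr.
(* A rational cube root [r] of [a b^2] would make [al'] equal to [r] or a root of a rational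
   quadratic, against the independence of [1, al', al'^2]. *)
move=> r er.
have hq : (al' - f r) * (al' ^+ 2 + f r * al' + f r ^+ 2) = 0.
  by rewrite -sub_cube -rmorphXn er al'3 rmorph_nat subrr.
move/eqP: hq; rewrite mulf_eq0 subr_eq0 => /orP[/eqP e|/eqP e].
  by rewrite e scalar_in1 in al'1.
have e1 : celt f al' (r ^+ 2) r 1 = celt f al' 0 0 0.
  by rewrite celt_quadratic -celt_zero.
have [_ _ /eqP] := celt_inj al'1 e1.
by rewrite oner_eq0.
Qed.

End CubicField.

(** * Index forms of pure cubic fields *)

(** The base changes in both directions are integral and mutually inverse. *)
Lemma int_bases_det (L : fieldExtType rat) n (w e : n.-tuple L) :
    integral_basis w -> integral_basis e -> basis_of fullv w -> basis_of fullv e ->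
  (\det (\matrix_(k < n, j < n) coord w j e`_k)) ^+ 2 = 1.
Proof.
move=> iw ie bw be.
have mem_int m (u : m.-tuple L) : integral_basis u -> forall i : 'I_m, algebraic_integer u`_i.
  move=> [_ iu] i; apply/iu; exists (fun j => (j == i)%:Z).
  rewrite (bigD1 i) //= eqxx big1 ?addr0 // => j /negPf ->.
  by rewrite mulr0z.
have key (u v : n.-tuple L) : integral_basis u -> integral_basis v -> basis_of fullv u ->
    exists C : 'M[int]_n, \matrix_(k < n, j < n) coord u j v`_k = map_mx intr C.
  move=> iu iv bu; have [C hC] := int_matrix iu (mem_int _ _ iv); exists C.
  apply/matrixP => i j; rewrite !mxE hC (coord_sum_free _ _ (basis_free bu)).
  by rewrite mxE.
have [C eC] := key w e iw ie bw; have [C' eC'] := key e w ie iw be.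
have := @coord_mx_inv L n w e (\matrix_(k < n, j < n) coord w j e`_k) be.
rewrite eC' => /(_ _)/(congr1 (fun X => \det X)) h.
have {h} : \det (map_mx intr C *m map_mx intr C' : 'M[rat]_n) = 1.
  rewrite -eC h ?det1 // => i.
  rewrite {1}(coord_basis bw (memvf e`_i)); apply: eq_bigr => j _.
  by rewrite mxE.
rewrite eC det_mulmx !det_map_mx -intrM => /eqP.
rewrite -[1]/(1%:~R : rat) eqr_int => /eqP /(congr1 absz).
rewrite abszM => /eqP; rewrite muln_eq1 => /andP[/eqP d1 _].
rewrite -rmorphXn /=; case: (\det C) d1 => [[|[|?]]|[|?]] // _.
Qed.

Section PureField.
Variables (L : fieldExtType rat) (a b : nat) (al be : L).
Notation f := (in_alg L : {rmorphism rat -> L}).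
Hypotheses (a_gt0 : (0 < a)%N) (b_gt0 : (0 < b)%N).
Hypothesis gens : pure_gens a b al be.
Hypothesis nc : not_cube (a * b ^ 2).
Hypothesis span : forall x, exists x0 y0 z0, x = pelt f al be x0 y0 z0.
Notation pe := (pelt f al be).
Notation A := (a%:R : rat).
Notation B := (b%:R : rat).
Let e : 3.-tuple L := [tuple 1; al; be].

Lemma peltE x y z : pe x y z = x *: e`_0 + y *: e`_1 + z *: e`_2.
Proof. by rewrite /pelt !in_algM -[f x]mulr1 in_algM. Qed.

Lemma pure_basis : basis_of fullv e.
Proof.
apply: basis3 => [c0 c1 c2|x].
  by rewrite -peltE => /(pelt_eq0 b_gt0 gens nc).
by have [x0 [y0 [z0 ->]]] := span x; exists x0, y0, z0; rewrite peltE.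
Qed.

Lemma dim_pure : \dim {:L} = 3%N.
Proof. by rewrite (size_basis pure_basis). Qed.

Lemma coord_pelt x y z i : coord e i (pe x y z) = [:: x; y; z]`_i.
Proof. by rewrite peltE coord3 // (basis_free pure_basis). Qed.

Lemma basis_pelt k : (k < 3)%N -> e`_k = pe (k == 0)%:R (k == 1)%:R (k == 2)%:R.
Proof. by case: k => [|[|[|k]]] // _; rewrite peltE !(scale0r, scale1r, addr0, add0r). Qed.

Lemma trace_pelt x y z : field_trace (pe x y z) = 3 * x.
Proof.
rewrite (field_trace_basis _ pure_basis) !big_ord_recl big_ord0.
by rewrite !basis_pelt // !(pelt_mul _ gens) !coord_pelt /=; ring.
Qed.

Lemma det_gram_pure : \det (gram e) = - 27 * (A * B) ^+ 2.
Proof.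
pose F (i j : nat) : rat :=
  nth 0 (nth [::] [:: [:: 3; 0; 0]; [:: 0; 0; 3 * (A * B)]; [:: 0; 3 * (A * B); 0]] i) j.
have -> : gram e = \matrix_(i < 3, j < 3) F i j.
  apply/matrixP => i j; rewrite !mxE !basis_pelt // (pelt_mul _ gens) trace_pelt /F.
  by case: i j => [[|[|[|i]]] hi] [[|[|[|j]]] hj] //=; ring.
by rewrite det3 /F /=; ring.
Qed.

Lemma integral_e (i : 'I_3) : algebraic_integer e`_i.
Proof.
case: i => [[|[|[|i]]] hi] //=; first exact: integral1.
  exact: cube_integral (al_cube a_gt0 b_gt0 gens).
exact: cube_integral (be_cube a_gt0 b_gt0 gens).
Qed.

Lemma index_pure (w : 3.-tuple L) x y z : basis_of fullv w ->
  \det (\matrix_(i < 3, j < 3) coord w j ((pe x y z) ^+ i))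
  = (B * y ^+ 3 - A * z ^+ 3) * \det (\matrix_(k < 3, j < 3) coord w j e`_k).
Proof.
move=> bw; pose F (i j : nat) : rat :=
  nth 0 (nth [::] [:: [:: 1; 0; 0]; [:: x; y; z];
    [:: x ^+ 2 + 2 * (A * B) * (y * z); 2 * (x * y) + A * z ^+ 2; 2 * (x * z) + B * y ^+ 2]] i) j.
have -> : \matrix_(i < 3, j < 3) coord w j ((pe x y z) ^+ i)
   = (\matrix_(i < 3, k < 3) F i k) *m (\matrix_(k < 3, j < 3) coord w j e`_k).
  apply/matrixP => i j; rewrite !mxE.
  have -> : (pe x y z) ^+ i = \sum_(k < 3) F i k *: e`_k.
    rewrite !big_ord_recl big_ord0 addr0 addrA.
    case: i => [[|[|[|i]]] hi] //.
    - by rewrite expr0 /= !scale0r scale1r !addr0.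
    - by rewrite expr1 /= -peltE.
    rewrite expr2 (pelt_mul _ gens) /= -[RHS]peltE.
    by rewrite /F /=; congr pelt; ring.
  rewrite linear_sum; apply: eq_bigr => k _; rewrite !mxE linearZ //.
rewrite det_mulmx det3 /F /=; congr (_ * _); ring.
Qed.

Hypothesis sqf : squarefree (a * b).

Section NotWild.
Hypotheses (m1 : ~~ (9 %| a%:Z * b%:Z ^+ 2 - 1)%Z) (m2 : ~~ (9 %| a%:Z * b%:Z ^+ 2 + 1)%Z).

Lemma integral_basis_pure : integral_basis e.
Proof.
split=> [|x]; first exact: basis_free pure_basis.
have [x0 [y0 [z0 ->]]] := span x; split.
  move/(integral_coords a_gt0 b_gt0 gens nc sqf m1 m2) => [].
  move=> /intrP[X ->] /intrP[Y ->] /intrP[Z ->].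
  exists (fun i : 'I_3 => [:: X; Y; Z]`_i).
  by rewrite !big_ord_recl big_ord0 addr0 addrA peltE !scaler_int.
case=> c; rewrite !big_ord_recl big_ord0 addr0 addrA -!scaler_int => ->.
rewrite -peltE; apply: (integral_pelt f a_gt0 b_gt0 gens); exact: intr_int.
Qed.

Lemma pure_quasi_monogenic_cubic D y z :
    D = - 27 * (A * B) ^+ 2 -> B * y ^+ 3 - A * z ^+ 3 = 1 ->
  quasi_monogenic_cubic D L.
Proof.
move=> eD h; have ie := integral_basis_pure; split; first exact: dim_pure.
  exists e; split=> //; exists y, z; left; rewrite /index_form.
  have -> : y *: e`_1 + z *: e`_2 = pe 0 y z by rewrite peltE scale0r add0r.
  rewrite (index_pure _ _ _ pure_basis) h mul1r.
  have -> : \matrix_(k < 3, j < 3) coord e j e`_k = 1%:M.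
    by apply/matrixP => k j; rewrite !mxE (coord_free _ _ (basis_free pure_basis)).
  exact: det1.
by exists 3%N, e; split=> //; rewrite eD -det_gram_pure.
Qed.

Lemma quasi_monogenic_solution : quasi_monogenic L ->
  exists y z, B * y ^+ 3 - A * z ^+ 3 = 1.
Proof.
move=> [w [iw w0 [x2 [x3]]]]; have ie := integral_basis_pure.
have [bw _] := integral_basis_basis iw pure_basis integral_e.
rewrite /index_form; have [x [y [z ->]]] := span (x2 *: w`_1 + x3 *: w`_2).
rewrite (index_pure _ _ _ bw).
have /eqP := int_bases_det iw ie bw pure_basis; rewrite sqrf_eq1.
set T := \det _ => hT h.
have hs : B * y ^+ 3 - A * z ^+ 3 = 1 \/ B * y ^+ 3 - A * z ^+ 3 = -1.
  case/orP: hT h => /eqP ->; rewrite ?mulr1 ?mulrN1 //.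
  by case=> /(canRL (@opprK _)) ->; rewrite ?opprK; [right|left].
case: hs => hs; [by exists y, z|exists (- y), (- z)].
by rewrite -[RHS]opprK -hs; ring.
Qed.

End NotWild.

(** Comparing discriminants gives [a b = |det C| N]. If [a b^2] were [u = 1] or [u = -1] modulo 9,
    the integer of [integral_third] would make 3 divide [v *m C]; as [v] has first entry 1, the
    adjugate gives that 3 divides [det C], hence [a b], hence [u]. So [e] is an integral basis and
    [det C] is a unit. *)
Lemma pure_disc N D : (0 < N)%N -> D = N%:R ^+ 2 * - 27 -> has_discriminant L D ->
  [/\ (a * b)%N = N, ~~ (9 %| a%:Z * b%:Z ^+ 2 - 1)%Z
    & ~~ (9 %| a%:Z * b%:Z ^+ 2 + 1)%Z].
Proof.
move=> N0 eD hD; have be_ := pure_basis.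
have [w [C [iw bw dC C0 hC]]] := disc_compare be_ integral_e hD.
have idx : (a * b)%N = (`|\det C| * N)%N.
  have h : (A * B) ^+ 2 = ((\det C)%:~R * N%:R) ^+ 2.
    apply: (@mulfI _ (- 27)) => //; rewrite -det_gram_pure dC eD; ring.
  have : ((a * b) ^ 2)%N = ((`|\det C| * N) ^ 2)%N.
    apply/eqP; rewrite -(eqr_nat rat) !natrX !natrM h !exprMn.
    suff -> : ((`|\det C|%N)%:R : rat) ^+ 2 = (\det C)%:~R ^+ 2 by [].
    by case: (\det C) => k //; rewrite NegzE abszN intrN sqrrN.
  by move/eqP; rewrite eqn_sqr => /eqP.
have wild (u : int) : u = 1 \/ u = -1 -> ~~ (9 %| a%:Z * b%:Z ^+ 2 - u)%Z.
  move=> hu; apply/negP => h9.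
  have gi := integral_third f gens hu h9.
  have [c hc] := (iw.2 _).1 gi.
  pose v : 'rV[int]_3 := \row_i [:: 1; u; b%:Z]`_i.
  have vC : v *m C = 3 *: (\row_j c j).
    apply/rowP => j; rewrite !mxE; apply/eqP; rewrite -(eqr_int rat); apply/eqP.
    transitivity (coord w j (3 *: pe (1 / 3) (u%:~R / 3) (B / 3))); last first.
      rewrite hc linearZ /= intrM; congr (_ * _).
      transitivity (coord w j (\sum_(i < 3) (c i)%:~R *: w`_i)).
        by congr (coord w j _); apply: eq_bigr => i _; rewrite scaler_int.
      by rewrite (coord_sum_free _ _ (basis_free bw)).
    have -> : 3 *: pe (1 / 3) (u%:~R / 3) (B / 3)
        = \sum_(i < 3) (v 0 i)%:~R *: e`_i.
      rewrite -in_algM pelt_scale peltE !big_ord_recl big_ord0 addr0 addrA !mxE /=.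
      by congr (_ *: _ + _ *: _ + _ *: _); field.
    rewrite linear_sum rmorph_sum; apply: eq_bigr => i _; rewrite linearZ /= intrM.
    congr (_ * _); rewrite hC.
    by rewrite (coord_sum_free _ _ (basis_free bw)) mxE.
  have d3 : (3 %| \det C)%Z.
    have := congr1 (fun X => (X *m \adj C) 0 0) vC.
    rewrite -mulmxA mul_mx_adj mul_mx_scalar -scalemxAl !mxE /= mulr1 => ->.
    exact: dvdz_mulr.
  have ab3 : (3 %| a * b)%N by rewrite idx dvdn_mulr // -dvdzE.
  have : (3 %| u)%Z.
    have -> : u = a%:Z * b%:Z * b%:Z - (a%:Z * b%:Z ^+ 2 - u) by ring.
    apply: rpredB; first by rewrite -PoszM dvd3M dvdzE /= ab3.
    by apply: dvdz_trans h9.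
  by case: hu => ->.
have nw1 : ~~ (9 %| a%:Z * b%:Z ^+ 2 - 1)%Z by apply: wild; left.
have nw2 : ~~ (9 %| a%:Z * b%:Z ^+ 2 + 1)%Z by have := wild (-1); rewrite opprK; apply; right.
split=> //; rewrite idx.
have ie := integral_basis_pure nw1 nw2.
have dT := int_bases_det iw ie bw be_.
have eT : \matrix_(k < 3, j < 3) coord w j e`_k = map_mx intr C.
  apply/matrixP => k j; rewrite !mxE hC (coord_sum_free _ _ (basis_free bw)).
  by rewrite mxE.
move: dT; rewrite eT det_map_mx -rmorphXn -[1]/(1%:~R : rat) => /eqP.
rewrite eqr_int => /eqP /(congr1 absz); rewrite abszX => e1.
have /eqP -> : `|\det C|%N == 1%N by rewrite -eqn_sqr e1.
by rewrite mul1n.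
Qed.

End PureField.

(** * Isomorphisms between pure cubic fields *)

Definition pure_field (L : fieldExtType rat) (a b : nat) : Prop :=
  exists al be : L, pure_gens a b al be /\
    forall x, exists x0 y0 z0, x = pelt (in_alg L : {rmorphism rat -> L}) al be x0 y0 z0.

Lemma pure_field_swap L a b : pure_field L a b -> pure_field L b a.
Proof.
case=> al [be [[e1 e2 e3] span]]; exists be, al; split.
  by split; rewrite // mulrC e3 mulnC.
move=> x; have [x0 [y0 [z0 ->]]] := span x; exists x0, z0, y0.
by rewrite /pelt addrAC.
Qed.

Lemma iso_in_alg (L L' : fieldExtType rat) (g : {rmorphism L -> L'}) r :
  g (in_alg L r) = in_alg L' r.
Proof. by rewrite /= !alg_num_field fmorph_rat. Qed.

Lemma iso_pelt (L L' : fieldExtType rat) (g : {rmorphism L -> L'}) al be x y z :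
  g (pelt (in_alg L : {rmorphism rat -> L}) al be x y z)
  = pelt (in_alg L' : {rmorphism rat -> L'}) (g al) (g be) x y z.
Proof. by rewrite /pelt !rmorphD !rmorphM !iso_in_alg. Qed.

Lemma pure_field_iso L L' a b : field_iso L L' -> pure_field L a b -> pure_field L' a b.
Proof.
move=> [g [h gK hK]] [al [be [[e1 e2 e3] span]]]; exists (g al), (g be); split.
  split; [have := e1|have := e2|have := e3] => /(congr1 g);
    by rewrite ?rmorphXn ?rmorphM ?rmorph_nat.
move=> x; have [x0 [y0 [z0 hx]]] := span (h x); exists x0, y0, z0.
by rewrite -iso_pelt -hx hK.
Qed.

Section CubicRadicals.
Variables (K : fieldType) (f : {rmorphism rat -> K}) (a b : nat) (al be : K).
Hypotheses (a_gt0 : (0 < a)%N) (b_gt0 : (0 < b)%N).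
Hypothesis gens : pure_gens a b al be.
Hypothesis nc : not_cube (a * b ^ 2).

Lemma charpoly_cube (g : K) m t e d :
    m%:R - f t * g ^+ 2 + f e * g - f d = 0 ->
  f (m%:R - d) + f e * g + f (- t) * g ^+ 2 = 0.
Proof. by move=> h; rewrite -[RHS]h rmorphB rmorphN rmorph_nat; ring. Qed.

(* A cube root of a rational number has trace zero, as has its square, so it is
   a multiple of [al] or of [be]. *)
Lemma pelt_cube_rat x y z m : pelt f al be x y z ^+ 3 = m%:R -> not_cube m ->
  m%:R = (a * b ^ 2)%:R * y ^+ 3 \/ m%:R = (a ^ 2 * b)%:R * z ^+ 3.
Proof.
move=> e3 ncm.
have yz : (y != 0) || (z != 0).
  rewrite -negb_and; apply/negP => /andP[/eqP y0 /eqP z0]; apply: (ncm x).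
  by apply: (fmorph_inj f); rewrite rmorphXn rmorph_nat -e3 y0 z0 -pelt_scalar.
have := pelt_charpoly f gens x y z; rewrite /= e3 => /charpoly_cube.
case/(pelt_free3 b_gt0 gens nc yz) => h1 h2 h3.
have x0 : x = 0.
  by move/eqP: h3; rewrite oppr_eq0 /ptr mulf_eq0 /= => /eqP.
have A0 : a%:R != 0 :> rat by rewrite pnatr_eq0 -lt0n.
have B0 : b%:R != 0 :> rat by rewrite pnatr_eq0 -lt0n.
move/eqP: h1; rewrite subr_eq0 /pnorm x0 => /eqP ->.
move/eqP: h2; rewrite /pe2 x0 expr0n sub0r mulrN oppr_eq0 !mulf_eq0 pnatr_eq0 (negPf A0) (negPf B0) /=.
by case/orP=> /eqP ->; [right|left]; rewrite !natrM ?natrX; ring.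
Qed.

End CubicRadicals.

Section PureIso.
Variables (a b : nat).
Hypotheses (a_gt0 : (0 < a)%N) (b_gt0 : (0 < b)%N).
Hypothesis nc : not_cube (a * b ^ 2).

Lemma iso_pure_field L L' : pure_field L a b -> pure_field L' a b -> field_iso L L'.
Proof.
move=> [al [be [gens span]]] [al' [be' [gens' span']]].
pose f : {rmorphism rat -> L} := in_alg L; pose f' : {rmorphism rat -> L'} := in_alg L'.
pose e : 3.-tuple L := [tuple 1; al; be]; pose e' : 3.-tuple L' := [tuple 1; al'; be'].
pose phi (x : L) : L' := pelt f' al' be' (coord e 0 x) (coord e 1 x) (coord e 2%:R x).
pose psi (x : L') : L := pelt f al be (coord e' 0 x) (coord e' 1 x) (coord e' 2%:R x).
have phiE x y z : phi (pelt f al be x y z) = pelt f' al' be' x y z.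
  by rewrite /phi !(coord_pelt b_gt0 gens nc span).
have psiE x y z : psi (pelt f' al' be' x y z) = pelt f al be x y z.
  by rewrite /psi !(coord_pelt b_gt0 gens' nc span').
have phiB : zmod_morphism phi.
  move=> u v; have [x [y [z ->]]] := span u; have [x' [y' [z' ->]]] := span v.
  by rewrite pelt_sub !phiE pelt_sub.
have phiM : monoid_morphism phi.
  split=> [|u v]; first by rewrite (pelt_one f al be) phiE -pelt_one.
  have [x [y [z ->]]] := span u; have [x' [y' [z' ->]]] := span v.
  by rewrite (pelt_mul _ gens) !phiE (pelt_mul _ gens').
pose phiA := GRing.isZmodMorphism.Build L L' phi phiB.
pose phiMM := GRing.isMonoidMorphism.Build L L' phi phiM.
pose phiR : {rmorphism L -> L'} := HB.pack phi phiA phiMM.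
exists phiR; exists psi => [u|u].
  by have [x [y [z ->]]] := span u; rewrite [phiR _]phiE psiE.
by have [x [y [z ->]]] := span' u; rewrite psiE [phiR _]phiE.
Qed.

Lemma pure_field_cubes L a' b' : (0 < a')%N -> (0 < b')%N ->
    pure_field L a b -> pure_field L a' b' -> not_cube (a' * b' ^ 2) ->
  (exists y : rat, (a' * b' ^ 2)%:R = (a * b ^ 2)%:R * y ^+ 3) \/
  (exists z : rat, (a' * b' ^ 2)%:R = (a ^ 2 * b)%:R * z ^+ 3).
Proof.
move=> a'0 b'0 [al [be [gens span]]] [al' [be' [gens' _]]] nc'.
have [x [y [z e]]] := span al'; have := al_cube a'0 b'0 gens'; rewrite e => h.
by have [] := pelt_cube_rat a_gt0 b_gt0 gens nc h nc'; [left; exists y|right; exists z].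
Qed.

End PureIso.

Lemma cube_root_pure a b : (0 < a)%N -> (0 < b)%N ->
  pure_field (cube_root_field (a * b ^ 2)) a b.
Proof.
move=> a0 b0; rewrite /cube_root_field.
case: num_field_exists => L [LC [zs Dzs gen]] /=.
case: zs Dzs gen => [|al [|? ?]] // [Dal] gen.
have al3 : al ^+ 3 = (a * b ^ 2)%:R.
  by apply: (fmorph_inj LC); rewrite rmorphXn /= Dal rootCK // rmorph_nat.
pose f : {rmorphism rat -> L} := in_alg L.
have bL : b%:R != 0 :> L by rewrite -(rmorph_nat f) fmorph_eq0 pnatr_eq0 -lt0n.
exists al, (al ^+ 2 / b%:R); split; first exact: pure_gens_sqr.
have deg3 : (adjoin_degree 1 al <= 3)%N.
  have h : minPoly 1 al %| 'X^3 - (al ^+ 3)%:P.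
    apply: minPoly_dvdp; last by rewrite /root !hornerE subrr.
    rewrite rpredB ?rpredX ?polyOverX // polyOverC al3.
    by rewrite -(rmorph_nat f); apply: scalar_in1.
  have := dvdp_leq (monic_neq0 (monicXnsubC _ (isT : 0 < 3)%N)) h.
  by rewrite size_minPoly size_XnsubC.
move=> x; have xin : x \in <<1; al>>%VS by rewrite -adjoin_seq1 gen memvf.
set p := Fadjoin_poly 1 al x.
have coef i : exists r, p`_i = f r.
  by apply/mem1_rat; apply/polyOverP; apply: Fadjoin_polyOver.
have [r0 c0] := coef 0%N; have [r1 c1] := coef 1%N; have [r2 c2] := coef 2%N.
exists r0, r1, (r2 * b%:R); rewrite -(Fadjoin_poly_eq xin) (@horner_coef_wide _ 3); last first.
  by rewrite (leq_trans (size_Fadjoin_poly _ _ _)).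
rewrite !big_ord_recl big_ord0 addr0 addrA -/p /= c0 c1 c2 expr0 mulr1 expr1 /pelt.
congr (_ + _); rewrite rmorphM rmorph_nat -[RHS]mulrA; congr (_ * _).
by rewrite [RHS]mulrCA divff // mulr1.
Qed.

(** * Cubic fields attached to points *)

Lemma F3_cases (x : 'F_3) : [\/ x = 0, x = 1 | x = -1].
Proof.
by case: x => [[|[|[|?]]] h] //; [constructor 1|constructor 2|constructor 3]; apply: val_inj.
Qed.

Lemma prod_primes_squarefree N : (0 < N)%N -> squarefree N -> (\prod_(q <- primes N) q)%N = N.
Proof.
move=> N0 sqf; rewrite [RHS](prod_prime_decomp N0) prime_decompE big_map /= !big_seq.
apply: eq_bigr => q; rewrite mem_primes => /and3P[pr _ qN].
have -> : logn q N = 1%N; last by rewrite expn1.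
apply/eqP; rewrite eqn_leq logn_gt0 mem_primes pr N0 qN andbT leqNgt.
by rewrite -pfactor_dvdn // sqf.
Qed.

Section LiftProduct.
Variables (s : nat) (p : s.-tuple nat).
Hypothesis p_prime : forall i, prime (tnth p i).
Hypothesis p_uniq : uniq p.
Implicit Types lam : 'rV['F_3]_s.

(** For [e = 1] and [e = -1] these are the factors in [lift_prod p lam = a b^2], since -1 lifts to
    2. *)
Definition level_prod lam (e : 'F_3) : nat := (\prod_(i < s | lam 0%R i == e) tnth p i)%N.

Lemma level_prod_gt0 lam e : (0 < level_prod lam e)%N.
Proof. by apply: prodn_cond_gt0 => i _; rewrite prime_gt0. Qed.

Lemma level_prodN lam e : level_prod (- lam) e = level_prod lam (- e).
Proof. by apply: eq_bigl => i; rewrite mxE eqr_oppLR. Qed.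

Lemma lift_prod_level lam : lift_prod p lam = (level_prod lam 1%R * level_prod lam (-1)%R ^ 2)%N.
Proof.
rewrite /lift_prod /level_prod -mulnn !(big_mkcond (fun i => lam 0 i == _)) -!big_split /=.
by apply: eq_bigr => i _; case: (F3_cases (lam 0 i)) => ->; rewrite /= ?muln1 ?mul1n.
Qed.

Lemma level_prod_mul lam : (forall i, lam 0 i != 0) ->
  (level_prod lam 1%R * level_prod lam (-1)%R)%N = (\prod_(q <- p) q)%N.
Proof.
move=> h; rewrite big_tuple /level_prod !(big_mkcond (fun i => lam 0 i == _)) -big_split /=.
apply: eq_bigr => i _; case: (F3_cases (lam 0 i)) (h i) => ->; rewrite ?eqxx //=.
  by rewrite muln1.
by rewrite mul1n.
Qed.

Lemma not_cube_lift_prod lam i : lam 0 i != 0 -> not_cube (lift_prod p lam).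
Proof.
move=> + t et; rewrite -(vF_lift_prod p_prime p_uniq lam i) -et vF_cube ?eqxx //.
by apply: cube_neq0; rewrite et pnatr_eq0 -lt0n lift_prod_gt0.
Qed.

Lemma lift_prod_inj lam lam' (y : rat) :
  (lift_prod p lam)%:R = (lift_prod p lam')%:R * y ^+ 3 -> lam = lam'.
Proof.
move=> e; apply/rowP => i; rewrite -!(vF_lift_prod p_prime p_uniq) e vF_mul_cube //.
  by rewrite pnatr_eq0 -lt0n lift_prod_gt0.
apply: contra_eq_neq e => ->; rewrite expr0n mulr0 pnatr_eq0 -lt0n.
exact: lift_prod_gt0.
Qed.

Lemma vF_lift_prod_out lam q : prime q -> q \notin p -> vF q (lift_prod p lam)%:R = 0.
Proof.
move=> pr qp; rewrite vF.unlock vq_nat /lift_prod logn_prodn => [|i]; last first.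
  by rewrite expn_gt0 prime_gt0.
rewrite big1 // => i _; rewrite lognX logn_prime //.
by case: eqP qp => [->|]; rewrite ?mem_tnth ?muln0.
Qed.

End LiftProduct.

(** * Points of the curve and solutions of [b y^3 - a z^3 = 1] *)

Section Solutions.
Variables (N : nat) (D c : rat).
Hypothesis N_gt0 : (0 < N)%N.
Hypothesis D_eq : D = N%:R ^+ 2 * - 27.
Hypothesis c_eq : c = N%:R * 27.
Variables (s : nat) (p : s.-tuple nat).
Hypothesis p_eq : perm_eq p (primes N).
Notation E := (ell (- 27 * D) rat).
Variables (lam : 'rV['F_3]_s) (a b : nat).
Hypothesis lam_neq0 : lam <> 0.
Hypothesis lam_prod : lift_prod p lam = (a * b ^ 2)%N.
Hypothesis ab_N : (a * b)%N = N.
Notation A := (a%:R : rat).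
Notation B := (b%:R : rat).

Let m : rat := (lift_prod p lam)%:R.
Let prs := p_prime N_gt0 p_eq.
Let uni := p_uniq p_eq.

Lemma m_neq0 : m != 0. Proof. by rewrite pnatr_eq0 -lt0n (lift_prod_gt0 prs). Qed.
Lemma mE : m = A * B ^+ 2. Proof. by rewrite /m lam_prod natrM natrX. Qed.

Lemma AB_neq0 : A != 0 /\ B != 0.
Proof. by apply/andP; move: m_neq0; rewrite mE mulf_eq0 expf_eq0 negb_or. Qed.

Lemma norm_neq0 : 216 * (A * B) != 0.
Proof.
have [A0 B0] := AB_neq0; apply: mulf_neq0; first by rewrite pnatr_eq0.
exact: mulf_neq0.
Qed.

Lemma vF_of_descent (X : E) x y q : coords X = Some (x, y) -> descent c p X = lam ->
  prime q -> vF q (kap c y) = vF q m.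
Proof.
move=> eX eL pr; have [qp|qp] := boolP (q \in p).
  have /tnthP[i ->] := qp; rewrite (vF_lift_prod prs uni) -eL mxE.
  by rewrite /vkap eX.
rewrite (vF_lift_prod_out prs) //.
have qN : ~~ (q %| N)%N by move: qp; rewrite (mem_p N_gt0 p_eq) pr.
by have := vkap_unramified N_gt0 D_eq c_eq X pr qN; rewrite /vkap eX.
Qed.

Lemma solution_of_descent (X : E) : descent c p X = lam ->
  exists y z, B * y ^+ 3 - A * z ^+ 3 = 1.
Proof.
move=> eL; have m0 := m_neq0; have [A0 B0] := AB_neq0.
case eX: (coords X) => [[x y]|]; last first.
  by case: lam_neq0; rewrite -eL; apply/rowP => i; rewrite !mxE /vkap eX.
have := coordsP X; rewrite eX (on_curveE D_eq c_eq) => /eqP h.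
have k0 := kap_neq0 N_gt0 c_eq h.
have [t et] : exists t, kap c y / m = t ^+ 3.
  apply: cube_vF => [|q pr]; first by rewrite mulf_neq0 ?invr_eq0.
  by rewrite vFM ?invr_eq0 // vFV // (vF_of_descent eX eL pr) subrr.
have t0 : t != 0 by apply: cube_neq0; rewrite -et mulf_neq0 ?invr_eq0.
have ek : kap c y = m * t ^+ 3 by rewrite -et mulrC divfK.
have [u [v [_ eu ev]]] := kapE N_gt0 c_eq h; rewrite ek in eu ev.
(* Dividing [m^-1 (v / t)^3 - m (t u)^3 = 8 c = 216 a b] by [216 a b] and inserting [m = a b^2]
   gives the equation in these variables. *)
exists (- (t * u) / 6), (- (v / t) / (6 * (A * B))).
have eN : 4 * (y + c) - 4 * (y - c) = 216 * (A * B).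
  by rewrite -natrM ab_N c_eq; ring.
transitivity ((4 * (y + c) - 4 * (y - c)) / (216 * (A * B))); last first.
  rewrite eN; exact: divff norm_neq0.
by rewrite eu ev mE; field; rewrite A0 B0 t0.
Qed.

Lemma descent_of_solution (y z : rat) : B * y ^+ 3 - A * z ^+ 3 = 1 ->
  exists X : E, descent c p X = lam.
Proof.
move=> h; have m0 := m_neq0; have [A0 B0] := AB_neq0.
(* The substitution of [solution_of_descent] read backwards: [U] and [W] stand for [t u] and
   [v / t]. *)
pose U := - 6 * y; pose W := - 6 * (A * B) * z.
pose x0 := U * W / 4; pose y0 := (m * U ^+ 3 + W ^+ 3 / m) / 8.
have eN : c = A * B * 27 by rewrite -natrM ab_N.
have dif : W ^+ 3 / m - m * U ^+ 3 = 8 * c.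
  transitivity (216 * (A * B) * (B * y ^+ 3 - A * z ^+ 3)).
    by rewrite mE /U /W; field; rewrite A0 B0.
  by rewrite h eN; ring.
have e1 : 4 * (y0 - c) = m * U ^+ 3.
  transitivity (4 * y0 - (8 * c) / 2); first by field.
  by rewrite -dif /y0; field.
have e2 : 4 * (y0 + c) = m^-1 * W ^+ 3.
  transitivity (4 * y0 + (8 * c) / 2); first by field.
  by rewrite -dif /y0; field.
have on : on_curve (- 27 * D) (Some (x0, y0)).
  rewrite (on_curveE D_eq c_eq) -subr_eq; apply/eqP.
  transitivity (4 * (y0 - c) * (4 * (y0 + c)) / 16); first by field.
  by rewrite e1 e2 /x0; field.
exists (Ell on); apply/rowP => i; rewrite mxE /vkap /=.
rewrite -(vF_lift_prod prs uni lam i) -/m /kap; case: (eqVneq y0 c) => ey.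
  have n2 : 4 * (y0 + c) != 0 by rewrite ey mulf_neq0 ?(cDc N_gt0 c_eq).
  have W0 : W != 0.
    by apply: contraNneq n2 => e; rewrite e2 e expr0n mulr0.
  by rewrite e2 vFV ?vF_mul_cube ?vFV ?opprK ?invr_eq0 // -e2.
have n1 : 4 * (y0 - c) != 0 by rewrite mulf_neq0 // subr_eq0.
have U0 : U != 0.
  by apply: contraNneq n1 => e; rewrite e1 e expr0n mulr0.
by rewrite e1 vF_mul_cube.
Qed.

End Solutions.

Lemma F3_line (vT : vectType 'F_3) (u v : vT) : <[u]>%VS = <[v]>%VS -> u != 0 ->
  v = u \/ v = - u.
Proof.
move=> e u0; have : u \in <[v]>%VS by rewrite -e memv_line.
case/vlineP => k; case: (F3_cases k) => -> eu.
- by rewrite eu scale0r eqxx in u0.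
- by left; rewrite eu scale1r.
by right; rewrite eu scaleN1r opprK.
Qed.

Lemma cubic_pure_field (L : fieldExtType rat) N D : \dim {:L} = 3%N ->
    (0 < N)%N -> D = N%:R ^+ 2 * - 27 -> has_discriminant L D ->
  exists a b, [/\ (0 < a)%N && (0 < b)%N, squarefree (a * b), not_cube (a * b ^ 2)
    & pure_field L a b].
Proof.
move=> dimL N0 eD hD.
have [a [b [al [be [ab0 sqf gens nc al1]]]]] := cubic_pure dimL N0 eD hD.
exists a, b; split=> //; exists al, be; split=> // x.
have [r0 [r1 [r2 ->]]] := cubic_coords dimL x al1.
exists r0, r1, (r2 * b%:R); case: gens => e1 _ _.
by rewrite /celt /pelt e1 rmorphM rmorph_nat mulrA.
Qed.

Lemma nat_cube_mod9 (a b : nat) :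
  ((a * b ^ 2)%N != 1 %[mod 9])%Z = ~~ (9 %| a%:Z * b%:Z ^+ 2 - 1)%Z /\
  ((a * b ^ 2)%N != -1 %[mod 9])%Z = ~~ (9 %| a%:Z * b%:Z ^+ 2 + 1)%Z.
Proof. by rewrite !eqz_mod_dvd opprK PoszM -[(b ^ 2)%N]mulnn PoszM expr2. Qed.

Section Bijection.
Variables (N : nat) (D c : rat).
Hypothesis N_gt0 : (0 < N)%N.
Hypothesis D_eq : D = N%:R ^+ 2 * - 27.
Hypothesis c_eq : c = N%:R * 27.
Variables (s : nat) (p : s.-tuple nat).
Hypothesis p_eq : perm_eq p (primes N).
Hypothesis sqfN : squarefree N.
Variable V : {vspace 'rV['F_3]_s}.
Hypothesis memV : forall v, v \in V <-> exists X : ell (- 27 * D) rat, descent c p X = v.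
Implicit Types (lam : 'rV['F_3]_s) (L : fieldExtType rat).
Notation a_ lam := (level_prod p lam 1).
Notation b_ lam := (level_prod p lam (-1)).
Let prs := p_prime N_gt0 p_eq.
Let uni := p_uniq p_eq.

Lemma prod_p : (\prod_(q <- p) q)%N = N.
Proof. by rewrite (perm_big _ p_eq) prod_primes_squarefree. Qed.

Lemma admissible_neq0 lam : admissible_vector p lam -> lam != 0.
Proof.
case=> _ n1 _; apply: contraNneq n1 => ->.
by rewrite /lift_prod big1 // => i _; rewrite mxE.
Qed.

Lemma admissible_not_cube lam : admissible_vector p lam -> not_cube (a_ lam * b_ lam ^ 2).
Proof.
move=> adm; rewrite -lift_prod_level.
have /rV0Pn[i li] := admissible_neq0 adm.
exact: (not_cube_lift_prod prs uni li).
Qed.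

Lemma pure_lift_prod lam : pure_field (cube_root_field (lift_prod p lam)) (a_ lam) (b_ lam).
Proof. by rewrite lift_prod_level; apply: cube_root_pure; apply: level_prod_gt0. Qed.

(** The only other generator of the line is [- lam], which exchanges the two factors and hence [al]
    with [be]; the field is the same. *)
Lemma subspace_field_pure lam L : admissible_vector p lam ->
  subspace_field p <[lam]>%VS L <-> pure_field L (a_ lam) (b_ lam).
Proof.
move=> adm; split=> [[lam1 e iso]|pL]; last first.
  exists lam => //; apply: (iso_pure_field (level_prod_gt0 prs lam (-1))) pL.
    exact: admissible_not_cube.
  exact: pure_lift_prod.
have := pure_field_iso iso (pure_lift_prod lam1).
have [->|->] := F3_line e (admissible_neq0 adm) => //.
by rewrite !level_prodN opprK; apply: pure_field_swap.
Qed.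

Lemma admissible_bijection :
  bijection_up_to_iso (admissible_subspace p V) (quasi_monogenic_cubic D)
    (subspace_field p).
Proof.
have A0 lam : (0 < a_ lam)%N := level_prod_gt0 prs lam 1.
have B0 lam : (0 < b_ lam)%N := level_prod_gt0 prs lam (-1).
split.
- move=> U [_ [lam -> adm]]; exists (cube_root_field (lift_prod p lam)).
  exact/subspace_field_pure/pure_lift_prod.
- move=> U L L' [_ [lam -> adm]] /(subspace_field_pure _ adm) pL.
  rewrite subspace_field_pure //; split=> [|iso]; last exact: pure_field_iso pL.
  exact: (iso_pure_field (B0 lam) (admissible_not_cube adm)).
- move=> U L [UV [lam eU adm]]; rewrite eU => /(subspace_field_pure _ adm).
  case=> al [be [gens span]].
  have lamV : lam \in V by rewrite memvE -eU.
  have [X eX] := (memV lam).1 lamV.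
  have [l0 n1 n2] := adm.
  have abN : (a_ lam * b_ lam)%N = N by rewrite level_prod_mul // prod_p.
  have lam0 : lam <> 0 by apply/eqP/admissible_neq0.
  have [y [z h]] := solution_of_descent N_gt0 D_eq c_eq p_eq lam0 (lift_prod_level p lam) abN eX.
  have [m1 m2] := nat_cube_mod9 (a_ lam) (b_ lam).
  rewrite lift_prod_level m1 in n1; rewrite lift_prod_level m2 in n2.
  apply: (pure_quasi_monogenic_cubic (A0 lam) (B0 lam) gens (admissible_not_cube adm) span _ n1 n2 _ h).
    by rewrite abN.
  by rewrite -natrM abN D_eq mulrC.
- move=> U U' L [_ [lam -> adm]] [_ [lam' -> adm']].
  move=> /(subspace_field_pure _ adm) pL /(subspace_field_pure _ adm') pL'.
  have [] := pure_field_cubes (A0 lam) (B0 lam) (admissible_not_cube adm)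
    (A0 lam') (B0 lam') pL pL' (admissible_not_cube adm').
    by rewrite -!lift_prod_level => -[y /(lift_prod_inj prs uni) ->].
  (* [a^2 b] belongs to [- lam], which spans the same line as [lam]. *)
  case=> z e; have e' : (lift_prod p lam')%:R = (lift_prod p (- lam))%:R * z ^+ 3 :> rat.
    by rewrite !lift_prod_level e !level_prodN opprK mulnC.
  rewrite (lift_prod_inj prs uni e'); apply/eqP.
  by rewrite eqEsubv -!memvE memvN memv_line -memvN memv_line.
move=> L [dimL qm hD].
have [a [b [/andP[a0 b0] sqf nc pL]]] := cubic_pure_field dimL N_gt0 D_eq hD.
have [al [be [gens span]]] := pL.
have [abN m1 m2] := pure_disc a0 b0 gens nc span sqf N_gt0 D_eq hD.
have [y [z h]] := quasi_monogenic_solution a0 b0 gens nc span sqf m1 m2 qm.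
(* The vector whose entries 1 mark the primes of [a] and whose entries -1 mark those of [b]; as
   [a b = N] is squarefree, it recovers both. *)
pose lam : 'rV['F_3]_s := \row_i (if (tnth p i %| a)%N then 1 else -1).
have l0 i : lam 0 i != 0 by rewrite mxE; case: ifP.
have ea : a_ lam = a.
  rewrite -[RHS](prod_primes_squarefree a0); last first.
    by move=> q pr; apply: contra (sqf q pr) => /dvdn_mulr ->.
  have -> : a_ lam = (\prod_(q <- p | q %| a) q)%N.
    by rewrite big_tuple; apply: eq_bigl => i; rewrite mxE; case: ifP.
  rewrite -big_filter; apply: perm_big; apply: uniq_perm; rewrite ?filter_uniq ?primes_uniq //.
  move=> q; rewrite mem_filter (mem_p N_gt0 p_eq) mem_primes a0 /= andbC -andbA.
  by congr (_ && _); apply/andb_idl => qa; rewrite -abN dvdn_mulr.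
have eb : b_ lam = b.
  by apply/eqP; rewrite -(eqn_pmul2l a0) abN -{1}ea level_prod_mul // prod_p.
have elam : lift_prod p lam = (a * b ^ 2)%N by rewrite lift_prod_level ea eb.
have adm : admissible_vector p lam.
  by have [n1 n2] := nat_cube_mod9 a b; split=> //; rewrite elam ?n1 ?n2.
have lamV : lam \in V.
  apply/memV; apply: (descent_of_solution N_gt0 D_eq c_eq p_eq elam abN h).
exists <[lam]>%VS; first by split; [rewrite -memvE | exists lam].
by apply/(subspace_field_pure _ adm); rewrite ea eb.
Qed.

End Bijection.

Theorem theorem7p13 (n n' : int) (n_neq0 : n != 0) (n_eq : n = 3 * n')
    (D : rat) (D_eq : D = - 3 * n%:~R ^+ 2)
    (s : nat) (p : s.-tuple nat) (p_eq : perm_eq p (primes `|n'|%N))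
    (zeta : algC) (zeta_prim : 3.-primitive_root zeta)
    (r : nat) (P : 'I_r.+1 -> ell (- 27 * D) rat)
    (P0_eq : coords (P ord0) = Some (0, 27 * `|n'|%:~R))
    (P_free : free_part_generators (fun i : 'I_r => P (lift ord0 i)))
    (M : 'M['F_3]_(r.+1, s))
    (M_rows : forall i, is_coef_vector zeta p (P i) (row i M)) :
  let V : {vspace 'rV['F_3]_s} := <<[seq row i M | i <- enum 'I_r.+1]>>%VS in
  cokernel_iso D V /\
  (squarefree_int n' ->
   bijection_up_to_iso (admissible_subspace p V) (quasi_monogenic_cubic D)
     (subspace_field p)).
Proof.
move=> V; set N := `|n'|%N in p_eq *.
have N_gt0 : (0 < N)%N.
  by rewrite absz_gt0; apply: contraNneq n_neq0 => e; rewrite n_eq e mulr0.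
have NE : `|n'|%:~R = N%:R :> rat by rewrite /N natr_absz.
have D_eq' : D = N%:R ^+ 2 * - 27.
  rewrite D_eq n_eq -NE intr_norm real_normK ?num_real // rmorphM exprMn.
  by ring.
have P0_eq' : coords (P ord0) = Some (0, N%:R * 27 : rat).
  by rewrite P0_eq NE mulrC.
split; first exact: (cokernel_iso_descent N_gt0 D_eq' erefl zeta_prim p_eq P0_eq' P_free M_rows).
move=> sqf; apply: (admissible_bijection N_gt0 D_eq' erefl p_eq sqf) => v.
exact: (mem_descent N_gt0 D_eq' erefl zeta_prim p_eq P0_eq' P_free M_rows).
Qed.
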